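(* For every signature $\mathcal G$, the prop $\mathfrak F\mathcal G$ (constructed from the derivable typing judgments over $\mathcal G$ modulo the equality rule) is the free prop generated by $\mathcal G$. That is, with respect to the morphism of signatures from $\mathcal G$ to the underlying signature of $\mathfrak F\mathcal G$ which is the identity on objects and sends an arrow $f\in\mathcal G(\vec A;\vec B)$ to the class of the judgment $\vec x:\vec A\vdash \vec f(\vec x):\vec B$ (with $f(\vec x)$ placed among the scalar terms if $\vec B$ is empty, and with an arbitrary label if $\vec A$ is empty and $\vec B$ is not), every morphism of signatures $\omega$ from $\mathcal G$ to the underlying signature of a prop $\mathcal P$ extends uniquely to a morphism of props $\mathfrak F\mathcal G\to\mathcal P$.
   Context: **Props.** A prop $\mathcal P$ consists of a set $\mathrm{ob}(\mathcal P)$ of objects and a symmetric strict monoidal category (associators and unitors are identities) whose underlying monoid of objects is freely generated by $\mathrm{ob}(\mathcal P)$; so its objects are finite lists $(A,\dots,Z)$ of elements of $\mathrm{ob}(\mathcal P)$, with tensor given by concatenation and unit the empty list. A morphism of props $\omega:\mathcal P\to\mathcal Q$ is a function $\omega_0:\mathrm{ob}(\mathcal P)\to\mathrm{ob}(\mathcal Q)$ together with a strict symmetric monoidal functor acting on objects by applying $\omega_0$ elementwise to lists. **Signatures.** A signature $\mathcal G$ is a set of objects together with a set of arrows, each assigned a domain and a codomain that are finite lists of objects; $\mathcal G(\vec A;\vec B)$ is the set of arrows with domain $\vec A$ and codomain $\vec B$ (an omitted list is empty). A morphism of signatures is a function on objects and a function on arrows compatible with domains and codomains. The underlying signature of a prop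 has the same objects, and its arrows are the morphisms of the prop. **Terms.** Types are the objects of $\mathcal G$. Fix an infinite set $\mathfrak A$ of labels. A context $\Gamma$ is a finite list $x_1:A_1,\dots,x_m:A_m$ of distinct variables with types. Terms over $\Gamma$ are generated inductively by: the variables of $\Gamma$; for $f\in\mathcal G(;B_1,\dots,B_n)$ and $a\in\mathfrak A$: $f^a_{(k)}$ ($1\le k\le n$) if $n\ge2$, $f^a$ if $n=1$, and $f$ (no label) if $n=0$; for $f\in\mathcal G(A_1,\dots,A_m;B_1,\dots,B_n)$ with $m\ge1$ and terms $M_1,\dots,M_m$: $f_{(k)}(M_1,\dots,M_m)$ ($1\le k\le n$) if $n\ge 2$, and $f(M_1,\dots,M_m)$ if $n\le1$. For $m\ge 1$ write $\vec f(\vec M)$ for the list $(f_{(1)}(\vec M),\dots,f_{(n)}(\vec M))$ if $n\ge2$ and for $f(\vec M)$ if $n\le1$; for $m=0$ and $n\ge1$ write $\vec f^a$ for $(f^a_{(1)},\dots,f^a_{(n)})$ if $n\ge2$ and for $f^a$ if $n=1$. $N[\vec M/\vec x]$ denotes ordinary simultaneous substitution. **Typing judgments.** A typing judgment $\Gamma\vdash(M_1,\dots,M_n\mid Z_1,\dots,Z_p):\Delta$ has $M_i,Z_j$ terms over $\Gamma$ and $\Delta=(B_1,\dots,B_n)$ a list of types, each marked active or not active; the $Z_j$ are the scalar terms. If $p=0$ one writes $(\vec M)$. Permutations below act on positions in lists. The derivable judgments are generated by two rules. *Identity rule.* Let $\Gamma=\vec x:\vec A$; let $f_i\in\mathcal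 G(;\vec B_i)$ with $\vec B_i$ nonempty ($1\le i\le r$, $r\ge0$); let $h_1,\dots,h_s\in\mathcal G(;)$ ($s\ge0$); let $a_1,\dots,a_r\in\mathfrak A$ be pairwise distinct; and let $\sigma$ be a permutation of $(\vec A,\vec B_1,\dots,\vec B_r)$ preserving the relative order of the first entries of $\vec B_1,\dots,\vec B_r$. Then $\Gamma\vdash(\sigma(\vec x,\vec f_1^{a_1},\dots,\vec f_r^{a_r})\mid h_1,\dots,h_s):\sigma(\vec A,\vec B_1,\dots,\vec B_r)$ is derivable, with all types active. *Generator rule.* Suppose $\Gamma\vdash(\vec M_1,\dots,\vec M_r,\vec P_1,\dots,\vec P_s,\vec R\mid\vec Z):(\vec A_1,\dots,\vec A_r,\vec C_1,\dots,\vec C_s,\vec E)$ is derivable, where each $\vec A_i$ and each $\vec C_j$ contains at least one active type (the types in $\vec E$ may or may not be active) and $r+s\ge1$. Let $f_i\in\mathcal G(\vec A_i;\vec F_i)$ with $\vec F_i$ nonempty, $h_j\in\mathcal G(\vec C_j;)$, let $\sigma$ be a permutation of $(\vec F_1,\dots,\vec F_r,\vec E)$ preserving the relative order of the entries of $\vec E$ and the relative order of the first entries of $\vec F_1,\dots,\vec F_r$, and let $\tau$ be a shuffle of $(h_1(\vec P_1),\dots,h_s(\vec P_s))$ with $\vec Z$ (a permutation of the concatenation preserving relative order within each of the two lists). Then $\Gamma\vdash(\sigma(\vec f_1(\vec M_1),\dots,\vec f_r(\vec M_r),\vec R)\mid\tau(h_1(\vec P_1),\dots,h_s(\vec P_s),\vec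 Z)):\sigma(\vec F_1,\dots,\vec F_r,\vec E)$ is derivable, with the types coming from the $\vec F_i$ active and those from $\vec E$ not active. For an unmarked list $\Delta$, the judgment is called derivable if it is derivable for some assignment of activeness to $\Delta$. **Equality rule.** For $\Gamma\vdash(\vec M\mid Z_1,\dots,Z_n):\Delta$ derivable, $\rho\in S_n$ and a bijection $\sigma:\mathfrak A\to\mathfrak A$, set $(\vec M\mid Z_1,\dots,Z_n)=(\vec M^\sigma\mid Z^\sigma_{\rho1},\dots,Z^\sigma_{\rho n})$, where $(-)^\sigma$ applies $\sigma$ to all labels. **The prop $\mathfrak F\mathcal G$.** Its objects are those of $\mathcal G$; morphisms $\Gamma\to\Delta$ (contexts being regarded as lists of types, and judgments being taken up to renaming of the variables of $\Gamma$) are derivable judgments $\Gamma\vdash(\vec M\mid\vec Z):\Delta$ modulo the equality rule. The identity of $\vec A$ is $\vec x:\vec A\vdash(\vec x):\vec A$. The composite of $\Gamma\vdash(\vec M\mid\vec Y):\Delta$ and $\Delta\vdash(\vec N\mid\vec Z):\Phi$ (with representatives having disjoint sets of labels) is $\Gamma\vdash(\vec N[\vec M/\Delta]\mid\vec Z[\vec M/\Delta],\vec Y):\Phi$, where $[\vec M/\Delta]$ substitutes $\vec M$ for the variables of $\Delta$. The tensor product of $\Gamma\vdash(\vec M\mid\vec Y):\Delta$ and $\Phi\vdash(\vec N\mid\vec Z):\Psi$ (with disjoint labels and disjoint variables) is $\Gamma,\Phi\vdash(\vec M,\vec N\mid\vec Z,\vec Y):\Delta,\Psi$. The symmetry is $\vec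 x:\vec A,\vec y:\vec B\vdash(\vec y,\vec x):\vec B,\vec A$. *)

(* Defs.v *)
From mathcomp Require Import all_boot.
From mathcomp Require Import boolp classical_sets functions cardinality.
From Stdlib Require List Permutation.

Set Implicit Arguments.
Unset Strict Implicit.
Unset Printing Implicit Defensive.

Local Open Scope classical_set_scope.

Record signature := Signature {
  sob : Type;
  sarr : Type;
  sdom : sarr -> seq sob;
  scod : sarr -> seq sob }.

Record sig_mor (G H : signature) := SigMor {
  smob : sob G -> sob H;
  smarr : sarr G -> sarr H;
  smdom : forall f, sdom (smarr f) = map smob (sdom f);
  smcod : forall f, scod (smarr f) = map smob (scod f) }.

Section SigComp.
Variables (G H K : signature) (v : sig_mor H K) (u : sig_mor G H).

Lemma sig_comp_dom f :
  sdom (smarr v (smarr u f)) = map (smob v \o smob u) (sdom f).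
Proof. by rewrite smdom smdom map_comp. Qed.

Lemma sig_comp_cod f :
  scod (smarr v (smarr u f)) = map (smob v \o smob u) (scod f).
Proof. by rewrite smcod smcod map_comp. Qed.

Definition sig_comp : sig_mor G K :=
  @SigMor G K (smob v \o smob u) (smarr v \o smarr u)
    sig_comp_dom sig_comp_cod.
End SigComp.

Definition hom_cast (T : Type) (hom : T -> T -> Type) (A A' B B' : T)
    (eA : A = A') (eB : B = B') (f : hom A B) : hom A' B' :=
  match eA in _ = X, eB in _ = Y return hom X Y with
  | erefl, erefl => f
  end.

(* Composition is written in diagrammatic order.  Associativity and unit laws
   of the tensor hold strictly, i.e. up to transport along equality of lists
   of objects. *)
Record prop_structure (ob : Type) (hom : seq ob -> seq ob -> Type) :=
  PropStructure {
  idm : forall A, hom A A;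
  comp : forall A B C, hom A B -> hom B C -> hom A C;
  tens : forall A B C D, hom A B -> hom C D -> hom (A ++ C) (B ++ D);
  symm : forall A B, hom (A ++ B) (B ++ A);
  comp_idl : forall A B (f : hom A B), comp (idm A) f = f;
  comp_idr : forall A B (f : hom A B), comp f (idm B) = f;
  compA : forall A B C D (f : hom A B) (g : hom B C) (h : hom C D),
    comp f (comp g h) = comp (comp f g) h;
  tens_id : forall A B, tens (idm A) (idm B) = idm (A ++ B);
  tens_comp : forall A B C A' B' C' (f : hom A B) (g : hom B C)
      (f' : hom A' B') (g' : hom B' C'),
    tens (comp f g) (comp f' g') = comp (tens f f') (tens g g');
  tensA : forall A B A' B' A'' B''
      (f : hom A B) (f' : hom A' B') (f'' : hom A'' B''),
    hom_cast (catA A A' A'') (catA B B' B'') (tens f (tens f' f''))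
    = tens (tens f f') f'';
  tens_unitl : forall A B (f : hom A B), tens (idm [::]) f = f;
  tens_unitr : forall A B (f : hom A B),
    hom_cast (cats0 A) (cats0 B) (tens f (idm [::])) = f;
  symm_nat : forall A B A' B' (f : hom A B) (f' : hom A' B'),
    comp (tens f f') (symm B B') = comp (symm A A') (tens f' f);
  symmK : forall A B, comp (symm A B) (symm B A) = idm (A ++ B);
  symm_hexagon : forall A B C,
    hom_cast (catA A B C) (esym (catA B C A)) (symm A (B ++ C))
    = comp (tens (symm A B) (idm C))
        (hom_cast (catA B A C) erefl (tens (idm B) (symm A C))) }.

Record prop_cat := PropCat {
  pob : Type;
  phom : seq pob -> seq pob -> Type;
  pstr : prop_structure phom }.

Record prop_mor (P Q : prop_cat) := PropMor {
  pmob : pob P -> pob Q;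
  pmhom : forall A B : seq (pob P),
    phom A B -> phom (map pmob A) (map pmob B);
  pm_id : forall A, pmhom (idm (pstr P) A) = idm (pstr Q) (map pmob A);
  pm_comp : forall A B C (f : phom A B) (g : phom B C),
    pmhom (comp (pstr P) f g) = comp (pstr Q) (pmhom f) (pmhom g);
  pm_tens : forall A B C D (f : phom A B) (g : phom C D),
    hom_cast (map_cat pmob A C) (map_cat pmob B D)
      (pmhom (tens (pstr P) f g))
    = tens (pstr Q) (pmhom f) (pmhom g);
  pm_symm : forall A B,
    hom_cast (map_cat pmob A B) (map_cat pmob B A) (pmhom (symm (pstr P) A B))
    = symm (pstr Q) (map pmob A) (map pmob B) }.

Record arrow (P : prop_cat) := Arrow {
  asrc : seq (pob P);
  atgt : seq (pob P);
  ahom : phom asrc atgt }.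

Definition underlying (P : prop_cat) : signature :=
  @Signature (pob P) (arrow P) (@asrc P) (@atgt P).

Definition underlying_mor (P Q : prop_cat) (F : prop_mor P Q) :
    sig_mor (underlying P) (underlying Q) :=
  @SigMor (underlying P) (underlying Q) (pmob F)
    (fun f : arrow P => Arrow (pmhom F (ahom f)))
    (fun=> erefl) (fun=> erefl).

(* A permutation of n positions is the list s of source positions: the j-th
   entry of [permute s l] is the entry of l at position s_j. *)
Definition is_permutation (n : nat) (s : seq nat) : bool := perm_eq s (iota 0 n).

Definition permute (T : Type) (s : seq nat) (l : seq T) : seq T :=
  pmap (onth l) s.

Definition keeps_order (P : pred nat) (s : seq nat) : bool :=
  sorted ltn (filter P s).

(* Positions of the first entries of consecutive blocks of sizes ns, the first
   block starting at position m. *)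
Definition block_starts (m : nat) (ns : seq nat) : seq nat :=
  [seq m + sumn (take i ns) | i <- iota 0 (size ns)].

Section TypeTheory.
Variables (G : signature) (L : Type).
Implicit Types (A B : seq (sob G)) (f h : sarr G).

(* Variables of a context are represented by their positions in it, which
   amounts to working up to renaming; output indices k are counted from 0.
   [Cst f a k] is f^a_(k+1), or f^a if f has one output; [App f Ms k] is
   f_(k+1)(Ms), or f(Ms) if f has one output; [Scal f Ms] is f(Ms), or f if Ms
   is empty, for f without outputs.  Arities are imposed by [is_term]. *)
Inductive term : Type :=
| Var of nat
| Cst of sarr G & L & nat
| App of sarr G & seq term & nat
| Scal of sarr G & seq term.

Inductive is_term (m : nat) : term -> Prop :=
| is_Var i : i < m -> is_term m (Var i)
| is_Cst f a k : sdom f = [::] -> k < size (scod f) -> is_term m (Cst f a k)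
| is_App f Ms k : sdom f <> [::] -> size Ms = size (sdom f) ->
    k < size (scod f) -> List.Forall (is_term m) Ms -> is_term m (App f Ms k)
| is_Scal f Ms : scod f = [::] -> size Ms = size (sdom f) ->
    List.Forall (is_term m) Ms -> is_term m (Scal f Ms).

Fixpoint subst (r : nat -> term) (t : term) : term :=
  match t with
  | Var i => r i
  | Cst f a k => Cst f a k
  | App f Ms k => App f (map (subst r) Ms) k
  | Scal f Ms => Scal f (map (subst r) Ms)
  end.

Definition subst_list (Ms : seq term) : term -> term :=
  subst (fun i => nth (Var i) Ms i).

Definition shift (m : nat) : term -> term := subst (fun i => Var (m + i)).

Fixpoint relabel (r : L -> L) (t : term) : term :=
  match t with
  | Var i => Var i
  | Cst f a k => Cst f (r a) k
  | App f Ms k => App f (map (relabel r) Ms) k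
  | Scal f Ms => Scal f (map (relabel r) Ms)
  end.

Fixpoint labels (t : term) : seq L :=
  match t with
  | Var _ => [::]
  | Cst _ a _ => [:: a]
  | App _ Ms _ => flatten (map labels Ms)
  | Scal _ Ms => flatten (map labels Ms)
  end.

Definition vars A : seq term := map Var (iota 0 (size A)).
Definition csts f (a : L) : seq term := mkseq (Cst f a) (size (scod f)).
Definition apps f (Ms : seq term) : seq term := mkseq (App f Ms) (size (scod f)).

Record entry := Entry { etm : term; ety : sob G; eactive : bool }.

Definition active_entries (Ms : seq term) A : seq entry :=
  [seq Entry p.1 p.2 true | p <- zip Ms A].

Definition deactivate (e : entry) : entry := Entry (etm e) (ety e) false.

Definition id_entries A (fs : seq (sarr G * L)) : seq entry :=
  active_entries (vars A) A ++
  flatten [seq active_entries (csts p.1 p.2) (scod p.1) | p <- fs].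

Definition gen_entries (fs : seq (sarr G * seq entry)) : seq entry :=
  flatten [seq active_entries (apps p.1 (map etm p.2)) (scod p.1) | p <- fs].

Definition gen_scalars (hs : seq (sarr G * seq entry)) : seq term :=
  [seq Scal p.1 (map etm p.2) | p <- hs].

(* [derivable A l Zs] is the judgment x : A |- (Ms | Zs) : Bs, where l lists
   the terms Ms with their types Bs and the activeness of these. *)
Inductive derivable A : seq entry -> seq term -> Prop :=
| der_id (fs : seq (sarr G * L)) (hs : seq (sarr G)) (s : seq nat) :
    List.Forall (fun p => sdom p.1 = [::] /\ scod p.1 <> [::]) fs ->
    List.NoDup (map snd fs) ->
    List.Forall (fun h => sdom h = [::] /\ scod h = [::]) hs ->
    is_permutation (size (id_entries A fs)) s ->
    keeps_order
      (mem (block_starts (size A) [seq size (scod p.1) | p <- fs])) s ->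
    derivable A (permute s (id_entries A fs)) [seq Scal h [::] | h <- hs]
| der_gen (fs hs : seq (sarr G * seq entry)) (R : seq entry)
      (Zs : seq term) (s t : seq nat) :
    derivable A (flatten (map snd fs) ++ flatten (map snd hs) ++ R) Zs ->
    0 < size fs + size hs ->
    List.Forall (fun p => [/\ map ety p.2 = sdom p.1, has eactive p.2
                            & scod p.1 <> [::]]) fs ->
    List.Forall (fun p => [/\ map ety p.2 = sdom p.1, has eactive p.2
                            & scod p.1 = [::]]) hs ->
    is_permutation (size (gen_entries fs) + size R) s ->
    keeps_order (fun i => size (gen_entries fs) <= i) s ->
    keeps_order (mem (block_starts 0 [seq size (scod p.1) | p <- fs])) s ->
    is_permutation (size hs + size Zs) t ->
    keeps_order (fun i => i < size hs) t ->
    keeps_order (fun i => size hs <= i) t ->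
    derivable A (permute s (gen_entries fs ++ map deactivate R))
                (permute t (gen_scalars hs ++ Zs)).

Lemma Forall_cat (T : Type) (P : T -> Prop) (l l' : seq T) :
  List.Forall P (l ++ l') <-> List.Forall P l /\ List.Forall P l'.
Proof. exact: List.Forall_app. Qed.

Lemma Forall_map (T U : Type) (g : T -> U) (P : U -> Prop) (l : seq T) :
  List.Forall P (map g l) <-> List.Forall (P \o g) l.
Proof. exact: List.Forall_map. Qed.

Lemma Forall_permute (T : Type) (P : T -> Prop) (s : seq nat) (l : seq T) :
  List.Forall P l -> List.Forall P (permute s l).
Proof.
have onthP (l' : seq T) i x : onth l' i = Some x -> List.In x l'.
  by elim: l' i => [|y l' IH] [|i] //= => [[->]|/IH]; [left | right].
move=> /List.Forall_forall Pl; elim: s => [|i s IH]; first by constructor.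
rewrite /permute /=; case E: (onth l i) => [x|] //=.
by constructor => //; apply/Pl/(onthP _ i).
Qed.

Lemma etm_active_entries (Ms : seq term) A :
  size Ms = size A -> map etm (active_entries Ms A) = Ms.
Proof. by elim: Ms A => [|M Ms IH] [|B A] //= [/IH ->]. Qed.

Lemma derivable_is_term A l Zs : derivable A l Zs ->
  List.Forall (is_term (size A)) (map etm l) /\
  List.Forall (is_term (size A)) Zs.
Proof.
set P := is_term _.
have mapP (T U : Type) (Q : U -> Prop) (g : T -> U) r :
    (forall x, List.In x r -> Q (g x)) -> List.Forall Q (map g r).
  by move=> H; apply/Forall_map/List.Forall_forall.
have flatP (T U : Type) (Q : U -> Prop) (g : T -> seq U) r :
    (forall x, List.In x r -> List.Forall Q (g x)) ->
    List.Forall Q (flatten (map g r)).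
  elim: r => [|x r IH] H /=; first by constructor.
  by apply/Forall_cat; split; [apply: H; left | apply: IH => y ?; apply: H; right].
have iotaP i m n : List.In i (iota m n) -> i < m + n.
  elim: n m => //= n IH m [<-|/IH]; last by rewrite addSnnS.
  by rewrite addnS leq_addr.
have blockP (T : Type) (hs : seq (T * seq entry)) R : List.Forall P (map etm
    (flatten (map snd hs) ++ R)) ->
    (forall p, List.In p hs -> List.Forall P (map etm p.2)) /\
    List.Forall P (map etm R).
  elim: hs => [|q hs IH] //=; rewrite -catA map_cat => /Forall_cat[Hq /IH[Hh HR]].
  by split => // p [<-|/Hh].
elim=> {l Zs} [fs hs s Hfs _ Hhs _ _|fs hs R Zs s t _ [IHl IHZ] _ Hfs Hhs _ _ _ _ _ _].
  split; last first.
    apply: (mapP) => h /((proj1 (List.Forall_forall _ _)) Hhs)[h0 h1].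
    by apply: is_Scal; rewrite ?h0.
  apply/(proj2 (Forall_map etm P _))/Forall_permute/(proj1 (Forall_map etm P _)).
  rewrite map_cat.
  apply/Forall_cat; split.
    rewrite etm_active_entries ?size_map ?size_iota //.
    by apply: (mapP) => i /iotaP; rewrite add0n; exact: is_Var.
  apply/(proj2 (Forall_map etm P _)); apply: flatP => p.
  move=> /((proj1 (List.Forall_forall _ _)) Hfs)[p0 p1].
  apply/(proj1 (Forall_map etm P _)); rewrite etm_active_entries ?size_mkseq //.
  by apply: mapP => k /iotaP; rewrite add0n; exact: is_Cst.
have [Mfs /blockP[Mhs HR]] := blockP _ _ _ IHl.
split; last first.
  apply: Forall_permute; apply/Forall_cat; split=> //.
  apply: mapP => p ph; have [p0 _ p1] := (proj1 (List.Forall_forall _ _)) Hhs _ ph.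
  by apply: is_Scal => //; [rewrite -p0 !size_map | exact: Mhs].
apply/(proj2 (Forall_map etm P _))/Forall_permute/(proj1 (Forall_map etm P _)).
rewrite map_cat; apply/Forall_cat; split; last by rewrite -map_comp.
apply/(proj2 (Forall_map etm P _)); apply: flatP => p pf.
have [p0 pa p1] := (proj1 (List.Forall_forall _ _)) Hfs _ pf.
apply/(proj1 (Forall_map etm P _)); rewrite etm_active_entries ?size_mkseq //.
apply: mapP => k /iotaP; rewrite add0n => kn; apply: is_App => //.
- by rewrite -p0; case: (p.2) pa.
- by rewrite -p0 !size_map.
- exact: Mfs.
Qed.

Record judgment := Judgment { jtms : seq term; jscals : seq term }.

Definition derives A (J : judgment) B : Prop :=
  exists l : seq entry,
    [/\ derivable A l (jscals J), map etm l = jtms J & map ety l = B].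

Definition jlabels (J : judgment) : seq L :=
  flatten (map labels (jtms J ++ jscals J)).

Definition disjoint_labels (J K : judgment) : Prop :=
  forall a, List.In a (jlabels J) -> ~ List.In a (jlabels K).

Definition jeq (J K : judgment) : Prop :=
  exists r : L -> L, [/\ bijective r, jtms K = map (relabel r) (jtms J)
    & Permutation.Permutation (map (relabel r) (jscals J)) (jscals K)].

Lemma relabel_comp (r r' : L -> L) :
  relabel (r' \o r) =1 relabel r' \o relabel r.
Proof.
rewrite /eqfun; fix IH 1.
case=> [i|f a k|f Ms k|f Ms] //=;
  [congr (App _ _ _) | congr (Scal _ _)];
  by elim: Ms => //= M Ms ->; rewrite IH.
Qed.

Lemma relabel_id : relabel id =1 id.
Proof.
rewrite /eqfun; fix IH 1.
case=> [i|f a k|f Ms k|f Ms] //=;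
  [congr (App _ _ _) | congr (Scal _ _)];
  by elim: Ms => //= M Ms ->; rewrite IH.
Qed.

Lemma jeq_refl J : jeq J J.
Proof.
exists id; split; first by exists id.
- by rewrite (eq_map relabel_id) map_id.
- by rewrite (eq_map relabel_id) map_id; exact: Permutation.Permutation_refl.
Qed.

Lemma jeq_sym J K : jeq J K -> jeq K J.
Proof.
have relK r r' : cancel r r' -> cancel (relabel r) (relabel r').
  move=> rK t; rewrite -[LHS]/((relabel r' \o relabel r) t) -relabel_comp.
  have -> : r' \o r = id by apply/funext.
  exact: relabel_id.
move=> [r [[r' rK r'K] tE sP]]; exists r'; split; first by exists r.
- by rewrite tE (mapK (relK _ _ rK)).
- apply: Permutation.Permutation_sym; rewrite -[jscals J](mapK (relK _ _ rK)).
  exact: Permutation.Permutation_map.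
Qed.

Lemma jeq_trans J K M : jeq J K -> jeq K M -> jeq J M.
Proof.
move=> [r [br tE sP]] [r' [br' tE' sP']]; exists (r' \o r); split.
- exact: bij_comp.
- by rewrite (eq_map (relabel_comp _ _)) map_comp -tE.
- rewrite (eq_map (relabel_comp _ _)) map_comp.
  by apply: Permutation.Permutation_trans sP'; exact: Permutation.Permutation_map.
Qed.

(* A morphism A -> B is an equivalence class of derivable judgments, given as
   the set of its representatives. *)
Record fmor A B := FMor {
  reps :> judgment -> Prop;
  fmorP : exists J, derives A J B /\
            reps = (fun K => derives A K B /\ jeq J K) }.

Definition id_judgment A : judgment := Judgment (vars A) [::].

Definition comp_judgment (J K : judgment) : judgment :=
  Judgment (map (subst_list (jtms J)) (jtms K))
           (map (subst_list (jtms J)) (jscals K) ++ jscals J).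

(* The variables of the second judgment come after the m variables of the
   first one. *)
Definition tens_judgment (m : nat) (J K : judgment) : judgment :=
  Judgment (jtms J ++ map (shift m) (jtms K))
           (map (shift m) (jscals K) ++ jscals J).

Definition symm_judgment A B : judgment :=
  Judgment (map Var (iota (size A) (size B) ++ iota 0 (size A))) [::].

Definition gen_judgment f (a : L) : judgment :=
  if nilp (scod f) then Judgment [::] [:: Scal f (vars (sdom f))]
  else if nilp (sdom f) then Judgment (csts f a) [::]
  else Judgment (apps f (vars (sdom f))) [::].

(* These clauses determine the operations of S, since any two classes have
   representatives with disjoint labels when L is infinite. *)
Record is_free_structure (S : prop_structure fmor) : Prop := {
  free_id : forall A, idm S A (id_judgment A);
  free_comp : forall A B C (x : fmor A B) (y : fmor B C) (J K : judgment),
    x J -> y K -> disjoint_labels J K -> comp S x y (comp_judgment J K);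
  free_tens : forall A B C D (x : fmor A B) (y : fmor C D) (J K : judgment),
    x J -> y K -> disjoint_labels J K ->
    tens S x y (tens_judgment (size A) J K);
  free_symm : forall A B, symm S A B (symm_judgment A B) }.

Definition is_generator_inclusion (S : prop_structure fmor)
    (eta : sig_mor G (underlying (PropCat S))) : Prop :=
  smob eta = id /\
  forall f (a : L), exists x : fmor (sdom f) (scod f),
    x (gen_judgment f a) /\ smarr eta f = @Arrow (PropCat S) _ _ x.

End TypeTheory.

(* Main.v *)
From HB Require Import structures.
Require Import Defs.
From mathcomp Require Import all_boot.
From mathcomp Require Import boolp classical_sets functions cardinality.
From mathcomp Require Import zify.

(** Terms with labels are a notation for string diagrams.  A box of the diagram
    is a node of the terms: a constant with its label, a generator applied to
    its arguments, or a scalar term.  A wire is a variable or one output of a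
    box.  A judgment is a diagram with interface A -> B exactly when every wire
    is consumed once, by a box or by the interface B ([good]).  No order of the
    boxes enters this description, and cycles are excluded because terms are
    well founded.

    The derivable judgments are the good ones ([derivesP]).  A derivation
    arranges the boxes in layers, each box being put as early as possible: this
    is what the activeness condition says, and it makes the layer of a box the
    height of its term ([lev]).  So the last rule of a derivation is forced, and
    [good_derivable] peels off the boxes of maximal height.

    Good judgments are stable under substitution and juxtaposition by counting
    wires ([good_comp], [good_tens]).  A judgment determines its boxes
    ([nodes_perm]), so that disjoint labels in the terms mean disjoint labels in
    the diagrams.  The laws of a prop then become equalities of terms between
    representatives with disjoint labels, which exist since there are infinitely
    many labels ([freeS]).

    To interpret a judgment in a prop, its boxes are fired one at a time on a
    list of distinct wires ([run], [sem]): each box consumes some wires and puts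
    its outputs in front, permutations of wires being interpreted by the
    symmetry.  Coherence for permutations ([pm_trans], [pm_cat], [pm_asym]) and
    naturality of the symmetry show that two independent boxes can be fired in
    either order, so that the result depends on the diagram only ([sem_perm]).
    As it is also invariant under renaming of the wires ([sem_map]), it respects
    relabelling and turns substitution into composition and juxtaposition into
    the tensor product ([value_comp], [value_tens]).  This is the extension of a
    morphism of signatures.

    Any morphism of props preserves the interpretation of runs ([amap_sem]).  In
    the prop of judgments itself the run of a judgment computes the class of
    that judgment ([free_value]).  Hence a morphism of props is determined by
    its values on generators. *)

Set Implicit Arguments.
Unset Strict Implicit.
Unset Printing Implicit Defensive.

Local Open Scope classical_set_scope.

(** * Arrows of a prop with their sources and targets *)

Section OneSorted.
Variable P : prop_cat.
Implicit Types (f g h : arrow P) (A B C : seq (pob P)).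

(** The laws of a prop hold up to transport along equalities of lists of
    objects.  A transport is invisible once a morphism is packed with its source
    and target, so all computations are made with packed arrows. *)
Lemma arrow_cast A A' B B' (eA : A = A') (eB : B = B') (f : phom A B) :
  Arrow (hom_cast eA eB f) = Arrow f.
Proof. by case: A' / eA; case: B' / eB. Qed.

Lemma Arrow_inj A B (f g : phom A B) : Arrow f = Arrow g -> f = g.
Proof.
move=> e.
have H (x y : arrow P) (exy : x = y) : exists (e1 : asrc x = asrc y)
    (e2 : atgt x = atgt y), hom_cast e1 e2 (ahom x) = ahom y.
  by case: y / exy; exists erefl, erefl.
have [/= e1 [e2]] := H _ _ e.
by rewrite (Prop_irrelevance e1 erefl) (Prop_irrelevance e2 erefl).
Qed.

Definition aid A := Arrow (idm (pstr P) A).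
Definition asym A B := Arrow (symm (pstr P) A B).
Definition atens f g := Arrow (tens (pstr P) (ahom f) (ahom g)).
(** Composition in the order of the diagram; the value f on arrows that do not
    match keeps [asrc_comp] free of side conditions. *)
Definition acomp f g : arrow P :=
  match pselect (asrc g = atgt f) with
  | left e => Arrow (Defs.comp (pstr P) (ahom f) (hom_cast e erefl (ahom g)))
  | right _ => f
  end.

Local Notation "f >> g" := (acomp f g) (at level 50, left associativity).
Local Notation "f ** g" := (atens f g) (at level 40, left associativity).

Lemma acompE A B C (f : phom A B) (g : phom B C) :
  Arrow f >> Arrow g = Arrow (Defs.comp (pstr P) f g).
Proof. by rewrite /acomp /=; case: pselect => // e; rewrite (Prop_irrelevance e erefl). Qed.

Lemma asrc_comp f g : asrc (f >> g) = asrc f.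
Proof. by rewrite /acomp; case: pselect. Qed.

Lemma atgt_comp f g : atgt f = asrc g -> atgt (f >> g) = atgt g.
Proof. by rewrite /acomp; case: pselect => // n e; case: n. Qed.

Lemma acompA f g h : atgt f = asrc g -> atgt g = asrc h ->
  f >> (g >> h) = f >> g >> h.
Proof.
case: f g h => A B f [B' C g] [C' D h] /= eB eC; case: B' / eB g => g.
by case: C' / eC h => h; rewrite !acompE Defs.compA.
Qed.

Lemma acomp_idl f A : A = asrc f -> aid A >> f = f.
Proof. by case: f => B C f /= ->; rewrite acompE comp_idl. Qed.

Lemma acomp_idr f A : A = atgt f -> f >> aid A = f.
Proof. by case: f => B C f /= ->; rewrite acompE comp_idr. Qed.

Lemma atensA f g h : f ** (g ** h) = f ** g ** h.
Proof. by rewrite {3 4}/atens /= -tensA arrow_cast. Qed.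

Lemma atens_id A B : aid A ** aid B = aid (A ++ B).
Proof. by rewrite /atens /= tens_id. Qed.

Lemma atens_unitl f : aid [::] ** f = f.
Proof. by case: f => A B f; rewrite /atens /= tens_unitl. Qed.

Lemma atens_unitr f : f ** aid [::] = f.
Proof.
case: f => A B f; rewrite /atens /=.
by rewrite -[in RHS](tens_unitr (pstr P) f) arrow_cast.
Qed.

Lemma atens_comp f g f' g' : atgt f = asrc g -> atgt f' = asrc g' ->
  (f >> g) ** (f' >> g') = (f ** f') >> (g ** g').
Proof.
case: f g f' g' => A B f [B' C g] [A' C' f'] [B1 D g'] /= eB eC.
case: B' / eB g => g; case: B1 / eC g' => g'.
by rewrite /atens /= !acompE tens_comp.
Qed.

Lemma asym_nat f g :
  (f ** g) >> asym (atgt f) (atgt g) = asym (asrc f) (asrc g) >> (g ** f).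
Proof. by case: f g => [A B f] [C D g]; rewrite /atens /asym /= !acompE symm_nat. Qed.

Lemma asymK A B : asym A B >> asym B A = aid (A ++ B).
Proof. by rewrite /asym acompE symmK. Qed.

(** The hexagon without transports. *)
Lemma asym_catr A B C :
  asym A (B ++ C) = (asym A B ** aid C) >> (aid B ** asym A C).
Proof.
rewrite -[LHS](arrow_cast (catA A B C) (esym (catA B C A))) symm_hexagon.
by rewrite -acompE arrow_cast.
Qed.

End OneSorted.

Local Notation "f >> g" := (acomp f g) (at level 50, left associativity).
Local Notation "f ** g" := (atens f g) (at level 40, left associativity).

(** Matching of sources and targets is decided by computing both sides as lists
    of objects, with the ends of opaque arrows taken from the context. *)
Ltac ends_simp := cbn [asrc atgt atens aid asym];
  repeat match goal with
  | H : atgt ?f = _ |- context [atgt ?f] => rewrite H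
  | H : asrc ?f = _ |- context [asrc ?f] => rewrite H
  end.

Ltac ends := solve [ ends_simp;
  repeat (rewrite asrc_comp; ends_simp);
  repeat (rewrite atgt_comp; [|solve [ends]]; ends_simp);
  rewrite ?cats0 -?catA //=; congruence ].

Section Braid.
Variable P : prop_cat.
Implicit Types (f g h : arrow P) (A B C : seq (pob P)).

Lemma whisker_r f g A : atgt f = asrc g ->
  (f >> g) ** aid A = (f ** aid A) >> (g ** aid A).
Proof. by move=> e; rewrite -atens_comp // acomp_idl. Qed.

Lemma whisker_l f g A : atgt f = asrc g ->
  aid A ** (f >> g) = (aid A ** f) >> (aid A ** g).
Proof. by move=> e; rewrite -atens_comp // acomp_idl. Qed.

Lemma slide_l f g : (f ** aid (asrc g)) >> (aid (atgt f) ** g) = f ** g.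
Proof. by rewrite -atens_comp // acomp_idr // acomp_idl. Qed.

Lemma slide_r f g : (aid (asrc f) ** g) >> (f ** aid (atgt g)) = f ** g.
Proof. by rewrite -atens_comp // acomp_idl // acomp_idr. Qed.

(** The hexagon makes this arrow idempotent, and it is invertible. *)
Lemma asym_nilr A : @asym P A [::] = aid A.
Proof.
have E : asym A [::] = @asym P A [::] >> asym A [::].
  by have := @asym_catr P A [::] [::]; rewrite atens_unitl atens_unitr.
have K := @asymK P A [::].
rewrite -{2}[A]cats0 -K -[LHS](@acomp_idr P _ A) /= ?cats0 //.
rewrite {2}E -acompA /= ?cats0 //.
by rewrite K cats0.
Qed.

Lemma asym_nill A : @asym P [::] A = aid A.
Proof.
by rewrite -(@asymK P [::] A) asym_nilr acomp_idr //= cats0.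
Qed.

(** Both sides are inverse to [asym C (A ++ B)], which the hexagon splits. *)
Lemma asym_catl A B C :
  @asym P (A ++ B) C = (aid A ** asym B C) >> (asym A C ** aid B).
Proof.
set h := RHS.
have hK : asym C (A ++ B) >> h = aid (C ++ A ++ B).
  rewrite asym_catr /h acompA; try ends.
  rewrite -(@acompA P _ (aid A ** asym C B)); try ends.
  rewrite -whisker_l // asymK atens_id acomp_idr; try ends.
  by rewrite -whisker_r // asymK atens_id -catA.
rewrite -(@acomp_idr P (asym (A ++ B) C) (C ++ A ++ B)) //.
rewrite -hK acompA //=; last by rewrite /h; ends.
by rewrite asymK acomp_idl // /h; ends.
Qed.

Lemma exchange f g A B C D :
  A = asrc f -> B = atgt f -> C = asrc g -> D = atgt g ->
  (f ** aid C) >> (aid B ** g) = (aid A ** g) >> (f ** aid D).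
Proof. by move=> -> -> -> ->; rewrite slide_l slide_r. Qed.

(** Naturality of the symmetry with y, applied to another symmetry. *)
Lemma yang_baxter x y u :
  (asym y x ** aid u) >> (aid x ** asym y u) >> (@asym P x u ** aid y) =
  (aid y ** asym x u) >> (asym y u ** aid x) >> (aid u ** asym y x).
Proof.
rewrite -asym_catr -acompA; try ends.
rewrite -asym_catr.
rewrite -[asym y (x ++ u)]/(asym (asrc (aid y)) (asrc (@asym P x u))).
by rewrite -asym_nat.
Qed.

(** Two wires x and y, initially in the order y, x, are inserted in a list.
    Inserting x first or y first gives the same arrow, up to an initial crossing
    of x and y.  In [braid1] y ends before x, in [braid2] after x. *)
Lemma braid1 x y u1 u2 :
  (aid y ** asym x (u1 ++ u2)) >> (@asym P y u1 ** aid (u2 ++ x)) =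
  (asym y x ** aid (u1 ++ u2)) >> (aid x ** asym y u1 ** aid u2) >>
  asym x (u1 ++ y ++ u2).
Proof.
rewrite asym_catr whisker_l; last ends.
rewrite -acompA; try ends.
have -> : aid y ** (aid u1 ** asym x u2) >> asym y u1 ** aid (u2 ++ x) =
   (asym y u1 ** aid (x ++ u2)) >> (aid (u1 ++ y) ** asym x u2).
  by rewrite atensA atens_id; symmetry; apply: exchange.
rewrite (catA u1 y u2) [in RHS]asym_catr [in RHS]asym_catr.
rewrite acompA; try ends.
rewrite [RHS]acompA; try ends.
congr (_ >> _).
rewrite -!atens_id !atensA -!whisker_r; try ends.
congr (_ ** _).
rewrite acompA; try ends.
rewrite yang_baxter -[RHS]acompA; try ends.
by rewrite -whisker_l // asymK atens_id acomp_idr //; ends.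
Qed.

Lemma braid2 x y t u :
  (aid y ** asym x t ** aid u) >> @asym P y (t ++ x ++ u) =
  (asym y x ** aid (t ++ u)) >> (aid x ** asym y (t ++ u)) >>
    (asym x t ** aid (u ++ y)).
Proof.
rewrite (catA t x u) [in LHS]asym_catr [asym y (t ++ x)]asym_catr.
rewrite acompA; try ends.
rewrite -whisker_r; last ends.
rewrite acompA; try ends.
rewrite -yang_baxter.
rewrite [asym y (t ++ u)]asym_catr whisker_l; last ends.
rewrite -[RHS]acompA; try ends.
rewrite -[X in _ = _ >> X]acompA; try ends.
have -> : aid x ** (aid t ** asym y u) >> asym x t ** aid (u ++ y) =
   (asym x t ** aid (y ++ u)) >> (aid (t ++ x) ** asym y u).
  by rewrite atensA atens_id; symmetry; apply: exchange.
rewrite [X in _ = _ >> X]acompA; try ends.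
rewrite [RHS]acompA; try ends.
congr (_ >> _).
rewrite -!atens_id !atensA -!whisker_r; try ends.
by rewrite acompA //; ends.
Qed.
(** Naturality, with the second symmetry moved to the other side. *)
Lemma asym_conj f A B C : B = asrc f -> C = atgt f ->
  asym A B >> (f ** aid A) >> asym C A = aid A ** f.
Proof.
move=> -> ->; rewrite -acompA; try ends.
rewrite (asym_nat f (aid A)) acompA //.
by rewrite asymK acomp_idl.
Qed.

(** The common frame of the two cases of [pm_mid]: the permutation q of the
    other wires slides along the crossing of x and y. *)
Lemma swap_front x y S1 S2 q c d e k : asrc q = S1 ++ S2 ->
  asrc c = x ++ atgt q -> atgt (aid y ** c) = asrc d ->
  asrc e = y ++ atgt q -> atgt (aid x ** e) = asrc k ->
  (aid y ** c) >> d = (@asym P y x ** aid (atgt q)) >> (aid x ** e) >> k ->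
  aid y ** ((asym S1 x ** aid S2) >> (aid x ** q) >> c) >> d =
  (asym (y ++ S1) x ** aid S2) >> (aid x ** ((aid y ** q) >> e)) >> k.
Proof.
move=> hq hc hd he hk E.
rewrite whisker_l; last ends.
rewrite -acompA; try ends.
rewrite E whisker_l; last ends.
rewrite [RHS]/= [in RHS]asym_catl (whisker_r (f := _ ** _)); last ends.
rewrite [in RHS]whisker_l; last ends.
rewrite !acompA; try ends.
congr (_ >> _ >> _).
rewrite -[LHS]acompA; try ends.
rewrite -[RHS]acompA; try ends.
rewrite -atensA; congr (_ >> _).
rewrite -atensA [in RHS]atens_id -hq !atensA !atens_id.
by symmetry; apply: exchange.
Qed.
End Braid.

(** * Coherence of permutation arrows *)

Section PermArrow.
Variables (P : prop_cat) (X : eqType) (ty : X -> seq (pob P)).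
Implicit Types (s t u v : seq X).

Definition obs s : seq (pob P) := flatten (map ty s).

Lemma obs_cat s t : obs (s ++ t) = obs s ++ obs t.
Proof. by rewrite /obs map_cat flatten_cat. Qed.

Lemma obs_cons x s : obs (x :: s) = ty x ++ obs s.
Proof. by []. Qed.

(** The arrow that permutes the wires s to t, for s without repetition: the
    tail of s is permuted first, then the head crosses the wires that precede it
    in t. *)
Fixpoint pm s t : arrow P :=
  if s is x :: s' then
    (aid (ty x) ** pm s' (rem x t)) >>
    (asym (ty x) (obs (take (index x t) t)) ** aid (obs (drop (index x t).+1 t)))
  else aid [::].

Lemma pm_cons x s t1 t2 : x \notin t1 ->
  pm (x :: s) (t1 ++ x :: t2) =
  (aid (ty x) ** pm s (t1 ++ t2)) >> (asym (ty x) (obs t1) ** aid (obs t2)).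
Proof.
move=> xt1; have i : index x (t1 ++ x :: t2) = size t1.
  by rewrite index_cat (negbTE xt1) /= eqxx addn0.
rewrite /= remE i take_size_cat // -cat_rcons drop_size_cat ?size_rcons //.
Qed.

Lemma perm_split x s t : perm_eq (x :: s) t ->
  exists t1 t2, [/\ t = t1 ++ x :: t2, x \notin t1 & perm_eq s (t1 ++ t2)].
Proof.
move=> st; have xt : x \in t by rewrite -(perm_mem st) mem_head.
exists (take (index x t) t), (drop (index x t).+1 t).
have E : t = take (index x t) t ++ x :: drop (index x t).+1 t.
  by rewrite -[LHS](cat_take_drop (index x t)) (drop_nth x) ?index_mem // nth_index.
split => //.
  by apply/negP => /index_ltn; rewrite ltnn.
by rewrite -(perm_cons x) (perm_trans st) // {1}E perm_catC /= perm_cons perm_catC.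
Qed.

Lemma asrc_pm s t : asrc (pm s t) = obs s.
Proof. by elim: s t => //= x s IH t; rewrite asrc_comp /= IH. Qed.

#[local] Arguments pm : simpl never.

Lemma atgt_pm s t : perm_eq s t -> atgt (pm s t) = obs t.
Proof.
elim: s t => [|x s IH] t; first by rewrite perm_sym => /perm_nilP ->.
move=> /perm_split[t1 [t2 [-> xt1 st]]]; rewrite pm_cons //.
rewrite atgt_comp /= ?IH ?obs_cat /= ?obs_cons -?catA //.
Qed.

End PermArrow.

Arguments pm : simpl never.

Ltac pends := cbn [asrc atgt atens aid asym]; rewrite ?(asrc_pm, asrc_comp);
  cbn [asrc atgt atens aid asym]; rewrite ?(asrc_pm, asrc_comp, obs_cat, obs_cons); ends.

Section Coherence.
Variables (P : prop_cat) (X : eqType) (ty : X -> seq (pob P)).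
Implicit Types (s t u v : seq X).
Local Notation obs := (obs ty).
Local Notation pm := (pm ty).

(** The recursion that defines [pm] may be performed on any wire x instead of
    the head y.  By induction x is extracted first and inserted last in the
    permutation of the tail; then the insertions of x and y are exchanged, in
    either of their two relative positions in the target. *)
Lemma pm_mid s1 x s2 t1 t2 : uniq (s1 ++ x :: s2) ->
  perm_eq (s1 ++ s2) (t1 ++ t2) ->
  pm (s1 ++ x :: s2) (t1 ++ x :: t2) =
  (asym (obs s1) (ty x) ** aid (obs s2)) >>
  (aid (ty x) ** pm (s1 ++ s2) (t1 ++ t2)) >>
  (asym (ty x) (obs t1) ** aid (obs t2)).
Proof.
elim: s1 t1 t2 => [|y s1 IH] t1 t2 /=.
  move=> /andP[xs _] st; rewrite pm_cons; last first.
    by apply: contra xs => xt; rewrite (perm_mem st) mem_cat xt.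
  by rewrite asym_nill atens_id acomp_idl //= asrc_pm.
move=> /andP[ys us] st.
have ysx : y != x by apply: contraNneq ys => ->; rewrite mem_cat mem_head orbT.
have xs : x \notin s1 ++ s2.
  have := us; rewrite (perm_uniq (_ : perm_eq _ ([:: x] ++ s1 ++ s2))).
    by case/andP.
  exact: (permEl (perm_catCA s1 [:: x] s2)).
have xt : x \notin t1 ++ t2.
  by rewrite -(perm_mem st) inE negb_or eq_sym ysx.
have yt : y \in t1 ++ t2 by rewrite -(perm_mem st) mem_head.
have := yt; rewrite mem_cat; case: (boolP (y \in t1)) => [yt1 _|nyt1 /= yt2].
- have := perm_to_rem yt1; rewrite perm_sym => /perm_split[u1 [u2 [E yu1 _]]].
  subst t1; rewrite -!catA !cat_cons.
  have st' : perm_eq (s1 ++ s2) (u1 ++ u2 ++ t2).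
    by rewrite -(perm_cons y) (perm_trans st) // -catA;
    exact: (permEl (perm_catCA u1 [:: y] _)).
  rewrite pm_cons // (catA u1) IH //; last by rewrite -catA.
  rewrite pm_cons // -catA.
  have hs := asrc_pm ty (s1 ++ s2) (u1 ++ u2 ++ t2); have ht := atgt_pm ty st'.
  set q := pm _ _ in hs ht *; rewrite !obs_cat in hs ht.
  rewrite obs_cons; apply: swap_front; rewrite ?ht ?obs_cat ?obs_cons ?obs_cat //=;
    rewrite -?catA //.
  have := congr1 (fun f => f ** aid (obs t2)) (braid1 (ty x) (ty y) (obs u1) (obs u2)).
  rewrite !whisker_r; try ends.
  by rewrite -!atensA !atens_id -!catA.
- have := perm_to_rem yt2; rewrite perm_sym => /perm_split[u1 [u2 [E yu1 _]]].
  subst t2.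
  have yt' : y \notin t1 ++ x :: u1 by rewrite mem_cat inE !negb_or nyt1 ysx.
  have st' : perm_eq (s1 ++ s2) (t1 ++ u1 ++ u2).
    by rewrite -(perm_cons y) (perm_trans st) // !catA;
    exact: (permEl (perm_catCA (t1 ++ u1) [:: y] u2)).
  have -> : t1 ++ x :: u1 ++ y :: u2 = (t1 ++ x :: u1) ++ y :: u2 by rewrite -catA.
  rewrite pm_cons // -catA cat_cons IH //.
  rewrite (catA t1 u1 (y :: u2)) pm_cons ?mem_cat ?negb_or ?nyt1 // -(catA t1 u1 u2).
  have hs := asrc_pm ty (s1 ++ s2) (t1 ++ u1 ++ u2); have ht := atgt_pm ty st'.
  set q := pm _ _ in hs ht *; rewrite !obs_cat in hs ht.
  rewrite obs_cons; apply: swap_front; rewrite ?ht ?obs_cat ?obs_cons ?obs_cat //=;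
    rewrite -?catA //.
  have := congr1 (fun f => f ** aid (obs u2)) (braid2 (ty x) (ty y) (obs t1) (obs u1)).
  rewrite !whisker_r; try ends.
  by rewrite -!atensA !atens_id -!catA.
Qed.

Lemma pm_refl s : pm s s = aid (obs s).
Proof.
elim: s => //= x s IH.
by rewrite (@pm_cons _ _ ty x s [::]) //= IH asym_nilr !atens_id acomp_idr //= cats0.
Qed.

Lemma pm_cat s s' t t' : perm_eq s t -> perm_eq s' t' ->
  pm (s ++ s') (t ++ t') = pm s t ** pm s' t'.
Proof.
move=> + st'; elim: s t => [|x s IH] t.
  by rewrite perm_sym => /perm_nilP ->; rewrite atens_unitl.
move=> /perm_split[t1 [t2 [-> xt1 st]]].
rewrite -catA !cat_cons !pm_cons // catA IH // obs_cat.
have h := atgt_pm ty st; rewrite obs_cat in h; have h' := atgt_pm ty st'.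
rewrite -atens_id !atensA -[RHS]slide_r.
rewrite asrc_comp /= asrc_pm h' whisker_r; last pends.
rewrite acompA; try pends; congr (_ >> _).
by rewrite -[LHS]slide_r h' /= asrc_pm.
Qed.

(** By [pm_mid] the head of s is the first wire to be treated in both factors;
    its insertion in t and its extraction from t cancel. *)
Lemma pm_trans s t u : uniq s -> perm_eq s t -> perm_eq t u ->
  pm s t >> pm t u = pm s u.
Proof.
elim: s t u => [|x s IH] t u.
  by rewrite perm_sym => _ /perm_nilP ->; rewrite perm_sym => /perm_nilP ->;
  rewrite pm_refl acomp_idl.
move=> uxs st; have ut : uniq t by rewrite -(perm_uniq st).
have := uxs; rewrite cons_uniq => /andP[xs us].
have [t1 [t2 [E xt1 st']]] := perm_split st; subst t.
move=> tu; have := perm_trans st tu => /perm_split[u1 [u2 [E xu1 su]]]; subst u.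
have tu' : perm_eq (t1 ++ t2) (u1 ++ u2) by apply: perm_trans su; rewrite perm_sym.
rewrite !pm_cons // pm_mid // -(IH _ _ us st' tu').
have h := atgt_pm ty st'; rewrite obs_cat in h.
have h' := atgt_pm ty tu'; rewrite obs_cat in h'.
have k := asrc_pm ty (t1 ++ t2) (u1 ++ u2); rewrite obs_cat in k.
rewrite !acompA; try pends.
rewrite -[X in X >> _ >> _ = _]acompA; try pends.
rewrite -whisker_r // asymK atens_id.
rewrite acomp_idr; last by rewrite /= h -catA.
by rewrite whisker_l // h k.
Qed.

Lemma pm_asym s t : uniq (s ++ t) -> pm (s ++ t) (t ++ s) = asym (obs s) (obs t).
Proof.
elim: s => [|x s IH] /=; first by rewrite cats0 pm_refl asym_nill.
move=> /andP[xst u]; rewrite pm_cons; last first.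
  by move: xst; rewrite mem_cat negb_or => /andP[].
by rewrite IH // [in RHS]obs_cons asym_catl.
Qed.

End Coherence.

(** A permutation arrow depends on the names of the wires only through their
    equalities and their types. *)
Lemma pm_map (P : prop_cat) (X Y : eqType) (tx : X -> seq (pob P))
    (ty : Y -> seq (pob P)) (sg : X -> Y) s t :
  perm_eq s t -> {in s &, injective sg} -> {in s, forall x, ty (sg x) = tx x} ->
  pm ty (map sg s) (map sg t) = pm tx s t.
Proof.
have obE r : {in r, forall x, ty (sg x) = tx x} -> obs ty (map sg r) = obs tx r.
  move=> h; rewrite /obs -map_comp; congr flatten; exact/eq_in_map.
elim: s t => [|x s IH] t //.
move=> /perm_split[t1 [t2 [-> xt1 st]]] inj hty.
have sub : {subset t1 ++ t2 <= x :: s}.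
  by move=> y; rewrite -(perm_mem st) inE orbC => ->.
rewrite map_cat /= !pm_cons //.
  rewrite -map_cat IH //.
  - rewrite hty ?mem_head // !obE // => y yt; apply/hty/sub;
    by rewrite mem_cat yt ?orbT.
  - by move=> a b aS bS; apply: inj; rewrite inE ?aS ?bS orbT.
  - by move=> a aS; apply: hty; rewrite inE aS orbT.
apply/mapP => -[y yt1 /inj e]; move: xt1; rewrite e ?yt1 ?mem_head //.
by apply: sub; rewrite mem_cat yt1.
Qed.

(** * Runs of nodes on lists of wires *)

Section Wiring.
Variables (X N : eqType) (nin nout : N -> seq X).
Implicit Types (s t u r : seq X) (n m : N) (ns : seq N).

Definition consumed ns := flatten (map nin ns).
Definition produced ns := flatten (map nout ns).
Definition remaining s n := [seq x <- s | x \notin nin n].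

(** Each node consumes wires of the current list, at any positions, and puts
    the wires it produces in front of the others.  Requiring that wires
    produced later are also new makes a wire determine its position in every
    intermediate list. *)
Fixpoint run s ns t : Prop :=
  if ns is n :: ns' then
    [/\ uniq (s ++ produced ns), perm_eq s (nin n ++ remaining s n)
      & run (nout n ++ remaining s n) ns' t]
  else uniq s /\ perm_eq s t.

Lemma outs_cat ns ns' : produced (ns ++ ns') = produced ns ++ produced ns'.
Proof. by rewrite /produced map_cat flatten_cat. Qed.

Lemma ins_cat ns ns' : consumed (ns ++ ns') = consumed ns ++ consumed ns'.
Proof. by rewrite /consumed map_cat flatten_cat. Qed.

Lemma outsP x ns : reflect (exists2 n, n \in ns & x \in nout n) (x \in produced ns).
Proof. exact: flatten_mapP. Qed.

Lemma insP x ns : reflect (exists2 n, n \in ns & x \in nin n) (x \in consumed ns).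
Proof. exact: flatten_mapP. Qed.

Lemma run_uniq s ns t : run s ns t -> uniq (s ++ produced ns).
Proof. by case: ns => [|n ns] []; rewrite ?cats0. Qed.

Lemma run_inv s n ns t : run s (n :: ns) t ->
  [/\ uniq (s ++ produced (n :: ns)), perm_eq s (nin n ++ remaining s n)
    & run (nout n ++ remaining s n) ns t].
Proof. by []. Qed.

Lemma run_uniqr s ns t : run s ns t -> uniq t.
Proof.
elim: ns s => [|n ns IH] s /=; last by case=> _ _ /IH.
by case=> us /perm_uniq <-.
Qed.

Lemma run_uniql s ns t : run s ns t -> uniq s.
Proof. by move=> /run_uniq; rewrite cat_uniq => /and3P[]. Qed.

Lemma run_mem s ns t n x :
  run s ns t -> n \in ns -> x \in nin n -> x \in s ++ produced ns.
Proof.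
elim: ns s => // m ns IH s [_ p h]; rewrite inE => /predU1P[->|nns] xn.
  by rewrite mem_cat (perm_mem p) mem_cat xn.
have := IH _ h nns xn; rewrite !mem_cat (perm_mem p) mem_cat.
by case/orP => [/orP[]|] ->; rewrite ?orbT.
Qed.

Lemma rest_perm s s' n : perm_eq s s' -> perm_eq (remaining s n) (remaining s' n).
Proof. exact: perm_filter. Qed.

Lemma rest_cat s u n : perm_eq s (nin n ++ remaining s n) -> uniq (s ++ u) ->
  remaining (s ++ u) n = remaining s n ++ u.
Proof.
move=> p us; rewrite /remaining filter_cat; congr (_ ++ _).
apply/all_filterP/allP => x xu; apply/negP => xn.
move: us; rewrite cat_uniq => /and3P[_ /hasPn/(_ _ xu)/negP + _]; case.
by rewrite /= (perm_mem p) mem_cat xn.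
Qed.

Lemma restE s r n : uniq s -> perm_eq s (nin n ++ r) -> perm_eq (remaining s n) r.
Proof.
move=> us p; rewrite (permPl (rest_perm n p)) /remaining filter_cat.
rewrite (_ : [seq x <- nin n | _] = [::]) ?cat0s; last first.
  by apply/eqP; rewrite -(negbK (_ == _)) -has_filter; apply/hasPn => x /= ->.
rewrite (_ : [seq x <- r | _] = r) //; apply/all_filterP/allP => x xr.
move: us; rewrite (perm_uniq p) cat_uniq => /and3P[_ /hasPn/(_ _ xr)] //.
Qed.

Lemma run_perml s s' ns t : perm_eq s' s -> run s ns t -> run s' ns t.
Proof.
elim: ns s s' => [|n ns IH] s s' ss /=.
  by case=> us st; rewrite (perm_uniq ss) (perm_trans ss st).
have rr := rest_perm n ss.
case=> us p h; split.
- by rewrite (perm_uniq (_ : perm_eq _ (s ++ produced (n :: ns)))) // perm_cat2r.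
- by rewrite (perm_trans ss) // (perm_trans p) // perm_cat2l perm_sym.
- by apply: IH h; rewrite perm_cat2l.
Qed.

Lemma run_permr s ns t t' : perm_eq t t' -> run s ns t -> run s ns t'.
Proof.
move=> tt; elim: ns s => [|n ns IH] s /=.
  by case=> us st; rewrite (perm_trans st tt).
by case=> us p /IH.
Qed.

Lemma step_perm s n ns r : perm_eq s (nin n ++ r) ->
  perm_eq (s ++ produced (n :: ns)) (nin n ++ (nout n ++ r) ++ produced ns).
Proof.
move=> p; rewrite /produced /= (permPl (perm_cat p (perm_refl _))) -catA perm_cat2l.
by rewrite catA perm_cat2r perm_catC.
Qed.

Lemma step_uniq s n ns r : perm_eq s (nin n ++ r) ->
  uniq (s ++ produced (n :: ns)) -> uniq ((nout n ++ r) ++ produced ns).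
Proof. by move=> /step_perm p; rewrite (perm_uniq (p ns)) cat_uniq => /and3P[]. Qed.

Lemma run_cons s n ns t r : perm_eq s (nin n ++ r) ->
  uniq (s ++ produced (n :: ns)) -> run (nout n ++ r) ns t -> run s (n :: ns) t.
Proof.
move=> p us h.
have us' : uniq s by move: us; rewrite cat_uniq => /and3P[].
have rr := restE us' p; split=> //.
  by rewrite (perm_trans p) // perm_cat2l perm_sym.
by apply: run_perml h; rewrite perm_cat2l.
Qed.

Lemma run_cat s ns t ns' u : uniq (s ++ produced (ns ++ ns')) ->
  run s ns t -> run t ns' u -> run s (ns ++ ns') u.
Proof.
move=> + + h'; elim: ns s => [|n ns IH] s us /=.
  by case=> _ st; exact: run_perml h'.
by case=> _ p h; split => //; apply: IH => //; exact: step_uniq us.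
Qed.

Lemma run_frame s ns t u : uniq ((s ++ u) ++ produced ns) ->
  run s ns t -> run (s ++ u) ns (t ++ u).
Proof.
elim: ns s => [|n ns IH] s us /=.
  by rewrite cats0 in us; case=> _ st; rewrite perm_cat2r.
have us' : uniq (s ++ u) by move: us; rewrite cat_uniq => /and3P[].
case=> _ p h; rewrite rest_cat //.
have p' : perm_eq (s ++ u) (nin n ++ remaining s n ++ u) by rewrite catA perm_cat2r.
split=> //; rewrite catA; apply: IH => //; rewrite -(catA (nout n)).
exact: step_uniq us.
Qed.

(** The nodes sorted by rank form a run: a wire consumed by the first of them
    can only be produced by a node of smaller rank, hence is a wire of s. *)
Lemma exists_run (rk : N -> nat) s ns t :
  uniq (s ++ produced ns) -> perm_eq (s ++ produced ns) (consumed ns ++ t) ->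
  {in ns &, forall n m x, x \in nin n -> x \in nout m -> rk m < rk n} ->
  exists2 ns', perm_eq ns ns' & run s ns' t.
Proof.
move=> us p hrk; exists (sort (relpre rk leq) ns); first by rewrite perm_sym perm_sort.
have : sorted (relpre rk leq) (sort (relpre rk leq) ns).
  by apply: sort_sorted => a b; exact: leq_total.
have pns : perm_eq ns (sort (relpre rk leq) ns) by rewrite perm_sym perm_sort.
have {us} : uniq (s ++ produced (sort (relpre rk leq) ns)).
  by rewrite -(perm_uniq (perm_cat (perm_refl s) (perm_flatten (perm_map nout pns)))).
have {p} : perm_eq (s ++ produced (sort (relpre rk leq) ns))
    (consumed (sort (relpre rk leq) ns) ++ t).
  rewrite -(permPl (perm_cat (perm_refl s) (perm_flatten (perm_map nout pns)))).
  by rewrite -(permPr (perm_cat (perm_flatten (perm_map nin pns)) (perm_refl t))).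
have {hrk} : {in sort (relpre rk leq) ns &,
    forall n m x, x \in nin n -> x \in nout m -> rk m < rk n}.
  by move=> n m; rewrite !mem_sort; exact: hrk.
move: (sort _ ns) => {pns}ns'; elim: ns' s => [|n ns' IH] s hrk p us srt.
  by rewrite /= !cats0 in p us *.
have ui : uniq (nin n).
  by move: us; rewrite (perm_uniq p) /consumed /= -catA cat_uniq => /and3P[].
have us' : uniq s by move: us; rewrite cat_uniq => /and3P[].
have sub : {subset nin n <= s}.
  move=> x xn; have : x \in s ++ produced (n :: ns').
    by rewrite (perm_mem p) mem_cat /consumed /= mem_cat xn.
  rewrite mem_cat; case/orP => // /outsP[m mns xm].
  have := hrk n m (mem_head _ _) mns x xn xm.
  move: mns; rewrite inE => /predU1P[->|mns]; first by rewrite ltnn.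
  have tr : transitive (relpre rk leq) by move=> a b c; exact: leq_trans.
  by have /allP/(_ _ mns) /= := order_path_min tr srt; rewrite ltnNge => ->.
have ps : perm_eq s (nin n ++ remaining s n).
  apply: uniq_perm => //.
    rewrite cat_uniq ui filter_uniq // andbT /=.
    by apply/hasPn => x; rewrite mem_filter => /andP[].
  move=> x; rewrite mem_cat mem_filter; case: (boolP (x \in nin n)) => //=.
  exact: sub.
split => //; apply: IH.
- by move=> a b aS bS; apply: hrk; rewrite inE ?aS ?bS orbT.
- rewrite -(perm_cat2l (nin n)) -(permPl (step_perm ns' ps)) (permPl p).
  by rewrite /consumed /= catA.
- exact: step_uniq us.
- exact: path_sorted srt.
Qed.

End Wiring.

Section RunArrows.
Variables (P : prop_cat) (X N : eqType) (nin nout : N -> seq X).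
Variables (ty : X -> seq (pob P)) (val : N -> arrow P).
Implicit Types (s t u r : seq X) (n m : N) (ns : seq N).
Local Notation run := (run nin nout).
Local Notation outs := (produced nout).
Local Notation rest := (remaining nin).
Local Notation obs := (obs ty).
Local Notation pm := (pm ty).

(** Before each node, the wires that it consumes are brought to the front. *)
Fixpoint sem s ns t : arrow P :=
  if ns is n :: ns' then
    pm s (nin n ++ rest s n) >> (val n ** aid (obs (rest s n))) >>
    sem (nout n ++ rest s n) ns' t
  else pm s t.

Definition val_typed n : Prop :=
  asrc (val n) = obs (nin n) /\ atgt (val n) = obs (nout n).

Lemma asrc_sem s ns t : asrc (sem s ns t) = obs s.
Proof. by case: ns => [|n ns] /=; rewrite ?asrc_comp asrc_pm. Qed.

Lemma atgt_sem s ns t : {in ns, forall n, val_typed n} ->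
  run s ns t -> atgt (sem s ns t) = obs t.
Proof.
elim: ns s => [|n ns IH] s vt /=; first by case=> _ /atgt_pm.
case=> us p h; have [vi vo] := vt n (mem_head _ _).
have hp := atgt_pm ty p; rewrite obs_cat in hp.
have e1 : atgt (pm s (nin n ++ rest s n)) = asrc (val n ** aid (obs (rest s n))).
  by rewrite hp /= vi.
rewrite !atgt_comp ?asrc_sem ?obs_cat /= ?vo //; apply: IH => // m mns.
by apply: vt; rewrite inE mns orbT.
Qed.

Lemma sem_perml s s' ns t : {in ns, forall n, val_typed n} -> perm_eq s' s ->
  run s ns t -> pm s' s >> sem s ns t = sem s' ns t.
Proof.
elim: ns s s' => [|n ns IH] s s' vt ss /=.
  by case=> us st; rewrite pm_trans // (perm_uniq ss).
move=> [us p h]; have us1 : uniq s by move: us; rewrite cat_uniq => /and3P[].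
have us2 : uniq s' by rewrite (perm_uniq ss).
have vt' : {in ns, forall n, val_typed n}.
  by move=> m mns; apply: vt; rewrite inE mns orbT.
have [vi vo] := vt n (mem_head _ _).
have rr := rest_perm nin n ss.
have p' : perm_eq s' (nin n ++ rest s' n).
  by rewrite (perm_trans ss) // (perm_trans p) // perm_cat2l perm_sym.
have hp := atgt_pm ty p; rewrite obs_cat in hp.
have hp' := atgt_pm ty p'; rewrite obs_cat in hp'.
have hr := atgt_pm ty rr; have hs := atgt_pm ty ss.
have st := asrc_sem (nout n ++ rest s n) ns t; rewrite obs_cat in st.
rewrite -(IH _ (nout n ++ rest s' n) vt' _ h); last by rewrite perm_cat2l.
rewrite pm_cat // pm_refl !acompA; try pends.
congr (_ >> _).
rewrite pm_trans // -(@pm_trans _ _ ty s' (nin n ++ rest s' n) (nin n ++ rest s n)) //;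
  last by rewrite perm_cat2l.
rewrite pm_cat // pm_refl -!acompA; try pends.
by congr (_ >> _); symmetry; apply: exchange; rewrite ?asrc_pm.
Qed.

Lemma sem_permr s ns t t' : {in ns, forall n, val_typed n} -> perm_eq t t' ->
  run s ns t -> sem s ns t >> pm t t' = sem s ns t'.
Proof.
move=> + tt; elim: ns s => [|n ns IH] s vt /=.
  by case=> us st; rewrite pm_trans.
move=> [us p h]; have [vi vo] := vt n (mem_head _ _).
have vt' : {in ns, forall n, val_typed n}.
  by move=> m mns; apply: vt; rewrite inE mns orbT.
have hp := atgt_pm ty p; rewrite obs_cat in hp.
have st := asrc_sem (nout n ++ rest s n) ns t; rewrite obs_cat in st.
have tt' := atgt_sem vt' h.
rewrite -acompA; try pends.
by rewrite IH.
Qed.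

(** The order in which the remaining wires are kept does not matter. *)
Lemma sem_cons s n ns t r : val_typed n -> {in ns, forall n, val_typed n} ->
  perm_eq s (nin n ++ r) -> run s (n :: ns) t ->
  sem s (n :: ns) t =
  pm s (nin n ++ r) >> (val n ** aid (obs r)) >> sem (nout n ++ r) ns t.
Proof.
move=> [vi vo] vt p' /= [us p h].
have us1 : uniq s by move: us; rewrite cat_uniq => /and3P[].
have rr : perm_eq r (rest s n) by rewrite perm_sym; exact: restE p'.
have hp := atgt_pm ty p; rewrite obs_cat in hp.
have hp' := atgt_pm ty p'; rewrite obs_cat in hp'.
have hr := atgt_pm ty rr.
have st := asrc_sem (nout n ++ rest s n) ns t; rewrite obs_cat in st.
rewrite -(@sem_perml (nout n ++ rest s n) (nout n ++ r)) ?perm_cat2l //.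
rewrite -(@pm_trans _ _ ty s (nin n ++ r)) ?perm_cat2l //.
rewrite !pm_cat // !pm_refl !acompA; try pends.
congr (_ >> _).
rewrite -!acompA; try pends.
by congr (_ >> _); symmetry; apply: exchange; rewrite ?asrc_pm.
Qed.

Lemma sem_cat s ns t ns' u : {in ns ++ ns', forall n, val_typed n} ->
  uniq (s ++ outs (ns ++ ns')) -> run s ns t -> run t ns' u ->
  sem s (ns ++ ns') u = sem s ns t >> sem t ns' u.
Proof.
move=> + + + h'; elim: ns s => [|n ns IH] s vt us /=.
  by case=> _ st; rewrite (sem_perml _ _ h').
case=> _ p h; have [vi vo] := vt n (mem_head _ _).
have vt' : {in ns ++ ns', forall n, val_typed n}.
  by move=> m mns; apply: vt; rewrite inE mns orbT.
have vt1 : {in ns, forall n, val_typed n}.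
  by move=> m mns; apply: vt'; rewrite mem_cat mns.
have hp := atgt_pm ty p; rewrite obs_cat in hp.
have st := asrc_sem (nout n ++ rest s n) ns t; rewrite obs_cat in st.
have tt := atgt_sem vt1 h; have su := asrc_sem t ns' u.
rewrite IH //; last exact: (step_uniq (ns := ns ++ ns') p us).
rewrite !acompA; try pends.
Qed.

Lemma sem_framer s ns t u : {in ns, forall n, val_typed n} ->
  uniq ((s ++ u) ++ outs ns) -> run s ns t ->
  sem (s ++ u) ns (t ++ u) = sem s ns t ** aid (obs u).
Proof.
elim: ns s => [|n ns IH] s vt us /=.
  by case=> _ st; rewrite pm_cat // pm_refl.
have us' : uniq (s ++ u) by move: us; rewrite cat_uniq => /and3P[].
case=> _ p h; have [vi vo] := vt n (mem_head _ _).
have vt' : {in ns, forall n, val_typed n}.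
  by move=> m mns; apply: vt; rewrite inE mns orbT.
have p' : perm_eq (s ++ u) (nin n ++ rest s n ++ u) by rewrite catA perm_cat2r.
have hp := atgt_pm ty p; rewrite obs_cat in hp.
have st := asrc_sem (nout n ++ rest s n) ns t; rewrite obs_cat in st.
rewrite rest_cat // !catA IH //; last first.
  by rewrite -(catA (nout n)); exact: (step_uniq p' us).
rewrite pm_cat // pm_refl obs_cat -atens_id atensA.
rewrite whisker_r; last pends.
by rewrite whisker_r; last pends.
Qed.

Lemma sem_framel s ns t u : {in ns, forall n, val_typed n} ->
  uniq ((s ++ u) ++ outs ns) -> run s ns t ->
  sem (u ++ s) ns (u ++ t) = aid (obs u) ** sem s ns t.
Proof.
move=> vt us h; have h' := run_frame us h.
have usu : uniq (s ++ u) by move: us; rewrite cat_uniq => /and3P[].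
have p1 : perm_eq (u ++ s) (s ++ u) by rewrite perm_catC.
have p2 : perm_eq (t ++ u) (u ++ t) by rewrite perm_catC.
have h2 := run_perml p1 h'.
have utu := run_uniqr h'.
rewrite -(sem_permr vt p2 h2) -(sem_perml vt p1 h') sem_framer //.
have e1 := asrc_sem s ns t; have e2 := atgt_sem vt h.
rewrite pm_asym; last by rewrite (perm_uniq p1).
rewrite pm_asym // -acompA; try pends.
have := asym_nat (sem s ns t) (aid (obs u)).
rewrite e1 e2 /= => ->; rewrite acompA; try pends.
by rewrite asymK acomp_idl //= e1.
Qed.

(** Up to permutation arrows, both runs start with the tensor product of the
    arrows of m and n: the crossing of the wires of the second node with the
    outputs of the first is undone by naturality. *)
Lemma sem_swap s m n ns t :
  {in [:: m, n & ns], forall n, val_typed n} ->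
  uniq (s ++ outs [:: m, n & ns]) -> run s [:: m, n & ns] t ->
  {subset nin n <= s} ->
  run s [:: n, m & ns] t /\ sem s [:: n, m & ns] t = sem s [:: m, n & ns] t.
Proof.
move=> vt us h sub.
have vt' : {in ns, forall n, val_typed n}.
  by move=> k kns; apply: vt; rewrite !inE kns !orbT.
have vm : val_typed m by apply: vt; rewrite mem_head.
have vn : val_typed n by apply: vt; rewrite !inE eqxx orbT.
case/run_inv: (h) => _ p h1; case/run_inv: (h1) => us2 p2 h2.
pose r := rest (rest s m) n.
have us1 : uniq s by move: us; rewrite cat_uniq => /and3P[].
have pr : perm_eq (rest s m) (nin n ++ r).
  apply: uniq_perm; first exact: filter_uniq.
    have := run_uniq h1; rewrite cat_uniq => /and3P[].
    rewrite (perm_uniq p2) cat_uniq => /and3P[un _ _] _ _.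
    rewrite cat_uniq un !filter_uniq // andbT /=.
    by apply/hasPn => x; rewrite mem_filter => /andP[].
  move=> x; rewrite mem_cat [x \in r]mem_filter; case: (boolP (x \in nin n)) => //= xn.
  have : x \in nout m ++ rest s m by rewrite (perm_mem p2) mem_cat xn.
  rewrite mem_cat => /orP[xm|-> //]; move: us.
  rewrite cat_uniq => /and3P[_ /hasPn/(_ x) + _].
  by rewrite /= sub // mem_cat xm => /(_ isT).
have ps : perm_eq s (nin m ++ nin n ++ r).
  by rewrite (perm_trans p) // perm_cat2l.
have ps' : perm_eq s (nin n ++ nin m ++ r).
  by rewrite (perm_trans ps) //; exact: (permEl (perm_catCA _ _ _)).
have us1' : uniq (nout m ++ rest s m).
  by have := run_uniq h1; rewrite cat_uniq => /and3P[].
have pS : perm_eq (nout m ++ rest s m) (nin n ++ nout m ++ r).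
  apply: (@perm_trans _ (nout m ++ nin n ++ r)); first by rewrite perm_cat2l.
  exact: (permEl (perm_catCA _ _ _)).
(* The state reached after both nodes, in the order that is common to both runs. *)
have hb : run (nout m ++ nout n ++ r) ns t.
  apply: run_perml h2; apply: (@perm_trans _ (nout n ++ nout m ++ r)).
    exact: (permEl (perm_catCA _ _ _)).
  by rewrite perm_cat2l perm_sym; apply: restE.
have pC : perm_eq (outs [:: n, m & ns]) (outs [:: m, n & ns]).
  exact: (permEl (perm_catCA (nout n) (nout m) _)).
have us' : uniq (s ++ outs [:: n, m & ns]).
  by rewrite (perm_uniq (perm_cat (perm_refl s) pC)).
have us1'' := step_uniq ps' us'.
have pS' : perm_eq (nout n ++ nin m ++ r) (nin m ++ nout n ++ r).
  exact: (permEl (perm_catCA _ _ _)).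
have h1' : run (nout n ++ nin m ++ r) (m :: ns) t.
  by apply: (run_cons pS') => //; apply: run_perml hb.
have h' : run s [:: n, m & ns] t.
  by apply: (run_cons ps').
split=> //.
have [vi vo] := vm; have [wi wo] := vn.
have vtm : {in m :: ns, forall n, val_typed n}.
  by move=> k; rewrite inE => /predU1P[->|/vt'].
have vtn : {in n :: ns, forall n, val_typed n}.
  by move=> k; rewrite inE => /predU1P[->|/vt'].
have hb' : run (nout n ++ nout m ++ r) ns t.
  by apply: run_perml hb; exact: (permEl (perm_catCA _ _ _)).
have pO : perm_eq (nout n ++ nout m ++ r) (nout m ++ nout n ++ r).
  exact: (permEl (perm_catCA _ _ _)).
have pI : perm_eq (nin m ++ nin n ++ r) (nin n ++ nin m ++ r).
  exact: (permEl (perm_catCA _ _ _)).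
rewrite (sem_cons vn vtm ps' h') (sem_cons vm vt' pS' h1').
have pS1 : perm_eq (nout m ++ nin n ++ r) (nin n ++ nout m ++ r).
  exact: (permEl (perm_catCA _ _ _)).
have h1n : run (nout m ++ nin n ++ r) (n :: ns) t.
  by apply: run_perml h1; rewrite perm_cat2l perm_sym.
rewrite (sem_cons vm vtn ps h) (sem_cons vn vt' pS1 h1n).
rewrite -(sem_perml vt' pO hb) -(pm_trans ty us1 ps pI).
have asymE u v : uniq (u ++ v ++ r) ->
    pm (u ++ v ++ r) (v ++ u ++ r) = asym (obs u) (obs v) ** aid (obs r).
  rewrite !catA cat_uniq => /and3P[uv _ _].
  by rewrite pm_cat ?pm_refl ?pm_asym // perm_catC.
rewrite !asymE.
- have hp := atgt_pm ty ps; rewrite !obs_cat in hp.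
  have hs := asrc_sem (nout m ++ nout n ++ r) ns t; rewrite !obs_cat in hs.
  rewrite !acompA; try pends; congr (_ >> _).
  have E1 := asym_conj (obs (nin m)) (esym wi) (esym wo).
  have E2 := asym_conj (obs (nout m)) (esym wi) (esym wo).
  rewrite !obs_cat -!atens_id !atensA.
  transitivity (pm s (nin m ++ nin n ++ r) >> (val m ** val n ** aid (obs r))).
    rewrite -!acompA; try pends; congr (_ >> _).
    rewrite acompA; try pends.
    rewrite acompA; try pends.
    rewrite -!whisker_r; try pends.
    by rewrite E1 -vi -wo slide_r.
  rewrite -!acompA; try pends; congr (_ >> _).
  rewrite [X in _ = _ >> X]acompA; try pends.
  rewrite -!whisker_r; try pends.
  by rewrite E2 -vo -wi slide_l.
- exact: run_uniql hb'.
- exact: run_uniql h1n.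
- exact: run_uniql h1'.
- by rewrite -(perm_uniq ps).
Qed.

(** A node that can be fired at the start can be moved to the front: the wires
    that it consumes are produced by no other node, so that it is exchanged with
    each of the preceding nodes by [sem_swap]. *)
Lemma sem_front s n ns ns' t :
  {in ns ++ n :: ns', forall n, val_typed n} ->
  uniq (s ++ outs (ns ++ n :: ns')) -> run s (ns ++ n :: ns') t ->
  {subset nin n <= s} ->
  run s (n :: ns ++ ns') t /\
  sem s (n :: ns ++ ns') t = sem s (ns ++ n :: ns') t.
Proof.
elim: ns s => [|m ns IH] s // vt us h sub; case/run_inv: (h) => _ p h1.
have us1 := run_uniq h1.
have vt' : {in ns ++ n :: ns', forall n, val_typed n}.
  by move=> k kns; apply: vt; rewrite inE kns orbT.
have sub' : {subset nin n <= nout m ++ rest s m}.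
  move=> x xn; have : x \in (nout m ++ rest s m) ++ outs (ns ++ n :: ns').
    by apply: run_mem h1 _ xn; rewrite mem_cat mem_head orbT.
  rewrite mem_cat => /orP[// |/outsP[k kn xk]]; move: us.
  rewrite cat_uniq => /and3P[_ /hasPn H _].
  have /H/negP[] : x \in outs ((m :: ns) ++ n :: ns').
    by apply/outsP; exists k => //; rewrite inE kn orbT.
  exact: sub.
have [h2 E] := IH _ vt' us1 h1 sub'.
have pN : perm_eq [:: m, n & ns ++ ns'] (m :: ns ++ n :: ns').
  by rewrite perm_cons; exact: (permEl (perm_catCA [:: n] ns ns')).
have pC := perm_flatten (perm_map nout pN).
have us2 : uniq (s ++ outs [:: m, n & ns ++ ns']).
  by rewrite (perm_uniq (perm_cat (perm_refl s) pC)).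
have h3 : run s [:: m, n & ns ++ ns'] t by split.
have vt2 : {in [:: m, n & ns ++ ns'], forall n, val_typed n}.
  by move=> k; rewrite (perm_mem pN); exact: vt.
have [h4 E4] := sem_swap vt2 us2 h3 sub.
by split => //; rewrite E4; exact: (congr1 (acomp _) E).
Qed.

(** Independence of the order of the nodes: the first node of one run is moved
    to the front of the other run, and so on. *)
Lemma sem_perm s ns ns' t : {in ns, forall n, val_typed n} -> perm_eq ns ns' ->
  run s ns t -> run s ns' t -> sem s ns t = sem s ns' t.
Proof.
elim: ns s ns' => [|n ns IH] s ns'.
  by rewrite perm_sym => _ /perm_nilP ->.
move=> vt /perm_split[n1 [n2 [-> _ pns]]] h h'.
have vt' : {in n1 ++ n :: n2, forall n, val_typed n}.
  have pn : perm_eq (n1 ++ n :: n2) (n :: n1 ++ n2).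
    exact: (permEl (perm_catCA n1 [:: n] n2)).
  move=> k; rewrite (perm_mem pn) inE -(perm_mem pns) => kn.
  by apply: vt; rewrite inE.
case/run_inv: (h) => us p h1.
have sub : {subset nin n <= s} by move=> x xn; rewrite (perm_mem p) mem_cat xn.
have [h2 <-] := sem_front vt' (run_uniq h') h' sub.
case/run_inv: h2 => _ _ h2 /=; congr (_ >> _); apply: IH => //.
by move=> k kn; apply: vt; rewrite inE kn orbT.
Qed.

End RunArrows.

Lemma obs_map (P : prop_cat) (X Y : eqType) (tx : X -> seq (pob P))
    (ty : Y -> seq (pob P)) (sg : X -> Y) s :
  {in s, forall x, ty (sg x) = tx x} -> obs ty (map sg s) = obs tx s.
Proof.
by move=> h; rewrite /obs -map_comp; congr flatten; exact/eq_in_map.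
Qed.

Section Renaming.
Variables (X N X' N' : eqType) (nin nout : N -> seq X) (nin' nout' : N' -> seq X').
Variables (sg : X -> X') (tau : N -> N').
Implicit Types (s t : seq X) (ns : seq N).

(** Runs are compared along a map of wires and a map of nodes.  This is used for
    relabelling, for substitution and for shifting the variables. *)
Definition renames ns :=
  {in ns, forall n, nin' (tau n) = map sg (nin n) /\ nout' (tau n) = map sg (nout n)}.

Lemma renames_cons n ns : renames (n :: ns) -> renames ns.
Proof. by move=> h m mns; apply: h; rewrite inE mns orbT. Qed.

Lemma outs_map ns : renames ns -> produced nout' (map tau ns) = map sg (produced nout ns).
Proof.
elim: ns => //= n ns IH h; rewrite /produced /= map_cat -/(produced _ _) -IH.
  by case: (h n (mem_head _ _)) => _ ->.
exact: renames_cons h.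
Qed.

Lemma ins_map ns : renames ns -> consumed nin' (map tau ns) = map sg (consumed nin ns).
Proof.
elim: ns => //= n ns IH h; rewrite /consumed /= map_cat -/(consumed _ _) -IH.
  by case: (h n (mem_head _ _)) => ->.
exact: renames_cons h.
Qed.

Lemma rest_map s n : nin' (tau n) = map sg (nin n) ->
  {subset nin n <= s} -> {in s &, injective sg} ->
  remaining nin' (map sg s) (tau n) = map sg (remaining nin s n).
Proof.
move=> e0 sub inj; rewrite /remaining e0 filter_map; congr map.
apply: eq_in_filter => x xs /=; congr (~~ _); apply/mapP/idP => [[y yn /inj e]|xn].
  by rewrite e //; exact: sub.
by exists x.
Qed.

Lemma inj_step s n ns : perm_eq s (nin n ++ remaining nin s n) ->
  {in s ++ produced nout (n :: ns) &, injective sg} ->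
  {in (nout n ++ remaining nin s n) ++ produced nout ns &, injective sg}.
Proof.
move=> p; apply: sub_in2 => x H.
by rewrite (perm_mem (step_perm nout ns p)) mem_cat H orbT.
Qed.

Lemma run_map s ns t : renames ns -> {in s ++ produced nout ns &, injective sg} ->
  run nin nout s ns t -> run nin' nout' (map sg s) (map tau ns) (map sg t).
Proof.
elim: ns s => [|n ns IH] s /=.
  by rewrite cats0 => _ inj [us /(perm_map sg)]; rewrite map_inj_in_uniq.
move=> rn inj [us p h]; have [ei eo] := rn n (mem_head _ _).
have sub : {subset nin n <= s} by move=> x xn; rewrite (perm_mem p) mem_cat xn.
have injs : {in s &, injective sg}.
  by apply: sub_in2 inj => x xs; rewrite mem_cat xs.
rewrite rest_map // ei eo -!map_cat; split.
- by rewrite (outs_map (ns := n :: ns)) // -map_cat map_inj_in_uniq.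
- exact: perm_map.
- by apply: IH h; [exact: renames_cons rn | exact: inj_step inj].
Qed.

Variables (P : prop_cat) (ty : X -> seq (pob P)) (ty' : X' -> seq (pob P)).
Variables (val : N -> arrow P) (val' : N' -> arrow P).

Lemma sem_map s ns t : renames ns -> {in s ++ produced nout ns &, injective sg} ->
  {in s ++ produced nout ns, forall x, ty' (sg x) = ty x} ->
  {in ns, forall n, val' (tau n) = val n} ->
  run nin nout s ns t ->
  sem nin' nout' ty' val' (map sg s) (map tau ns) (map sg t) =
  sem nin nout ty val s ns t.
Proof.
elim: ns s => [|n ns IH] s /=.
  by rewrite cats0 => _ inj et _ [_ st]; exact: pm_map.
move=> rn inj et ev [us p h]; have [ei eo] := rn n (mem_head _ _).
have sub : {subset nin n <= s} by move=> x xn; rewrite (perm_mem p) mem_cat xn.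
have sin x : x \in s -> x \in s ++ produced nout (n :: ns).
  by move=> xs; rewrite mem_cat xs.
have injs : {in s &, injective sg} by apply: sub_in2 inj.
have ets : {in s, forall x, ty' (sg x) = ty x} by apply: sub_in1 et.
have etr : {in remaining nin s n, forall x, ty' (sg x) = ty x}.
  by apply: sub_in1 ets => x; rewrite mem_filter => /andP[].
rewrite rest_map // ei eo -!map_cat (pm_map (tx := ty)) //.
rewrite ev ?mem_head // (obs_map etr); congr (_ >> _); apply: IH h.
- exact: renames_cons rn.
- exact: inj_step inj.
- move=> x xs; apply: et.
  by rewrite (perm_mem (step_perm nout ns p)) mem_cat xs orbT.
- by move=> m mns; apply: ev; rewrite inE mns orbT.
Qed.

End Renaming.

Section Functor.
Variables (P Q : prop_cat) (F : prop_mor P Q).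
Implicit Types (f g : arrow P) (A B : seq (pob P)).

Definition amap f : arrow Q := Arrow (pmhom F (ahom f)).

Lemma amap_id A : amap (aid A) = aid (map (pmob F) A).
Proof. by rewrite /amap /= pm_id. Qed.

Lemma amap_comp f g : atgt f = asrc g -> amap (f >> g) = amap f >> amap g.
Proof.
case: f g => A B f [B' C g] /= e; case: B' / e g => g.
by rewrite acompE /amap /= acompE pm_comp.
Qed.

Lemma amap_tens f g : amap (f ** g) = amap f ** amap g.
Proof. by rewrite /amap /atens /= -pm_tens arrow_cast. Qed.

Lemma amap_asym A B : amap (asym A B) = asym (map (pmob F) A) (map (pmob F) B).
Proof. by rewrite /asym /amap /= -pm_symm arrow_cast. Qed.

Variables (X N : eqType) (nin nout : N -> seq X).
Variables (ty : X -> seq (pob P)) (val : N -> arrow P).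
Let ty' x := map (pmob F) (ty x).
Let val' n := amap (val n).

Lemma map_obs s : map (pmob F) (obs ty s) = obs ty' s.
Proof. by rewrite /obs map_flatten -map_comp. Qed.

Lemma amap_pm s t : perm_eq s t -> amap (pm ty s t) = pm ty' s t.
Proof.
elim: s t => [|x s IH] t; first by rewrite /= amap_id.
move=> /perm_split[t1 [t2 [-> xt1 st]]]; rewrite !pm_cons //.
have h := atgt_pm ty st; rewrite obs_cat in h; rewrite amap_comp; last pends.
by rewrite !amap_tens !amap_id amap_asym IH // !map_obs.
Qed.

Lemma amap_sem s ns t : {in ns, forall n, val_typed nin nout ty val n} ->
  run nin nout s ns t ->
  amap (sem nin nout ty val s ns t) = sem nin nout ty' val' s ns t.
Proof.
elim: ns s => [|n ns IH] s vt /=; first by case=> _ st; exact: amap_pm.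
case=> us p h; have [vi vo] := vt n (mem_head _ _).
have vt' : {in ns, forall n, val_typed nin nout ty val n}.
  by move=> m mns; apply: vt; rewrite inE mns orbT.
have hp := atgt_pm ty p; rewrite obs_cat in hp.
have st := asrc_sem nin nout ty val (nout n ++ remaining nin s n) ns t.
rewrite obs_cat in st.
rewrite amap_comp; last pends.
rewrite amap_comp; last pends.
by rewrite IH // amap_pm // amap_tens amap_id map_obs.
Qed.

End Functor.

(** * Judgments as string diagrams *)

HB.instance Definition _ (G : signature) (L : Type) := gen_eqMixin (term G L).

Section Terms.
Variables (G : signature) (L : eqType).
Local Notation term := (term G L).
Implicit Types (A B C : seq (sob G)) (f h : sarr G) (t x n : term) (N Ms Zs : seq term).

Lemma term_induction (Q : term -> Prop) :
  (forall i, Q (Var _ _ i)) -> (forall f a k, Q (Cst f a k)) ->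
  (forall f Ms k, {in Ms, forall M, Q M} -> Q (App f Ms k)) ->
  (forall f Ms, {in Ms, forall M, Q M} -> Q (Scal f Ms)) ->
  forall t, Q t.
Proof.
move=> QV QC QA QS; fix IH 1.
case=> [i|f a k|f Ms k|f Ms]; [exact: QV|exact: QC|apply: QA|apply: QS];
elim: Ms => [|M Ms IHs] M'; [discriminate|rewrite in_cons => /predU1P[->|]
            |discriminate|rewrite in_cons => /predU1P[->|]].
- exact: (IH M).
- exact: IHs.
- exact: (IH M).
- exact: IHs.
Qed.

(** The number of the rule that introduces a term in a derivation, the identity
    rule being numbered 0. *)
Fixpoint lev t : nat :=
  match t with
  | App _ Ms _ | Scal _ Ms => foldr (fun M => maxn (lev M).+1) 0 Ms
  | _ => 0
  end.

(** A node is represented by the term of its first output, or by the scalar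
    term; thus substitution and relabelling act on nodes as they do on terms. *)
Definition nin n : seq term :=
  match n with App _ Ms _ | Scal _ Ms => Ms | _ => [::] end.

Definition nout n : seq term :=
  match n with Cst f a _ => csts f a | App f Ms _ => apps f Ms | _ => [::] end.

Definition is_scal n : bool := if n is Scal _ _ then true else false.

Definition clab n : seq L := if n is Cst _ a _ then [:: a] else [::].

Definition labs N := flatten (map clab N).

Definition tyo A t : option (sob G) :=
  match t with
  | Var i => onth A i
  | Cst f _ k | App f _ k => onth (scod f) k
  | Scal _ _ => None
  end.

Definition is_node A n : Prop :=
  match n with
  | Var _ => False
  | Cst f _ k => [/\ k = 0, sdom f = [::] & scod f <> [::]]
  | App f Ms k => [/\ k = 0, sdom f <> [::], scod f <> [::]
                    & map (tyo A) Ms = map Some (sdom f)]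
  | Scal f Ms => scod f = [::] /\ map (tyo A) Ms = map Some (sdom f)
  end.

Definition node_of t : term :=
  match t with
  | Cst f a _ => Cst f a 0
  | App f Ms _ => App f Ms 0
  | _ => t
  end.

Local Notation ins := (consumed nin).
Local Notation outs := (produced nout).

(** N lists the nodes of the diagram; the clause on wires says that each variable
    and each output of a node is consumed exactly once. *)
Record good A N Ms Zs B : Prop := Good {
  good_labs : uniq (labs N);
  good_node : {in N, forall n, is_node A n};
  good_ty : map (tyo A) Ms = map Some B;
  good_perm : perm_eq (vars L A ++ outs N) (ins N ++ Ms);
  good_scal : perm_eq (filter is_scal N) Zs }.

Lemma lev_mem M Ms : M \in Ms ->
  lev M < foldr (fun M => maxn (lev M).+1) 0 Ms.
Proof.
elim: Ms => //= M' Ms IH; rewrite inE leq_max => /predU1P[->|/IH ->].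
  by rewrite leqnn.
by rewrite orbT.
Qed.

Lemma lev_nin n x : x \in nin n -> lev x < lev n.
Proof. by case: n => //= [f Ms k|f Ms]; exact: lev_mem. Qed.

Lemma mem_csts f a x : x \in csts f a -> exists2 k, k < size (scod f) & x = Cst f a k.
Proof. by case/mapP => k; rewrite mem_iota => /= ks ->; exists k. Qed.

Lemma mem_apps f Ms x :
  x \in apps f Ms -> exists2 k, k < size (scod f) & x = App f Ms k.
Proof. by case/mapP => k; rewrite mem_iota => /= ks ->; exists k. Qed.

Lemma lev_nout n x : x \in nout n -> lev x = lev n.
Proof.
by case: n => //= [f a k|f Ms k]; [case/mem_csts|case/mem_apps] => i _ ->.
Qed.

Lemma lev_lt n m x : x \in nin n -> x \in nout m -> lev m < lev n.
Proof. by move=> /lev_nin + /lev_nout <-. Qed.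

Lemma uniq_nout n : uniq (nout n).
Proof.
by case: n => //= [f a _|f Ms _]; rewrite map_inj_uniq ?iota_uniq // => i j [].
Qed.

Lemma nout_node A n x : is_node A n -> x \in nout n -> node_of x = n.
Proof.
case: n => //= [f a k|f Ms k] [-> _ _]; first by case/mem_csts => i _ ->.
by move=> _ /mem_apps [i _ ->].
Qed.

Lemma node_nout A n : is_node A n -> ~~ is_scal n -> n \in nout n.
Proof.
have lt0 f : scod f <> [::] -> 0 < size (scod f) by case: scod.
case: n => //= [f a k|f Ms k] [-> _ /lt0 f0]; [move=> _|move=> _ _];
by apply/mapP; exists 0 => //; rewrite mem_iota.
Qed.

Lemma count_outs A N x : {in N, forall n, is_node A n} ->
  count_mem x (outs N) = count_mem (node_of x) N * (x \in nout (node_of x)).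
Proof.
elim: N => // n N IH gN; rewrite /outs /= count_cat -/(outs N) IH; last first.
  by move=> m mN; apply: gN; rewrite inE mN orbT.
rewrite mulnDl; congr (_ + _); rewrite count_uniq_mem ?uniq_nout //.
have gn := gN n (mem_head _ _).
case: (boolP (x \in nout n)) => [xn|]; first by rewrite (nout_node gn xn) eqxx xn.
by case: eqP => [->|] // /negbTE ->.
Qed.

Lemma uniq_vars A : uniq (vars L A).
Proof. by rewrite map_inj_uniq ?iota_uniq // => i j []. Qed.

Lemma tyo_vars A : map (tyo A) (vars L A) = map Some A.
Proof.
apply: eq_from_onth => i; rewrite /vars !onth_map.
case: (ltnP i (size A)) => iA; last by rewrite !onth_default ?size_iota.
have -> : onth (iota 0 (size A)) i = Some i.
  by rewrite onthE (nth_map 0) ?size_iota // nth_iota.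
by rewrite /=; case: onth (onthTE A i); rewrite ?iA.
Qed.

Lemma mem_vars A x : x \in vars L A -> exists2 i, i < size A & x = Var _ _ i.
Proof. by case/mapP => i; rewrite mem_iota => /= iA ->; exists i. Qed.

Lemma count_labs f a N : count_mem (Cst f a 0) N <= count_mem a (labs N).
Proof.
elim: N => //= n N IH; rewrite /labs /= count_cat leq_add //.
by case: eqP => // ->; rewrite /= eqxx.
Qed.

(** Equal wires come from equal nodes.  Equal constants have the same label.  If
    a generator with arguments occurred twice, its first argument would be
    consumed twice, hence produced twice, against the induction hypothesis on
    the level. *)
Lemma good_uniq A N Ms Zs B : good A N Ms Zs B -> uniq (vars L A ++ outs N).
Proof.
move=> [gl gn gt gp gs].
suff H k : forall x, lev x < k -> count_mem x (vars L A ++ outs N) <= 1.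
  apply: count_mem_uniq => x; have := H _ x (leqnn _).
  rewrite -has_pred1 has_count.
  by case: (count _ _) => [|[]].
elim: k => // k IH x; rewrite ltnS count_cat => xk.
have V : ~~ (if x is Var _ then true else false) -> count_mem x (vars L A) = 0.
  by move=> nx; apply/count_memPn; apply: contra nx => /mem_vars[i _ ->].
case: (x) xk V => [i|f a i|f Ks i|f Ks] xk V.
- rewrite (count_outs _ gn) /= muln0 addn0.
  by rewrite count_uniq_mem ?uniq_vars // leq_b1.
- rewrite V // add0n (count_outs _ gn) /=.
  apply: leq_trans (_ : count_mem (Cst f a 0) N <= 1).
    by case: (_ \in _); rewrite ?muln1 ?muln0.
  by apply: leq_trans (count_labs _ _ _) _; rewrite count_uniq_mem // leq_b1.
- rewrite V // add0n (count_outs _ gn) /=.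
  apply: leq_trans (_ : count_mem (App f Ks 0) N <= 1).
    by case: (_ \in _); rewrite ?muln1 ?muln0.
  case: (boolP (App f Ks 0 \in N)) => [/gn /= [_ d0 _ tyK]|]; last first.
    by move/count_memPn ->.
  case: Ks xk tyK {V} => [|K Ks] xk tyK.
    by case: d0; case: sdom tyK.
  have Kk : lev K < k by apply: leq_trans xk; apply: lev_mem; exact: mem_head.
  apply: leq_trans (IH _ Kk); rewrite (permP gp) count_cat.
  apply: leq_trans (leq_addr _ _).
  elim: (N) => //= n N' IHN; rewrite /ins /= count_cat; apply: leq_add => //.
  by case: eqP => // ->; rewrite /= eqxx.
- by rewrite V // (count_outs _ gn) /= muln0.
Qed.
End Terms.

(** Equalities of multisets of wires are proved by counting. *)
Ltac count_lia :=
  repeat match goal with |- context [count ?p ?s] => move: (count p s) end;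
  intros; lia.

Section Good.
Variables (G : signature) (L : eqType).
Local Notation term := (term G L).
Implicit Types (A B C : seq (sob G)) (f h : sarr G) (t x n : term) (N Ms Zs : seq term).
Local Notation ins := (consumed (@nin G L)).
Local Notation outs := (produced (@nout G L)).
Local Notation jlab Ms := (flatten (map (@labels G L) Ms)).

Lemma In_mem (T : eqType) (a : T) s : List.In a s <-> a \in s.
Proof.
elim: s => //= b s [H1 H2]; rewrite inE; split.
  by case=> [->|/H1 ->]; rewrite ?eqxx ?orbT.
by case/predU1P => [->|/H2]; [left|right].
Qed.

Lemma lev_bound N : exists K, {in N, forall n, lev n < K}.
Proof.
elim: N => [|n N [K h]]; first by exists 0.
exists (maxn (lev n).+1 K) => m; rewrite inE leq_max => /predU1P[->|/h ->].
  by rewrite leqnn.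
by rewrite orbT.
Qed.

(** Induction on the nodes from the outputs of the diagram down. *)
Lemma down_induction N (Q : term -> Prop) :
  {in N, forall n, {in N, forall m, lev n < lev m -> Q m} -> Q n} ->
  {in N, forall n, Q n}.
Proof.
move=> step; have [K hK] := lev_bound N.
suff H d : {in N, forall n, K - lev n <= d -> Q n}.
  by move=> n nN; exact: (H _ n nN (leqnn _)).
elim: d => [|d IH] n nN dn.
  by have := hK n nN; rewrite -subn_gt0 ltnNge dn.
apply: step => // m mN nm; apply: IH => //.
by rewrite -ltnS (leq_trans _ dn) // ltn_sub2l // hK.
Qed.

Lemma node_nout_outs A N n : is_node A n -> n \in N -> ~~ is_scal n -> n \in outs N.
Proof. by move=> gn nN sn; apply/outsP; exists n => //; exact: node_nout gn sn. Qed.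

(** The first output of a node is an output of the judgment or an argument of a
    node of higher level, so all nodes are found in the terms, from the outputs
    down. *)
Lemma nodes_sub A N N' Ms Zs B B' : good A N Ms Zs B -> good A N' Ms Zs B' ->
  {subset N <= N'}.
Proof.
move=> g g'; have gn := good_node g; have gn' := good_node g'.
apply: down_induction => n nN IH; case sn: (is_scal n).
  have : n \in filter (@is_scal G L) N' by
    rewrite (perm_mem (good_scal g')) -(perm_mem (good_scal g)) mem_filter sn.
  by rewrite mem_filter => /andP[].
have nn := node_nout (gn n nN) (negbT sn).
have : n \in vars L A ++ outs N' by
  rewrite (perm_mem (good_perm g')); have : n \in vars L A ++ outs N by
    [rewrite mem_cat (node_nout_outs (gn n nN)) ?sn ?orbT];
  rewrite (perm_mem (good_perm g)) !mem_cat => /orP[/insP[m mN nm]|->];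
  [rewrite (_ : n \in ins N') //; apply/insP; exists m => //;
   apply: IH => //; exact: lev_nin|rewrite orbT].
rewrite mem_cat => /orP[/mem_vars[i _ E]|/outsP[m mN' nm]].
  by move: (gn n nN); rewrite E.
by rewrite -(nout_node (gn n nN) nn) (nout_node (gn' m mN') nm).
Qed.

Lemma nodes_uniq A N Ms Zs B : good A N Ms Zs B ->
  uniq (filter (predC (@is_scal G L)) N).
Proof.
move=> g; apply: count_mem_uniq => n; have gn := good_node g.
case: (boolP (n \in _)) => [|/count_memPn //]; rewrite mem_filter /= => /andP[sn nN].
have nn := node_nout (gn n nN) sn.
apply/eqP; rewrite eqn_leq; apply/andP; split; last first.
  by rewrite -has_count has_pred1 mem_filter /= sn.
have U := good_uniq g; move: U; rewrite cat_uniq => /and3P[_ _ U].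
have := count_uniq_mem n U; rewrite (count_outs _ gn) (nout_node (gn n nN) nn) nn muln1.
move=> E; apply: leq_trans (_ : count_mem n N <= 1); last by rewrite E leq_b1.
by rewrite count_filter; apply: sub_count => m /= /andP[].
Qed.

Lemma nodes_perm A N N' Ms Zs B B' : good A N Ms Zs B -> good A N' Ms Zs B' ->
  perm_eq N N'.
Proof.
move=> g g'; rewrite -(perm_filterC (@is_scal G L) N) perm_sym.
rewrite -(perm_filterC (@is_scal G L) N') perm_sym; apply: perm_cat.
  by rewrite (permPl (good_scal g)) perm_sym (good_scal g').
apply: uniq_perm; [exact: nodes_uniq g|exact: nodes_uniq g'|] => n.
rewrite !mem_filter; congr (_ && _).
by apply/idP/idP; [exact: (nodes_sub g g')|exact: (nodes_sub g' g)].
Qed.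

(** A wire that carries a label is an output of the judgment, or is consumed by
    a scalar term, or is consumed by a node whose outputs carry this label too
    and have a higher level. *)
Lemma labs_jlab A N Ms Zs B : good A N Ms Zs B ->
  {subset labs N <= jlab (Ms ++ Zs)}.
Proof.
move=> g a /flatten_mapP[n nN an]; have gn := good_node g.
have an' : a \in labels n by case: (n) an.
move: n nN an' {an}.
apply: (down_induction (Q := fun n => a \in labels n -> _)) => n nN IH an.
apply/flatten_mapP; case sn: (is_scal n).
  by exists n => //; rewrite mem_cat -(perm_mem (good_scal g)) mem_filter sn nN orbT.
have : n \in vars L A ++ outs N by
  rewrite mem_cat (node_nout_outs (gn n nN)) ?sn ?orbT.
rewrite (perm_mem (good_perm g)) mem_cat => /orP[/insP[m mN nm]|nM]; last first.
  by exists n => //; rewrite mem_cat nM.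
apply/flatten_mapP; apply: (IH m mN (lev_nin nm)).
by case: m nm {mN} => //= [f Ks k|f Ks] nK; apply/flatten_mapP; exists n.
Qed.

(** Substitutions from the context B to the context A that respect types. *)
Definition wsubst A B (r : nat -> term) :=
  forall i b, onth B i = Some b -> tyo A (r i) = Some b.

Lemma subst_tyo A B r t b : wsubst A B r -> tyo B t = Some b ->
  tyo A (subst r t) = Some b.
Proof. by case: t => //= i h /h. Qed.

Lemma subst_typed A B r Ms Bs : wsubst A B r -> map (tyo B) Ms = map Some Bs ->
  map (tyo A) (map (subst r) Ms) = map Some Bs.
Proof.
move=> h; elim: Ms Bs => [|M Ms IH] [|b Bs] //= [tM /IH ->].
by rewrite (subst_tyo h tM).
Qed.

Lemma subst_node A B r n : wsubst A B r -> is_node B n -> is_node A (subst r n).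
Proof.
move=> h; case: n => //= [f Ks k|f Ks]; first by case=> ? ? ? /(subst_typed h).
by case=> ? /(subst_typed h).
Qed.

Lemma subst_nout r n B : is_node B n -> nout (subst r n) = map (subst r) (nout n).
Proof. by case: n => //= [f a k|f Ks k] _; rewrite -map_comp. Qed.

Lemma subst_nin r n B : is_node B n -> nin (subst r n) = map (subst r) (nin n).
Proof. by case: n. Qed.

Lemma subst_renames r B N : {in N, forall n, is_node B n} ->
  renames (@nin G L) (@nout G L) (@nin G L) (@nout G L) (subst r) (subst r) N.
Proof. by move=> h n /h gn; rewrite (subst_nin r gn) (subst_nout r gn). Qed.

Lemma subst_labs r B N : {in N, forall n, is_node B n} ->
  labs (map (subst r) N) = labs N.
Proof.
elim: N => //= n N IH h; rewrite /labs /= -!/(labs _) IH; last first.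
  by move=> m mN; apply: h; rewrite inE mN orbT.
by case: n h => // i h; case: (h _ (mem_head _ _)).
Qed.

Lemma subst_is_scal r B N : {in N, forall n, is_node B n} ->
  filter (@is_scal G L) (map (subst r) N) = map (subst r) (filter (@is_scal G L) N).
Proof.
move=> h; rewrite filter_map; congr map; apply: eq_in_filter => n /h.
by case: n.
Qed.

Lemma wsubst_nth A B Ms : map (tyo A) Ms = map Some B ->
  wsubst A B (fun i => nth (Var _ _ i) Ms i).
Proof.
move=> tM i b Bi; have := onth_map i Ms (tyo A); rewrite tM onth_map Bi /=.
by case E: (onth Ms i) => [M|] //= [->]; rewrite (onth_nth _ _ _ _ E).
Qed.

Lemma subst_vars Ms m : size Ms = m ->
  map (subst_list Ms) (map (Var _ _) (iota 0 m)) = Ms.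
Proof.
move=> <-; rewrite -map_comp; apply: (@eq_from_nth _ (Var _ _ 0)).
  by rewrite size_map size_iota.
move=> i; rewrite size_map size_iota => iM.
rewrite (nth_map 0) ?size_iota //= nth_iota //= /subst_list /= add0n.
exact: set_nth_default.
Qed.

Lemma good_comp A B C N N' Ms Ms' Zs Zs' :
  good A N Ms Zs B -> good B N' Ms' Zs' C -> uniq (labs N' ++ labs N) ->
  good A (map (subst_list Ms) N' ++ N) (map (subst_list Ms) Ms')
    (map (subst_list Ms) Zs' ++ Zs) C.
Proof.
move=> g g' ul; have gn := good_node g; have gn' := good_node g'.
have hw := wsubst_nth (good_ty g).
have sMs : map (subst_list Ms) (vars L B) = Ms.
  by apply: subst_vars; rewrite -(size_map (tyo A)) (good_ty g) size_map.
have rn : renames (@nin G L) (@nout G L) (@nin G L) (@nout G L)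
  (subst_list Ms) (subst_list Ms) N' by exact: subst_renames gn'.
split.
- by rewrite /labs map_cat flatten_cat -!/(labs _) (subst_labs _ gn').
- move=> n; rewrite mem_cat => /orP[/mapP[m /gn' mN' ->]|/gn //].
  exact: subst_node mN'.
- exact: subst_typed (good_ty g').
- rewrite outs_cat ins_cat (outs_map rn) (ins_map rn).
  have := perm_map (subst_list Ms) (good_perm g'); rewrite !map_cat sMs => p'.
  apply/permP => a; have := permP p' a; have := permP (good_perm g) a.
  by rewrite !count_cat; count_lia.
- rewrite filter_cat (subst_is_scal _ gn'); apply: perm_cat (good_scal g).
  exact: perm_map (good_scal g').
Qed.
End Good.

(** * Derivability *)

HB.instance Definition _ (G : signature) (L : Type) := gen_eqMixin (entry G L).

Section Permute.

Lemma map_permute (T U : Type) (g : T -> U) s (l : seq T) :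
  map g (permute s l) = permute s (map g l).
Proof.
elim: s => //= i s IH; rewrite /permute /= onth_map.
by case: (onth l i) => [x|] /=; [congr cons|]; exact: IH.
Qed.

Lemma permute_perm (T : eqType) s (l : seq T) :
  is_permutation (size l) s -> perm_eq (permute s l) l.
Proof.
have -> : perm_eq (permute s l) l = perm_eq (permute s l) (permute (iota 0 (size l)) l).
  congr perm_eq; elim: l => //= x l IH; rewrite /permute /= -[1]/(1 + 0) iotaDl.
  by congr (x :: _); rewrite {1}IH; elim: (iota _ _) => //= i r ->.
exact: perm_pmap.
Qed.

Lemma index_uniq_iota (T : eqType) (l : seq T) :
  uniq l -> map (index^~ l) l = iota 0 (size l).
Proof.
case: l => // x0 l; move: (x0 :: l) => {}l ul.
apply: (@eq_from_nth _ 0); rewrite size_map ?size_iota // => i il.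
by rewrite (nth_map x0) // nth_iota // index_uniq.
Qed.

Section Arrange.
Variables (T : eqType) (l0 l : seq T).
Hypotheses (ul0 : uniq l0) (pl : perm_eq l l0).
Let s := map (index^~ l0) l.

Lemma arrange_permutation : is_permutation (size l0) s.
Proof. by rewrite /is_permutation -index_uniq_iota //; exact: perm_map. Qed.

Lemma arrange_permute : permute s l0 = l.
Proof.
have : {subset l <= l0} by move=> x; rewrite (perm_mem pl).
rewrite /s; elim: (l) => //= x r IH sub; rewrite /permute /=.
have xl : x \in l0 by apply: sub; rewrite mem_head.
rewrite onthE (nth_map x) ?index_mem // nth_index //=; congr cons.
by apply: IH => y yr; apply: sub; rewrite inE yr orbT.
Qed.

(** The permutation of a rule is read off from the positions in l0 of the
    entries of l.  It keeps the order of some of them if they occur in l in the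
    same order as in l0. *)
Lemma arrange_keeps_order (p : pred nat) :
  subseq (filter (fun x => p (index x l0)) l) l0 -> keeps_order p s.
Proof.
move=> sub; rewrite /keeps_order /s filter_map.
apply: (subseq_sorted ltn_trans (map_subseq (index^~ l0) sub)).
by rewrite index_uniq_iota // iota_ltn_sorted.
Qed.

End Arrange.

Lemma block_starts_cons m k ks :
  block_starts m (k :: ks) = m :: block_starts (m + k) ks.
Proof.
rewrite /block_starts /= addn0 -[1]/(1 + 0) iotaDl -map_comp; congr cons.
by apply: eq_map => i /=; rewrite addnA.
Qed.

Lemma index_block_starts (T : eqType) (x : T) v bs r :
  {in bs, forall b, b <> [::]} ->
  index x (v ++ flatten bs ++ r) \in block_starts (size v) (map size bs) ->
  x \in v ++ flatten bs ++ r -> x \in pmap ohead bs.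
Proof.
elim: bs v => //= b bs IH v hb; rewrite block_starts_cons inE.
case: b hb => [|y b] hb; first by case: (hb [::] (mem_head _ _)).
case/predU1P => [ix xl|].
  by rewrite inE -(nth_index y xl) ix nth_cat ltnn subnn /= eqxx.
rewrite -catA catA -size_cat => i1 x1; rewrite /= inE; apply/orP; right.
by apply: IH i1 x1 => c cb; apply: hb; rewrite inE cb orbT.
Qed.

Lemma subseq_heads (T : eqType) (bs : seq (seq T)) : subseq (pmap ohead bs) (flatten bs).
Proof.
elim: bs => //= [[|x b] bs IH] //=; rewrite eqxx.
exact: subseq_trans IH (suffix_subseq _ _).
Qed.

(** The entries inherited from the premise must occur in l in their order in l0,
    and so must the first entries of the blocks. *)
Lemma arrange_blocks (T : eqType) (v : seq T) bs r l :
  uniq (v ++ flatten bs ++ r) -> perm_eq l (v ++ flatten bs ++ r) ->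
  {in bs, forall b, b <> [::]} ->
  filter [in pmap ohead bs] l = pmap ohead bs -> filter [in r] l = r ->
  exists s, [/\ is_permutation (size (v ++ flatten bs ++ r)) s,
    permute s (v ++ flatten bs ++ r) = l,
    keeps_order (mem (block_starts (size v) (map size bs))) s
    & keeps_order (fun i => size v + size (flatten bs) <= i) s].
Proof.
move=> u p hb hh hr; set l0 := v ++ _ in u p *; exists (map (index^~ l0) l).
have ll0 : {subset l <= l0} by move=> x; rewrite (perm_mem p).
split.
- exact: arrange_permutation.
- exact: arrange_permute.
- apply: arrange_keeps_order => //.
  rewrite (_ : filter _ l =
      filter (fun x => mem (block_starts (size v) (map size bs)) (index x l0))
        (filter [in pmap ohead bs] l)).
    rewrite hh; apply: subseq_trans (filter_subseq _ _) _.
    apply: subseq_trans (subseq_heads bs) _.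
    by rewrite /l0; apply: subseq_trans (suffix_subseq v _); exact: prefix_subseq.
  rewrite -filter_predI; apply: eq_in_filter => x xl /=.
  apply/idP/andP => [i|[]//]; split=> //; apply: index_block_starts i _ => //.
  exact: ll0.
- apply: arrange_keeps_order => //.
  rewrite (_ : filter _ l = r).
    by rewrite /l0 catA; exact: suffix_subseq.
  rewrite -[RHS]hr; apply: eq_in_filter => x /ll0 xl.
  rewrite /l0 catA index_cat -size_cat.
  case: (boolP (x \in v ++ flatten bs)) => [xv|xv].
    rewrite leqNgt index_mem xv /=; apply/esym/negP => xr.
    by move: u; rewrite /l0 catA cat_uniq => /and3P[_ /hasPn/(_ _ xr)/negP].
  rewrite leq_addr; apply/esym; move: xl.
  by rewrite /l0 catA mem_cat (negbTE xv).
Qed.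

(** Scalar terms can be repeated, so the positions in z are arranged instead of
    the entries of z. *)
Lemma arrange_shuffle (T : Type) (p : pred T) (z : seq T) :
  exists t, [/\ is_permutation (size (filter p z) + size (filter (predC p) z)) t,
    permute t (filter p z ++ filter (predC p) z) = z,
    keeps_order (fun i => i < size (filter p z)) t
    & keeps_order (fun i => size (filter p z) <= i) t].
Proof.
case: z => [|x0 z]; first by exists [::].
move: (x0 :: z) => {}z.
pose q i := p (nth x0 z i); pose l := iota 0 (size z).
pose l0 := filter q l ++ filter (predC q) l.
have zE : z = map (nth x0 z) l by rewrite map_nth_iota0 // take_size.
have E1 : filter p z = map (nth x0 z) (filter q l) by rewrite {1}zE filter_map.
have E2 : filter (predC p) z = map (nth x0 z) (filter (predC q) l).
  by rewrite {1}zE filter_map.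
have pl : perm_eq l l0 by rewrite perm_sym; exact: (permEl (perm_filterC _ _)).
have ul0 : uniq l0 by rewrite -(perm_uniq pl) iota_uniq.
exists (map (index^~ l0) l); rewrite E1 E2 !size_map -map_cat -map_permute.
have side x : x \in l -> index x l0 < size (filter q l) = q x.
  move=> xl; rewrite /l0 index_cat mem_filter xl andbT.
  by case: ifP => qx; [rewrite index_mem mem_filter qx xl|rewrite ltnNge leq_addr].
split.
- by rewrite -size_cat; exact: arrange_permutation.
- by rewrite arrange_permute.
- apply: arrange_keeps_order => //.
  have -> : [seq x <- l | index x l0 < size (filter q l)] = filter q l.
    by apply: eq_in_filter => x /side.
  exact: prefix_subseq.
- apply: arrange_keeps_order => //.
  have -> : [seq x <- l | size (filter q l) <= index x l0] = filter (predC q) l.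
    by apply: eq_in_filter => x /side /= <-; rewrite -leqNgt.
  exact: suffix_subseq.
Qed.

End Permute.

Section Derivable.
Variables (G : signature) (L : eqType).
Local Notation term := (term G L).
Local Notation entry := (entry G L).
Implicit Types (A B C : seq (sob G)) (f h : sarr G) (t x n : term) (N Ms Zs : seq term)
  (e : entry) (l r : seq entry).
Local Notation ins := (consumed (@nin G L)).
Local Notation outs := (produced (@nout G L)).

Lemma etm_active Ms B : size Ms = size B -> map (@etm G L) (active_entries Ms B) = Ms.
Proof. exact: etm_active_entries. Qed.

Lemma ety_active Ms B : size Ms = size B -> map (@ety G L) (active_entries Ms B) = B.
Proof. by elim: Ms B => [|M Ms IH] [|b B] //= [/IH ->]. Qed.

Lemma size_csts f (a : L) : size (csts f a) = size (scod f).
Proof. by rewrite size_mkseq. Qed.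

Lemma size_apps f Ms : size (apps f Ms) = size (scod f).
Proof. by rewrite size_mkseq. Qed.

Lemma size_vars A : size (vars L A) = size A.
Proof. by rewrite size_map size_iota. Qed.

Lemma mkseq_onth (T : Type) (s : seq T) : mkseq (onth s) (size s) = map Some s.
Proof.
case: s => // x s; move: (x :: s) => {}s.
by apply: (@eq_from_nth _ None); rewrite size_mkseq ?size_map // => i is_;
   rewrite nth_mkseq // onthE.
Qed.

Lemma tyo_csts A f (a : L) : map (tyo A) (csts f a) = map Some (scod f).
Proof. by rewrite -mkseq_onth /csts /mkseq -map_comp. Qed.

Lemma tyo_apps A f Ms : map (tyo A) (apps f Ms) = map Some (scod f).
Proof. by rewrite -mkseq_onth /apps /mkseq -map_comp. Qed.

Lemma cat_inj (T : Type) (s1 s2 t1 t2 : seq T) :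
  s1 ++ s2 = t1 ++ t2 -> size s1 = size t1 -> s1 = t1 /\ s2 = t2.
Proof.
by elim: s1 t1 => [|x s1 IH] [|y t1] //= [-> /IH h] [/h[-> ->]].
Qed.

Lemma flatten_etm (T : Type) (fs : seq (T * seq entry)) :
  map (@etm G L) (flatten (map snd fs)) = flatten (map (fun p => map (@etm G L) p.2) fs).
Proof. by rewrite map_flatten -map_comp. Qed.

(** Each rule adds the nodes that it names; a generator rule turns the wires that
    these nodes consume into the wires that they produce. *)
Lemma derivable_good A l Zs : derivable A l Zs ->
  exists N, good A N (map (@etm G L) l) Zs (map (@ety G L) l).
Proof.
elim=> {l Zs} [fs hs s Hfs ufs Hhs ps _|fs hs r Zs s t _ [N g] _ Hfs Hhs ps _ _ pt _ _].
- pose Nf := map (fun p : sarr G * L => Cst p.1 p.2 0) fs.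
  pose Nh := map (fun h => Scal h [::] : term) hs.
  have iE : ins (Nf ++ Nh) = [::].
    rewrite ins_cat (_ : ins Nh = [::]) ?cats0; last by rewrite /Nh; elim: (hs).
    by rewrite /Nf; elim: (fs).
  have oE : outs (Nf ++ Nh) = flatten (map (fun p => csts p.1 p.2) fs).
    rewrite outs_cat (_ : outs Nh = [::]) ?cats0; last by rewrite /Nh; elim: (hs).
    by rewrite /produced -map_comp.
  have eE : map (@etm G L) (id_entries A fs) = vars L A ++ outs (Nf ++ Nh).
    rewrite map_cat etm_active ?size_vars // oE map_flatten -map_comp.
    congr (_ ++ flatten _); apply: eq_map => p /=.
    by rewrite etm_active // size_csts.
  have tE : map (@ety G L) (id_entries A fs) = A ++ flatten (map (fun p => scod p.1) fs).
    rewrite map_cat ety_active ?size_vars // map_flatten -map_comp.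
    congr (_ ++ flatten _); apply: eq_map => p /=.
    by rewrite ety_active // size_csts.
  exists (Nf ++ Nh); split.
  + rewrite /labs map_cat flatten_cat (_ : flatten (map _ Nh) = [::]) ?cats0; last first.
      by rewrite /Nh; elim: (hs).
    rewrite /Nf -map_comp (_ : flatten _ = map snd fs); last first.
      by elim: (fs) => //= p q ->.
    elim: (map _ _) ufs => //= a q IH H; inversion H; subst.
    by rewrite IH // andbT; apply/negP => /In_mem.
  + move=> n; rewrite mem_cat => /orP[].
      rewrite /Nf; elim: Hfs => //= p q [p0 p1] _ IH; rewrite inE.
      by case/predU1P => [->|/IH].
    rewrite /Nh; elim: Hhs => //= p q [p0 p1] _ IH; rewrite inE.
    by case/predU1P => [->|/IH] //=; rewrite p0.
  + rewrite !map_permute eE tE !map_cat tyo_vars; congr (permute s (_ ++ _)).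
    rewrite oE !map_flatten -!map_comp; congr flatten; apply: eq_map => p /=.
    exact: tyo_csts.
  + rewrite iE cat0s map_permute perm_sym -eE.
    by apply: permute_perm; rewrite size_map.
  + have -> : map (fun h => Scal h [::] : term) hs = filter (@is_scal G L) Nh.
      by rewrite /Nh; elim: (hs) => //= h q <-.
    rewrite filter_cat (_ : filter _ Nf = [::]) //.
    by rewrite /Nf; elim: (fs).
pose etms p := map (@etm G L) (p : sarr G * seq entry).2.
pose Nf := map (fun p => App p.1 (etms p) 0) fs.
pose Nh := map (fun p => Scal p.1 (etms p) : term) hs.
have [gl gn gt gp gs] := g.
have iF : ins Nf = map (@etm G L) (flatten (map snd fs)).
  by rewrite flatten_etm /consumed -map_comp.
have iH : ins Nh = map (@etm G L) (flatten (map snd hs)).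
  by rewrite flatten_etm /consumed -map_comp.
have oH : outs Nh = [::] by rewrite /Nh; elim: (hs).
have oF : outs Nf = map (@etm G L) (gen_entries fs).
  rewrite /produced /gen_entries map_flatten -!map_comp; congr flatten.
  by apply: eq_map => p /=; rewrite etm_active // size_apps.
have tF : map (tyo A) (outs Nf) = map Some (map (@ety G L) (gen_entries fs)).
  rewrite /produced /gen_entries !map_flatten -!map_comp; congr flatten.
  by apply: eq_map => p /=; rewrite tyo_apps ety_active // size_apps.
have dE : map (@etm G L) (map (@deactivate G L) r) = map (@etm G L) r.
  by rewrite -map_comp.
have dT : map (@ety G L) (map (@deactivate G L) r) = map (@ety G L) r.
  by rewrite -map_comp.
have ty3 : [/\ map (tyo A) (map (@etm G L) (flatten (map snd fs))) =
     map Some (map (@ety G L) (flatten (map snd fs))),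
   map (tyo A) (map (@etm G L) (flatten (map snd hs))) =
     map Some (map (@ety G L) (flatten (map snd hs)))
  & map (tyo A) (map (@etm G L) r) = map Some (map (@ety G L) r)].
  move: (gt); rewrite !map_cat => /cat_inj[|e1 /cat_inj[|e2 e3]]; last by split.
    by rewrite !size_map.
  by rewrite !size_map.
case: ty3 => tf th tr.
have tblock (qs : seq (sarr G * seq entry)) (Q : sarr G * seq entry -> Prop) :
    map (tyo A) (map (@etm G L) (flatten (map snd qs))) =
      map Some (map (@ety G L) (flatten (map snd qs))) ->
    List.Forall (fun p => map (@ety G L) p.2 = sdom p.1 /\ Q p) qs ->
    List.Forall (fun p => map (tyo A) (etms p) = map Some (sdom p.1) /\ Q p) qs.
  move=> + H; elim: H => //= p q [p0 Qp] _ IH.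
  rewrite !map_cat => /cat_inj[|E /IH h]; first by rewrite !size_map.
  by constructor => //; rewrite /etms E p0.
have {}Hfs : List.Forall (fun p => map (tyo A) (etms p) = map Some (sdom p.1) /\
    (sdom p.1 <> [::] /\ scod p.1 <> [::])) fs.
  apply: tblock tf _; elim: Hfs => // p q [p0 pa p1] _ IH; constructor => //.
  by split=> //; split=> //; rewrite -p0; case: (p.2) pa.
have {}Hhs : List.Forall (fun p => map (tyo A) (etms p) = map Some (sdom p.1) /\
    scod p.1 = [::]) hs.
  by apply: tblock th _; elim: Hhs => // p q [p0 pa p1] _ IH; constructor.
exists (Nf ++ Nh ++ N); split.
- rewrite /labs !map_cat !flatten_cat (_ : flatten (map _ Nf) = [::]); last first.
    by rewrite /Nf; elim: (fs).
  by rewrite (_ : flatten (map _ Nh) = [::]) //; rewrite /Nh; elim: (hs).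
- move=> n; rewrite !mem_cat => /or3P[| |/gn //].
    rewrite /Nf; elim: Hfs => //= p q [p0 [p1 p2]] _ IH; rewrite inE.
    by case/predU1P => [->|/IH].
  rewrite /Nh; elim: Hhs => //= p q [p0 p1] _ IH; rewrite inE.
  by case/predU1P => [->|/IH].
- by rewrite !map_permute !map_cat dE dT -oF tF tr.
- rewrite !outs_cat !ins_cat oH iF iH.
  have pp : perm_eq (map (@etm G L) (permute s (gen_entries fs ++ map (@deactivate G L) r)))
      (outs Nf ++ map (@etm G L) r).
    rewrite -dE oF -map_cat; apply/perm_map/permute_perm.
    by rewrite size_cat size_map.
  apply/permP => a; have := permP gp a; have := permP pp a.
  by rewrite !map_cat !count_cat /=; count_lia.
- rewrite !filter_cat (_ : filter _ Nf = [::]); last by rewrite /Nf; elim: (fs).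
  rewrite (_ : filter _ Nh = Nh); last by rewrite /Nh; elim: (hs) => //= p q ->.
  rewrite perm_sym; apply: (@perm_trans _ (Nh ++ Zs)).
    by apply: permute_perm; rewrite size_cat !size_map.
  by rewrite perm_cat2l perm_sym.
Qed.

End Derivable.

Section Layers.
Variables (G : signature) (L : eqType).
Local Notation term := (term G L).
Local Notation entry := (entry G L).
Implicit Types (A B C : seq (sob G)) (f h : sarr G) (t x n : term) (N Ms Zs : seq term)
  (e : entry) (l r : seq entry).
Local Notation ins := (consumed (@nin G L)).
Local Notation outs := (produced (@nout G L)).
Local Notation etm := (@etm G L).
Local Notation ety := (@ety G L).
Local Notation is_scal := (@is_scal G L).

(** The entry of the wire t in a judgment whose last rule is numbered k: active
    if and only if it was produced by this rule. *)
Definition ent A k t : option entry := omap (fun b => Entry t b (lev t == k)) (tyo A t).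

Lemma etm_ent A k Ms Bs : map (tyo A) Ms = map Some Bs ->
  map etm (pmap (ent A k) Ms) = Ms /\ map ety (pmap (ent A k) Ms) = Bs.
Proof.
elim: Ms Bs => [|M Ms IH] [|b Bs] //= [tM /IH [E1 E2]].
by rewrite /ent tM /= E1 E2.
Qed.

Lemma ent_active A k Ms Bs : map (tyo A) Ms = map Some Bs ->
  {in Ms, forall M, lev M = k} -> active_entries Ms Bs = pmap (ent A k) Ms.
Proof.
elim: Ms Bs => [|M Ms IH] [|b Bs] //= [tM /IH {}IH] lk.
rewrite /ent tM /= lk ?mem_head // eqxx /=; congr cons; apply: IH => M' M's.
by apply: lk; rewrite inE M's orbT.
Qed.

Lemma deactivate_ent A k k' Ms : {in Ms, forall M, lev M != k'} ->
  map (@deactivate G L) (pmap (ent A k) Ms) = pmap (ent A k') Ms.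
Proof.
elim: Ms => //= M Ms IH lk; have {}IH := IH _.
rewrite /ent; case: (tyo A M) => [b|] /=; last first.
  by apply: IH => M' M's; apply: lk; rewrite inE M's orbT.
rewrite IH; last by move=> M' M's; apply: lk; rewrite inE M's orbT.
by rewrite /deactivate /= (negbTE (lk M (mem_head _ _))).
Qed.

Lemma ent_entries A k l : map (tyo A) (map etm l) = map Some (map ety l) ->
  {in l, forall e, eactive e = (lev (etm e) == k)} -> pmap (ent A k) (map etm l) = l.
Proof.
elim: l => //= -[t b a] l IH [/= tb /IH {}IH] fl.
have := fl _ (mem_head _ _); rewrite /ent tb /= => <-.
by rewrite IH // => e el; apply: fl; rewrite inE el orbT.
Qed.

Lemma etm_pmap_ent A k e Ms : e \in pmap (ent A k) Ms -> etm e \in Ms.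
Proof.
rewrite mem_pmap => /mapP[t tM]; rewrite /ent.
by case: (tyo A t) => //= b [->].
Qed.

Lemma ent_etm A k l Ms e : pmap (ent A k) (map etm l) = l ->
  e \in l -> etm e \in Ms -> e \in pmap (ent A k) Ms.
Proof.
move=> <- el eM; rewrite mem_pmap; apply/mapP; exists (etm e) => //.
move: el; rewrite mem_pmap => /mapP[t tM]; rewrite /ent.
by case E: (tyo A t) => [b|] //= [->] /=; rewrite E.
Qed.

Lemma uniq_pmap_ent A k Ms : uniq Ms -> uniq (pmap (ent A k) Ms).
Proof.
elim: Ms => //= M Ms IH /andP[nM /IH u]; rewrite /ent.
case: (tyo A M) => [b|] //=; rewrite u andbT.
by apply: contra nM => /etm_pmap_ent.
Qed.

Lemma filter_ent A k l Ms : pmap (ent A k) (map etm l) = l ->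
  filter [in Ms] (map etm l) = Ms ->
  filter [in pmap (ent A k) Ms] l = pmap (ent A k) Ms.
Proof.
move=> El EM; have P : {in l, forall e, (e \in pmap (ent A k) Ms) = (etm e \in Ms)}.
  move=> e el; apply/idP/idP; first exact: etm_pmap_ent.
  exact: ent_etm El el.
have E1 : filter [in pmap (ent A k) Ms] l = filter (fun e => etm e \in Ms) l.
  exact: eq_in_filter.
have sub (p : pred entry) : pmap (ent A k) (map etm (filter p l)) = filter p l.
  have : {in l, forall e, ent A k (etm e) = Some e}.
    move=> e; rewrite -{1}El mem_pmap => /mapP[t tM]; rewrite /ent.
    by case E: (tyo A t) => [b|] //= [->] /=; rewrite E.
  elim: (l) => //= e r IH h; case: (p e) => /=.
    by rewrite h ?mem_head //= IH // => e' e'r; apply: h; rewrite inE e'r orbT.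
  by rewrite IH // => e' e'r; apply: h; rewrite inE e'r orbT.
by rewrite E1 -[in RHS]EM filter_map sub.
Qed.

(** This is why a node of the next layer has an active argument. *)
Lemma lev_witness (m : term) k : lev m = k.+1 -> exists2 x, x \in nin m & lev x = k.
Proof.
have H Ms : foldr (fun M => maxn (lev M).+1) 0 Ms = k.+1 ->
    exists2 x, x \in Ms & lev x = k.
  elim: Ms => //= M Ms IH; rewrite /maxn; case: ifP => _.
    by case/IH => x xM xk; exists x => //; rewrite inE xM orbT.
  by case=> Mk; exists M => //; rewrite mem_head.
by case: m => [i|f a i|f Ms i|f Ms] //=; exact: H.
Qed.

(** The nodes introduced by the last rule: they are listed in the order of their
    first outputs in the judgment, and the scalar ones in their order there, as
    the rules demand. *)
Section Top.
Variables (A B : seq (sob G)) (k : nat) (N Ms Zs : seq term).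
Hypotheses (g : good A N Ms Zs B) (hk : {in N, forall n : term, lev n <= k}).

Definition top := filter (fun t : term => [&& t \in N, ~~ is_scal t & lev t == k]) Ms.
Definition topz := filter (fun z : term => lev z == k) Zs.
Definition lower := filter (fun n : term => lev n != k) N.

(** A wire produced by a node of maximal level is not consumed. *)
Lemma top_node n : n \in N -> ~~ is_scal n -> lev n = k -> n \in Ms.
Proof.
move=> nN sn nk; have : n \in vars L A ++ outs N.
  by rewrite mem_cat (node_nout_outs (good_node g nN)) ?orbT.
rewrite (perm_mem (good_perm g)) mem_cat => /orP[/insP[m mN /lev_nin nm]|//].
by have := leq_trans nm (hk mN); rewrite nk ltnn.
Qed.

Lemma uniq_Ms : uniq Ms.
Proof. by have := good_uniq g; rewrite (perm_uniq (good_perm g)) cat_uniq => /and3P[]. Qed.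

Lemma perm_topk : perm_eq (filter (fun n : term => lev n == k) N) (top ++ topz).
Proof.
have U := nodes_uniq g.
rewrite -(perm_filterC is_scal (filter _ N)) perm_catC.
apply: perm_cat; last first.
  rewrite -filter_predI; have -> : filter (predI is_scal (fun n => lev n == k)) N =
     filter (fun n => lev n == k) (filter is_scal N).
    by rewrite -filter_predI; apply: eq_filter => n /=; rewrite andbC.
  by apply: perm_filter; exact: good_scal g.
apply: uniq_perm.
- have -> : filter (predC is_scal) (filter (fun n => lev n == k) N) =
     filter (fun n => lev n == k) (filter (predC is_scal) N).
    by rewrite -!filter_predI; apply: eq_filter => n /=; rewrite andbC.
  exact: filter_uniq.
- exact: filter_uniq uniq_Ms.
- move=> n; rewrite !mem_filter /=; apply/and3P/andP => [[sn /eqP nk nN]|[/and3P[]//]].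
  by rewrite sn nk eqxx nN; split => //; exact: top_node.
Qed.

Lemma perm_top : perm_eq N (top ++ topz ++ lower).
Proof.
rewrite -(perm_filterC (fun n => lev n == k) N) catA; apply: perm_cat => //.
exact: perm_topk.
Qed.

Lemma is_scal_Zs z : z \in Zs -> z \in N /\ is_scal z.
Proof. by rewrite -(perm_mem (good_scal g)) mem_filter => /andP[]. Qed.

Lemma outs_topz : outs topz = [::].
Proof.
rewrite /topz; have : {in Zs, forall z, is_scal z} by move=> z /is_scal_Zs[].
elim: (Zs) => //= z r IH h.
have {}IH := IH (sub_in1 (mem_behead (s := z :: r)) h).
by case: ifP => // _; rewrite /produced /= -/(outs _) IH; case: (z) (h _ (mem_head _ _)).
Qed.

Lemma filter_outs M : filter (fun t : term => lev t == k) (outs M) =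
  outs (filter (fun t : term => lev t == k) M).
Proof.
elim: M => //= n M IH; rewrite /produced /= filter_cat -/(outs M) IH.
case: ifP => nk.
  by congr (_ ++ _); apply/all_filterP/allP => x /lev_nout ->; rewrite nk.
rewrite (_ : filter _ (nout n) = [::]) //; apply/eqP; rewrite -[_ == _]negbK -has_filter.
by apply/hasPn => x /lev_nout ->; rewrite nk.
Qed.

Lemma top_outs : 0 < k -> perm_eq Ms (outs top ++ filter (fun t : term => lev t != k) Ms).
Proof.
move=> k0; rewrite -{1}(perm_filterC (fun t => lev t == k) Ms); apply: perm_cat => //.
have := perm_filter (fun t : term => lev t == k) (good_perm g).
rewrite !filter_cat filter_outs.
rewrite (_ : filter _ (vars L A) = [::]); last first.
  apply/eqP; rewrite -[_ == _]negbK -has_filter; apply/hasPn => x /mem_vars[i _ ->] /=.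
  by rewrite eq_sym -lt0n.
rewrite (_ : filter _ (ins N) = [::]); last first.
  apply/eqP; rewrite -[_ == _]negbK -has_filter; apply/hasPn => x /insP[m mN /lev_nin xm].
  by rewrite neq_ltn (leq_trans xm) // hk.
rewrite /= perm_sym => p; rewrite (permPl p).
rewrite (permPl (perm_flatten (perm_map _ perm_topk))) map_cat flatten_cat.
by rewrite -/(outs topz) outs_topz cats0.
Qed.

End Top.

(** Turns a property of the nodes in a list into a list of data for a rule. *)
Lemma Forall_factor (T U : Type) (gg : U -> T) (Q : U -> Prop) (s : seq T) :
  (forall y, List.In y s -> exists2 p, y = gg p & Q p) ->
  exists2 ps, s = map gg ps & List.Forall Q ps.
Proof.
elim: s => [|y s IH] hs; first by exists [::].
have [p -> Qp] := hs y (or_introl erefl).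
have [ps -> Qps] := IH (fun z zs => hs z (or_intror zs)).
by exists (p :: ps) => //; constructor.
Qed.

Lemma filter_mem_filter (T : eqType) (p : pred T) (s : seq T) :
  filter [in filter p s] s = filter p s.
Proof. by apply: eq_in_filter => y xs; rewrite mem_filter xs andbT. Qed.

Lemma flatten_pmap (T U V : Type) (gg : T -> option U) (hh : V -> seq T) (s : seq V) :
  flatten (map (fun v => pmap gg (hh v)) s) = pmap gg (flatten (map hh s)).
Proof. by elim: s => //= v s ->; rewrite pmap_cat. Qed.

Lemma uniq_NoDup (T : eqType) (s : seq T) : uniq s -> List.NoDup s.
Proof.
elim: s => [|y s IH] /=; first by constructor.
by move=> /andP[xs /IH]; constructor => // /In_mem; exact/negP.
Qed.

Lemma tyo_nout A n : is_node A n -> exists Bs, map (tyo A) (nout n) = map Some Bs.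
Proof.
case: n => //= [f a _|f Ms _|f Ms] _; last by exists [::].
- by exists (scod f); exact: tyo_csts.
- by exists (scod f); exact: tyo_apps.
Qed.

Lemma good_typed A N Ms Zs B x : good A N Ms Zs B ->
  x \in vars L A ++ outs N -> tyo A x <> None.
Proof.
have H Bs (Ks : seq term) : map (tyo A) Ks = map Some Bs -> x \in Ks -> tyo A x <> None.
  elim: Ks Bs => // K Ks IH [|b Bs] // [tK /IH {}IH].
  by rewrite inE => /predU1P[->|//]; rewrite tK.
move=> g; rewrite mem_cat => /orP[|/outsP[n /(good_node g)/tyo_nout[Bs]]].
  exact: H (tyo_vars L A).
exact: H.
Qed.

Lemma node_first A n : is_node A n -> ~~ is_scal n ->
  exists b, exists2 r, nout n = n :: r & tyo A n = Some b.
Proof.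
case: n => //= [f a i|f Ms i].
  case=> -> _ + _; rewrite /csts /mkseq; case: (scod f) => //= b bs _.
  by exists b, (map (Cst f a) (iota 1 (size bs))).
case=> -> _ + _ _; rewrite /apps /mkseq; case: (scod f) => //= b bs _.
by exists b, (map (App f Ms) (iota 1 (size bs))).
Qed.

Lemma heads_ent A k M : {in M, forall n, is_node A n /\ ~~ is_scal n} ->
  pmap ohead (map (fun n => pmap (ent A k) (nout n)) M) = pmap (ent A k) M.
Proof.
elim: M => //= n M IH h; rewrite IH; last first.
  by move=> m mM; apply: h; rewrite inE mM orbT.
have [gn sn] := h _ (mem_head _ _).
by have [b [r -> tn]] := node_first gn sn; rewrite /ent /= tn.
Qed.

Lemma nout_ent_neq0 A k n : is_node A n -> ~~ is_scal n ->
  pmap (ent A k) (nout n) <> [::].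
Proof.
move=> gn sn; have [b [r -> tn]] := node_first gn sn.
by rewrite /ent /= tn.
Qed.

Lemma arrange_layer A k l F V R :
  pmap (ent A k) (map etm l) = l -> uniq (map etm l) ->
  perm_eq (map etm l) (V ++ outs F ++ R) ->
  {in F, forall n, is_node A n /\ ~~ is_scal n} ->
  filter [in F] (map etm l) = F -> filter [in R] (map etm l) = R ->
  let v := pmap (ent A k) V in
  let bs := map (fun n => pmap (ent A k) (nout n)) F in
  let l0 := v ++ flatten bs ++ pmap (ent A k) R in
  exists s, [/\ is_permutation (size l0) s, permute s l0 = l,
    keeps_order (mem (block_starts (size v) (map size bs))) s
    & keeps_order (fun i => size v + size (flatten bs) <= i) s].
Proof.
move=> El ul pl hF fF fR v bs l0.
have El0 : l0 = pmap (ent A k) (V ++ outs F ++ R).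
  by rewrite /l0 /bs flatten_pmap !pmap_cat.
have ul' : uniq l by rewrite -El; exact: uniq_pmap_ent.
have hE : pmap ohead bs = pmap (ent A k) F by exact: heads_ent.
have pE : perm_eq l l0 by rewrite El0 -{1}El; exact: perm_pmap.
apply: arrange_blocks => //.
- by rewrite -/l0 -(perm_uniq pE).
- by move=> b /mapP[n /hF[gn sn] ->]; exact: nout_ent_neq0.
- by rewrite hE; exact: filter_ent.
- exact: filter_ent.
Qed.

Lemma perm_labs N N' : perm_eq N N' -> perm_eq (labs N) (labs N').
Proof. by move=> p; exact/perm_flatten/perm_map. Qed.

(** Induction on the maximal level k of the nodes.  The nodes of level k are
    introduced by the last rule.  The premise is the judgment made of the other
    nodes, with the arguments of the nodes of level k among its outputs; it is
    good by counting wires.  For k = 0 there are only constants and scalars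
    without arguments, introduced by the identity rule. *)
Lemma good_derivable k A N l Zs :
  good A N (map etm l) Zs (map ety l) ->
  {in l, forall e, eactive e = (lev (etm e) == k)} ->
  {in N, forall n : term, lev n <= k} ->
  k = 0 \/ (exists2 n, n \in N & lev n = k) ->
  derivable A l Zs.
Proof.
elim: k N l Zs => [|k IH] N l Zs g fl hk hn.
- pose F := top 0 N (map etm l).
  have El := ent_entries (good_ty g) fl.
  have pN := perm_top g hk; rewrite -/F in pN.
  have lev0 (f : sarr G) (K : term) Ks : lev (Scal f (K :: Ks)) <> 0.
    by rewrite /= /maxn; case: ifP => //; case: foldr.
  have Zs0 : topz 0 Zs = Zs.
    apply/all_filterP/allP => z /(is_scal_Zs g)[/hk + _].
    by rewrite leqn0.
  have low0 : lower 0 N = [::].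
    apply/eqP; rewrite -[_ == _]negbK -has_filter; apply/hasPn => n /hk.
    by rewrite leqn0 => ->.
  rewrite Zs0 low0 cats0 in pN.
  have FN : {in F, forall n, [/\ n \in N, ~~ is_scal n & lev n = 0]}.
    by move=> n; rewrite mem_filter => /andP[/and3P[? ? /eqP]].
  have [fs EF Hfs] : exists2 fs, F = map (fun p : sarr G * L => Cst p.1 p.2 0) fs &
      List.Forall (fun p => sdom p.1 = [::] /\ scod p.1 <> [::]) fs.
    apply: Forall_factor => x /In_mem /FN[/(good_node g)].
    case: x => // [f a i|f [|K Ks] i]; first by case=> -> ? ? _ _; exists (f, a).
      by case=> _ d0 _ /=; case: sdom d0.
    by move=> _ _ /lev0.
  have [hs EZ Hhs] : exists2 hs, Zs = map (fun h => Scal h [::]) hs &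
      List.Forall (fun h => sdom h = [::] /\ scod h = [::]) hs.
    apply: Forall_factor => x /In_mem /(is_scal_Zs g)[xN].
    have := good_node g xN; have := hk x xN; rewrite leqn0 => /eqP.
    case: x {xN} => // f [|K Ks] /= ; last by move/lev0.
    by move=> _ [f0]; case E: sdom => // _ _; exists f.
  have iN : ins N = [::].
    apply/eqP; rewrite -size_eq0 -leqn0 leqNgt -has_predT.
    apply/hasPn => x /insP[m mN /lev_nin xm].
    by have := leq_trans xm (hk m mN).
  have pl : perm_eq (map etm l) (vars L A ++ outs F ++ [::]).
    rewrite cats0; have := good_perm g; rewrite iN perm_sym => p; rewrite (permPl p).
    rewrite perm_cat2l (permPl (perm_flatten (perm_map _ pN))) map_cat flatten_cat.
    by rewrite -/(outs Zs) -Zs0 (outs_topz 0 g) cats0.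
  have [] := arrange_layer El (uniq_Ms g) pl.
  + by move=> n /FN[/(good_node g)].
  + exact: filter_mem_filter.
  + by elim: (map etm l).
  move=> s; rewrite /= cats0.
  have -> : pmap (ent A 0) (vars L A) ++
      flatten (map (fun n => pmap (ent A 0) (nout n)) F) = id_entries A fs.
    congr (_ ++ _).
      by rewrite -(ent_active (k := 0) (tyo_vars L A)) // => M /mem_vars[i _ ->].
    rewrite EF -map_comp; congr flatten; apply: eq_map => p /=.
    by rewrite -(ent_active (k := 0) (tyo_csts A _ _)) // => M /mem_csts[i _ ->].
  have -> : size (pmap (ent A 0) (vars L A)) = size A.
    by have [E _] := etm_ent 0 (tyo_vars L A); rewrite -(size_map etm) E size_vars.
  have -> : map size (map (fun n => pmap (ent A 0) (nout n)) F) =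
      [seq size (scod p.1) | p <- fs].
    rewrite EF -!map_comp; apply: eq_map => p /=.
    have [E _] := etm_ent 0 (tyo_csts A p.1 p.2).
    by rewrite -(size_map etm) E size_csts.
  case=> ps Es ks _; rewrite EZ -Es; apply: der_id => //.
  apply: uniq_NoDup; have := good_labs g; rewrite (perm_uniq (perm_labs pN)).
  rewrite /labs map_cat flatten_cat cat_uniq => /and3P[+ _ _].
  rewrite EF -map_comp (_ : flatten _ = map snd fs) //.
  by elim: (fs) => //= p q ->.
pose F := top k.+1 N (map etm l); pose Zn := topz k.+1 Zs; pose N1 := lower k.+1 N.
have El := ent_entries (good_ty g) fl.
have pN : perm_eq N (F ++ Zn ++ N1) := perm_top g hk.
have FN : {in F, forall n, [/\ n \in N, ~~ is_scal n & lev n = k.+1]}.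
  by move=> n; rewrite mem_filter => /andP[/and3P[? ? /eqP]].
have ZN : {in Zn, forall n, [/\ n \in N, is_scal n & lev n = k.+1]}.
  by move=> n; rewrite mem_filter => /andP[/eqP nk /(is_scal_Zs g)[]].
(* A node of level k + 1 has an argument of level k, active in the premise. *)
have active_arg n Bs : lev n = k.+1 -> map (tyo A) (nin n) = map Some Bs ->
    has (@eactive G L) (pmap (ent A k) (nin n)).
  move=> /lev_witness[x xn xk] /etm_ent - /(_ k)[E1 _].
  move: xn; rewrite -{1}E1 => /mapP[e eK ee]; apply/hasP; exists e => //.
  move: eK; rewrite mem_pmap => /mapP[t _]; rewrite /ent.
  by case: (tyo A t) => //= b [E]; move: ee; rewrite E /= => <-; rewrite xk eqxx.
have [fs EF Hfs] : exists2 fs, F = map (fun p : sarr G * seq term => App p.1 p.2 0) fs &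
    List.Forall (fun p => [/\ map (tyo A) p.2 = map Some (sdom p.1),
      has (@eactive G L) (pmap (ent A k) p.2) & scod p.1 <> [::]]) fs.
  apply: Forall_factor => x /In_mem /FN[/(good_node g)].
  case: x => // f Ks i [-> _ f0 tK] _ lk; exists (f, Ks) => //; split => //.
  exact: (active_arg _ _ lk tK).
have [hs EZ Hhs] : exists2 hs, Zn = map (fun p : sarr G * seq term => Scal p.1 p.2) hs &
    List.Forall (fun p => [/\ map (tyo A) p.2 = map Some (sdom p.1),
      has (@eactive G L) (pmap (ent A k) p.2) & scod p.1 = [::]]) hs.
  apply: Forall_factor => x /In_mem /ZN[/(good_node g)].
  case: x => // f Ks [f0 tK] _ lk; exists (f, Ks) => //; split => //.
  exact: (active_arg _ _ lk tK).
pose Rt := filter (fun t : term => lev t != k.+1) (map etm l).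
pose fe := map (fun p : sarr G * seq term => (p.1, pmap (ent A k) p.2)).
have fe_etm (Q : sarr G * seq term -> Prop) ps :
    List.Forall (fun p => [/\ map (tyo A) p.2 = map Some (sdom p.1),
      has (@eactive G L) (pmap (ent A k) p.2) & Q p]) ps ->
    map (fun p => (p.1, map etm p.2)) (fe ps) = ps.
  elim=> //= -[f Ks] r [/= tK _ _] _ ->.
  by have [-> _] := etm_ent k tK.
have fe_flat ps : flatten (map snd (fe ps)) = pmap (ent A k) (flatten (map snd ps)).
  by rewrite /fe -map_comp flatten_pmap.
have fe_Forall (Q : sarr G -> Prop) ps :
    List.Forall (fun p => [/\ map (tyo A) p.2 = map Some (sdom p.1),
      has (@eactive G L) (pmap (ent A k) p.2) & Q p.1]) ps ->
    List.Forall (fun p => [/\ map ety p.2 = sdom p.1, has (@eactive G L) p.2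
      & Q p.1]) (fe ps).
  elim=> //= -[f Ks] r [/= tK aK Qf] _ IHr; constructor => //=.
  by have [_ ->] := etm_ent k tK.
have iF : flatten (map snd fs) = ins F by rewrite EF /consumed -map_comp.
have iZ : flatten (map snd hs) = ins Zn by rewrite EZ /consumed -map_comp.
(* The outputs of the premise: those of the nodes of level k + 1 are replaced by
   the arguments of these nodes. *)
pose T1 := ins F ++ ins Zn ++ Rt.
pose Z1 := filter (predC (fun z : term => lev z == k.+1)) Zs.
have pMs : perm_eq (map etm l) (outs F ++ Rt) := top_outs g hk isT.
have oZ : outs Zn = [::] := outs_topz k.+1 g.
have insT1 : {subset T1 <= ins N ++ map etm l}.
  move=> x; rewrite !mem_cat => /or3P[/insP[m /FN[mN _ _] xm]|/insP[m /ZN[mN _ _] xm]|].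
  - by apply/orP; left; apply/insP; exists m.
  - by apply/orP; left; apply/insP; exists m.
  - by rewrite mem_filter => /andP[_ ->]; rewrite orbT.
have [B1 tB1] : exists B1, map (tyo A) T1 = map Some B1.
  have : {in T1, forall x, tyo A x <> None}.
    move=> x /insT1; rewrite -(perm_mem (good_perm g)); exact: (good_typed g).
  elim: (T1) => [|x r IHr] h /=; first by exists [::].
  case: IHr => [y yr|B1 ->]; first by apply: h; rewrite inE yr orbT.
  by case: (tyo A x) (h x (mem_head _ _)) => // b _; exists (b :: B1).
have [E1 E2] := etm_ent k tB1.
have g1 : good A N1 (map etm (pmap (ent A k) T1)) Z1 (map ety (pmap (ent A k) T1)).
  rewrite E1 E2; split => //.
  - have := good_labs g; rewrite (perm_uniq (perm_labs pN)).
    by rewrite /labs !map_cat !flatten_cat !cat_uniq => /and3P[_ _ /and3P[]].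
  - by move=> n; rewrite mem_filter => /andP[_ /(good_node g)].
  - have po := perm_flatten (perm_map (@nout G L) pN).
    have pi := perm_flatten (perm_map (@nin G L) pN).
    rewrite !map_cat !flatten_cat -!/(outs _) oZ in po.
    rewrite !map_cat !flatten_cat -!/(ins _) in pi.
    apply/permP => a; have := permP po a; have := permP pi a.
    have := permP pMs a; have := permP (good_perm g) a.
    by rewrite /T1 !count_cat /=; count_lia.
  - rewrite /N1 /lower /Z1 -filter_predI.
    have -> : filter (predI is_scal (fun n : term => lev n != k.+1)) N =
      filter (predC (fun z : term => lev z == k.+1)) (filter is_scal N).
      by rewrite -filter_predI; apply: eq_filter => n /=; rewrite andbC.
    by apply: perm_filter; exact: good_scal g.
have d1 : derivable A (pmap (ent A k) T1) Z1.
  apply: (IH N1) g1 _ _ _.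
  - move=> e; rewrite mem_pmap => /mapP[t _]; rewrite /ent.
    by case: (tyo A t) => //= b [->].
  - move=> n; rewrite mem_filter => /andP[nk nN].
    by rewrite -ltnS ltn_neqAle nk hk.
  - case: hn => // -[n nN /lev_witness[x xn xk]].
    case: (posnP k) => [k0|k0]; [by left|right].
    have : x \in vars L A ++ outs N.
      by rewrite (perm_mem (good_perm g)) mem_cat; apply/orP; left; apply/insP; exists n.
    rewrite mem_cat => /orP[/mem_vars[i _ E]|/outsP[m mN /lev_nout xm]].
      by move: k0; rewrite -xk E.
    (* The argument of level k > 0 is the output of a node of level k. *)
    exists m; last by rewrite -xm.
    by rewrite mem_filter mN -xm xk neq_ltn ltnSn.
have [t [pt Et kt1 kt2]] := arrange_shuffle (fun z : term => lev z == k.+1) Zs.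
rewrite -/Z1 -/(topz k.+1 Zs) -/Zn in pt Et kt1 kt2.
have [] := @arrange_layer A k.+1 l F [::] Rt El (uniq_Ms g) pMs.
- by move=> n /FN[/(good_node g)].
- exact: filter_mem_filter.
- exact: filter_mem_filter.
move=> s /=.
have gE : gen_entries (fe fs) = flatten (map (fun n => pmap (ent A k.+1) (nout n)) F).
  have lfs : List.Forall (fun p => lev (App p.1 p.2 0) = k.+1) fs.
    have := FN; rewrite EF; elim: (fs) => // p r IHr h; constructor.
      by case: (h _ (mem_head _ _)).
    by apply: IHr => n nr; apply: h; rewrite inE nr orbT.
  rewrite EF; elim: Hfs lfs => // -[f Ks] r [/= tK _ _] _ IHr lfs.
  have lK := List.Forall_inv lfs; have lr := List.Forall_inv_tail lfs.
  rewrite /gen_entries /= -/(fe r) -/(gen_entries (fe r)) IHr //; congr (_ ++ _).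
  have [-> _] := etm_ent k tK; apply: ent_active (tyo_apps A f Ks) _.
  by move=> M /mem_apps[i _ ->].
have dE : map (@deactivate G L) (pmap (ent A k) Rt) = pmap (ent A k.+1) Rt.
  by apply: deactivate_ent => M; rewrite mem_filter => /andP[].
have bE : map size (map (fun n => pmap (ent A k.+1) (nout n)) F) =
      [seq size (scod p.1) | p <- fe fs].
  rewrite EF -!map_comp; apply: eq_map => p /=.
  have [E _] := etm_ent k.+1 (tyo_apps A p.1 p.2).
  by rewrite -(size_map etm) E size_apps.
have hE : gen_scalars (fe hs) = Zn.
  by rewrite EZ -{2}(fe_etm _ _ Hhs) /gen_scalars -!map_comp.
rewrite bE -gE -dE add0n => -[ps Es ks1 ks2].
rewrite -Es -Et -hE; apply: der_gen => //.
- by rewrite !fe_flat iF iZ -!pmap_cat.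
- rewrite /fe !size_map; have pos n : n \in F ++ Zn -> 0 < size fs + size hs.
    move=> nFZ; have : 0 < size (F ++ Zn) by case: (F ++ Zn) nFZ.
    by rewrite EF EZ size_cat !size_map.
  case: hn => // -[n nN nk]; apply: (pos n); move: nN.
  rewrite (perm_mem pN) catA mem_cat => /orP[//|].
  by rewrite mem_filter nk eqxx.
- exact: fe_Forall (fun f => scod f <> [::]) _ Hfs.
- exact: fe_Forall (fun f => scod f = [::]) _ Hhs.
- by move: ps; rewrite size_cat size_map.
- by move: pt; rewrite -hE /gen_scalars size_map.
- by move: kt1; rewrite -hE /gen_scalars size_map.
- by move: kt2; rewrite -hE /gen_scalars size_map.
Qed.

End Layers.

(** * Relabelling and the equality rule *)

Section Judgments.
Variables (G : signature) (L : eqType).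
Local Notation term := (term G L).
Local Notation judgment := (judgment G L).
Implicit Types (A B C : seq (sob G)) (f h : sarr G) (t x n : term) (N Ms Zs : seq term).
Implicit Types (J K M : judgment) (r q : L -> L).
Local Notation is_scal := (@is_scal G L).

Lemma PermutationP (T : eqType) (s1 s2 : seq T) :
  Permutation.Permutation s1 s2 <-> perm_eq s1 s2.
Proof.
split.
  elim=> //= {s1 s2} [y s1 s2 _|y z s1|s1 s2 s3 _ p _]; first by rewrite perm_cons.
    exact: (permEl (perm_catCA [:: z] [:: y] s1)).
  exact: perm_trans.
elim: s1 s2 => [|y s1 IH] s2.
  by rewrite perm_sym => /perm_nilP ->; constructor.
move=> /perm_split[t1 [t2 [-> _ /IH p]]].
exact: Permutation.Permutation_cons_app.
Qed.

(** The number of the last rule, read off from the nodes. *)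
Lemma top_level N : exists k, {in N, forall n : term, lev n <= k} /\
  (k = 0 \/ exists2 n, n \in N & lev n = k).
Proof.
elim: N => [|n N [k [h1 h2]]]; first by exists 0; split=> //; left.
exists (maxn (lev n) k); split=> [m|].
  by rewrite inE leq_max => /predU1P[->|/h1 ->]; rewrite ?leqnn ?orbT.
case: (leqP k (lev n)) => kn; last first.
  by case: h2 => [->|[m mN mk]]; [left|right; exists m; rewrite // inE mN orbT].
by right; exists n; rewrite ?mem_head.
Qed.

Lemma derivesP A J B : derives A J B <-> exists N, good A N (jtms J) (jscals J) B.
Proof.
split=> [[l [/derivable_good[N g] <- <-]]|[N g]]; first by exists N.
have [k [h1 h2]] := top_level N; have [E1 E2] := etm_ent k (good_ty g).
exists (pmap (ent A k) (jtms J)); split=> //.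
apply: (@good_derivable _ _ k A N) => //; first by rewrite E1 E2.
move=> e; rewrite mem_pmap => /mapP[t _]; rewrite /ent.
by case: (tyo A t) => //= b [->].
Qed.

Lemma derives_is_term A J B t : derives A J B -> t \in jtms J ++ jscals J ->
  is_term (size A) t.
Proof.
case=> l [/derivable_is_term[/List.Forall_forall h1 /List.Forall_forall h2] E _].
rewrite mem_cat -E => /orP[/In_mem/h1|/In_mem/h2] //.
Qed.

Lemma derives_size A J B : derives A J B -> size (jtms J) = size B.
Proof. by case=> l [_ <- <-]; rewrite !size_map. Qed.

Lemma relabel_tyo A r t : tyo A (relabel r t) = tyo A t.
Proof. by case: t. Qed.

Lemma relabel_typed A r Ms : map (tyo A) (map (relabel r) Ms) = map (tyo A) Ms.
Proof. by rewrite -map_comp; apply: eq_map => t /=; rewrite relabel_tyo. Qed.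

Lemma relabel_node A r n : is_node A n -> is_node A (relabel r n).
Proof. by case: n => //= [f Ks k|f Ks]; rewrite relabel_typed. Qed.

Lemma relabel_renames r N :
  renames (@nin G L) (@nout G L) (@nin G L) (@nout G L) (relabel r) (relabel r) N.
Proof. by move=> [i|f a k|f Ks k|f Ks] _ //=; rewrite -map_comp. Qed.

Lemma relabel_labels r t : labels (relabel r t) = map r (labels t).
Proof.
elim/term_induction: t => //= [f Ms k|f Ms] IH;
  rewrite map_flatten -!map_comp; congr flatten; exact/eq_in_map.
Qed.

Lemma relabel_eq r q t : {in labels t, r =1 q} -> relabel r t = relabel q t.
Proof.
elim/term_induction: t => //= [f a k|f Ms k|f Ms].
- by move=> ->; rewrite ?mem_head.
- move=> IH h; congr (App _ _ _); apply/eq_in_map => M MM; apply: IH => // a aM.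
  by apply: h; apply/flatten_mapP; exists M.
- move=> IH h; congr (Scal _ _); apply/eq_in_map => M MM; apply: IH => // a aM.
  by apply: h; apply/flatten_mapP; exists M.
Qed.

Lemma good_relabel A N Ms Zs B r : injective r -> good A N Ms Zs B ->
  good A (map (relabel r) N) (map (relabel r) Ms) (map (relabel r) Zs) B.
Proof.
move=> ir g; split.
- have -> : labs (map (relabel r) N) = map r (labs N).
    rewrite /labs map_flatten -!map_comp; congr flatten; apply: eq_map.
    by case.
  by rewrite map_inj_uniq // (good_labs g).
- by move=> n /mapP[m /(good_node g) gm ->]; exact: relabel_node.
- by rewrite relabel_typed (good_ty g).
- rewrite (outs_map (@relabel_renames r N)) (ins_map (@relabel_renames r N)).
  have -> : vars L A = map (relabel r) (vars L A) by rewrite -map_comp.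
  by rewrite -!map_cat; apply: perm_map; exact: good_perm g.
- have -> : filter is_scal (map (relabel r) N) = map (relabel r) (filter is_scal N).
    by rewrite filter_map; congr map; apply: eq_filter; case.
  exact: perm_map (good_scal g).
Qed.

Definition relabelJ r J : judgment :=
  Judgment (map (relabel r) (jtms J)) (map (relabel r) (jscals J)).

Lemma relabelJ_derives A J B r : injective r -> derives A J B ->
  derives A (relabelJ r J) B.
Proof.
move=> ir /derivesP[N g]; apply/derivesP; exists (map (relabel r) N).
exact: good_relabel.
Qed.

Lemma relabelJ_labels r J : jlabels (relabelJ r J) = map r (jlabels J).
Proof.
rewrite /jlabels /= -map_cat map_flatten -!map_comp; congr flatten.
by apply: eq_map => t /=; rewrite relabel_labels.
Qed.

(** The equality rule without relabelling. *)
Definition jsim J K := jtms J = jtms K /\ perm_eq (jscals J) (jscals K).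

Lemma jsim_derives A J K B : jsim J K -> derives A J B -> derives A K B.
Proof.
case=> E p /derivesP[N g]; apply/derivesP; exists N; rewrite -E.
by case: g => *; split=> //; apply: perm_trans p.
Qed.

Lemma jeqP J K : jeq J K <-> exists2 r, bijective r & jsim (relabelJ r J) K.
Proof.
split=> [[r [br E /PermutationP p]]|[r br [E /PermutationP p]]]; exists r => //.
Qed.

Lemma jsim_jeq J K : jsim J K -> jeq J K.
Proof.
case=> E p; apply/jeqP; exists id; first by exists id.
by split; rewrite /= (eq_map (@relabel_id G L)) map_id.
Qed.

Lemma jsim_labels J K : jsim J K -> jlabels J =i jlabels K.
Proof.
case=> E p a; apply/perm_mem/perm_flatten/perm_map.
by rewrite E perm_cat2l.
Qed.

Definition dis J K := {in jlabels J, forall a, a \notin jlabels K}.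

Lemma disP J K : disjoint_labels J K <-> dis J K.
Proof.
split=> h a; first by move=> /In_mem /h aK; apply/negP => /In_mem.
by move=> /In_mem /h /negP aK /In_mem.
Qed.

Definition transp (a b c : L) := if c == a then b else if c == b then a else c.

Lemma transpK a b : involutive (transp a b).
Proof.
move=> c; rewrite /transp; case: (eqVneq c a) => [->|ca].
  by case: (eqVneq b a) => // ba; rewrite eqxx.
case: (eqVneq c b) => [->|cb]; first by rewrite eqxx.
by rewrite (negbTE ca) (negbTE cb).
Qed.

(** A partial injection between finite sets of labels extends to a bijection,
    by composing transpositions. *)
Lemma extend_bij (s s' : seq L) : uniq s -> uniq s' -> size s = size s' ->
  exists2 r, bijective r & map r s = s'.
Proof.
elim: s s' => [|a s IH] [|b s'] //=; first by exists id => //; exists id.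
move=> /andP[as_ us] /andP[bs us'] [/(IH _ us us')[r br E]].
exists (transp (r a) b \o r).
  by apply: bij_comp br; exists (transp (r a) b); exact: transpK.
rewrite /= {1}/transp eqxx; congr cons; rewrite map_comp E.
rewrite -[RHS]map_id; apply/eq_in_map => c cs; rewrite /transp.
case: eqP => [ca|_]; last by case: eqP => // cb; rewrite -cb cs in bs.
by move: as_; rewrite -(mem_map (bij_inj br)) E -ca cs.
Qed.

(** Relabellings of two judgments without common labels are given by a single
    bijection of labels.  Hence operations on judgments respect the equality
    rule as soon as they commute with relabelling. *)
Lemma glue_labels J K J' K' : dis J K -> dis J' K' -> jeq J J' -> jeq K K' ->
  exists q, [/\ bijective q, jsim (relabelJ q J) J' & jsim (relabelJ q K) K'].
Proof.
move=> d d' /jeqP[r br s] /jeqP[r' br' s'].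
(* Disjointness of the images makes m injective on the labels of J and K. *)
pose m a := if a \in jlabels J then r a else r' a.
pose l := undup (jlabels J ++ jlabels K).
have lJ a : a \in jlabels J -> r a \in jlabels J'.
  by move=> aJ; rewrite -(jsim_labels s) relabelJ_labels map_f.
have lK a : a \in jlabels K -> r' a \in jlabels K'.
  by move=> aK; rewrite -(jsim_labels s') relabelJ_labels map_f.
have um : uniq (map m l).
  rewrite map_inj_in_uniq ?undup_uniq // => a b; rewrite !mem_undup !mem_cat /m.
  case: (boolP (a \in jlabels J)) => aJ; case: (boolP (b \in jlabels J)) => bJ //=.
  - by move=> _ _; exact: bij_inj br _ _.
  - by move=> _ /lK bK E; have := d' _ (lJ _ aJ); rewrite E bK.
  - by move=> /lK aK _ E; have := d' _ (lJ _ bJ); rewrite -E aK.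
  - by move=> _ _; exact: bij_inj br' _ _.
have [q bq E] := extend_bij (undup_uniq _) um (esym (size_map _ _)).
have {}E : {in l, q =1 m}.
  by apply/eq_in_map.
have relE (M : judgment) p : {in jlabels M, q =1 p} -> relabelJ q M = relabelJ p M.
  move=> h; congr Judgment; apply/eq_in_map => t tM; apply: relabel_eq => a at_;
    by apply: h; apply/flatten_mapP; exists t; rewrite // mem_cat tM ?orbT.
exists q; split=> //.
- rewrite (relE _ r) // => a aJ; rewrite E /m ?aJ //.
  by rewrite mem_undup mem_cat aJ.
- rewrite (relE _ r') // => a aK; rewrite E /m; last by rewrite mem_undup mem_cat aK orbT.
  by case: ifP => // /d; rewrite aK.
Qed.

Lemma fresh_list (infL : infinite_set [set: L]) (t : seq L) k :
  exists s : seq L, [/\ uniq s, size s = k & {in s, forall a, a \notin t}].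
Proof.
elim: k => [|k [s [us ss st]]]; first by exists [::].
have [a ha] : exists a, a \notin s ++ t.
  apply: contrapT => H; apply: infL.
  apply: (@sub_finite_set _ _ [set` (s ++ t)]); last exact: finite_seq.
  by move=> a _ /=; apply: contrapT => /negP na; apply: H; exists a.
move: ha; rewrite mem_cat negb_or => /andP[as_ at_].
exists (a :: s); split; rewrite /= ?as_ ?ss // => b; rewrite inE => /predU1P[->//|].
exact: st.
Qed.

End Judgments.

(** * Classes of judgments *)

Section FreeProp.
Variables (G : signature) (L : eqType).
Hypothesis infL : infinite_set [set: L].
Local Notation term := (term G L).
Local Notation judgment := (judgment G L).
Local Notation fmor := (@fmor G L).
Implicit Types (A B C D : seq (sob G)) (f h : sarr G) (t n : term) (N Ms Zs : seq term).
Implicit Types (J K M : judgment) (r q : L -> L).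
Local Notation Var := (@Var G L).

Definition mk A B J (d : derives A J B) : fmor A B :=
  FMor (ex_intro _ J (conj d erefl)).

Lemma rep_derives A B (x : fmor A B) J : x J -> derives A J B.
Proof. by case: x => R [J0 [d E]] /=; rewrite E => -[]. Qed.

Lemma rep_jeq A B (x : fmor A B) J K : x J -> x K -> jeq J K.
Proof.
case: x => R [J0 [d E]] /=; rewrite E => -[_ e] [_ e'].
exact: jeq_trans (jeq_sym e) e'.
Qed.

Lemma rep_closed A B (x : fmor A B) J K : x J -> jeq J K -> derives A K B -> x K.
Proof.
case: x => R [J0 [d E]] /=; rewrite E => -[_ e] e' dK.
by split=> //; exact: jeq_trans e e'.
Qed.

Lemma rep_sim A B (x : fmor A B) J K : x J -> jsim J K -> x K.
Proof.
move=> xJ s; apply: (rep_closed xJ (jsim_jeq s)).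
exact: jsim_derives s (rep_derives xJ).
Qed.

Lemma mk_rep A B J (d : derives A J B) : mk d J.
Proof. by split=> //; exact: jeq_refl. Qed.

Lemma rep_ex A B (x : fmor A B) : exists J, x J.
Proof.
by case: x => R [J [d E]]; exists J; rewrite /= E; split=> //; exact: jeq_refl.
Qed.

Lemma fmor_eq A B (x y : fmor A B) J : x J -> y J -> x = y.
Proof.
move=> xJ yJ; have E : reps x = reps y.
  apply/funext => K; apply/propext; split=> h.
    exact: rep_closed yJ (rep_jeq xJ h) (rep_derives h).
  exact: rep_closed xJ (rep_jeq yJ h) (rep_derives h).
clear xJ yJ; case: x y E => R p [R' p'] /= E; case: R' / E p' => p'.
by congr FMor; exact: Prop_irrelevance.
Qed.

Lemma cast_rep A A' B B' (eA : A = A') (eB : B = B') (x : fmor A B) J :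
  x J -> reps (hom_cast (hom := fmor) eA eB x) J.
Proof. by case: A' / eA; case: B' / eB. Qed.

Lemma fresh_rep A B (x : fmor A B) (s : seq L) :
  exists2 J, x J & {in jlabels J, forall a, a \notin s}.
Proof.
have [J xJ] := rep_ex x.
have [s' [us' ss' ds']] := fresh_list infL s (size (undup (jlabels J))).
have [r br E] := extend_bij (undup_uniq _) us' (esym ss').
exists (relabelJ r J).
  apply: (rep_closed xJ); first by apply/jeqP; exists r.
  exact: relabelJ_derives (bij_inj br) (rep_derives xJ).
move=> a; rewrite relabelJ_labels => /mapP[b bJ ->]; apply: ds'.
by rewrite -E map_f // mem_undup.
Qed.

Lemma rep_dis A B C D (x : fmor A B) (y : fmor C D) J :
  x J -> exists2 K, y K & dis J K.
Proof.
move=> xJ; have [K yK h] := fresh_rep y (jlabels J); exists K => // a aJ.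
by apply/negP => /h; rewrite aJ.
Qed.

Lemma subst_ext m t (r r' : nat -> term) : is_term m t ->
  (forall i, i < m -> r i = r' i) -> subst r t = subst r' t.
Proof.
move=> + h; elim/term_induction: t => [i|f a k|f Ks k IH|f Ks IH] H //=.
- by inversion H; subst; exact: h.
- congr (App _ _ _); apply/eq_in_map => M MK; apply: IH => //.
  by inversion H; subst; move/List.Forall_forall: H6; apply; apply/In_mem.
- congr (Scal _ _); apply/eq_in_map => M MK; apply: IH => //.
  by inversion H; subst; move/List.Forall_forall: H4; apply; apply/In_mem.
Qed.

Lemma subst_id t : subst Var t = t.
Proof.
elim/term_induction: t => //= [f Ks k|f Ks] IH;
  rewrite (_ : map _ Ks = Ks) // -[RHS]map_id; exact/eq_in_map.
Qed.

Lemma subst_subst (r r' : nat -> term) t :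
  subst r (subst r' t) = subst (fun i => subst r (r' i)) t.
Proof.
elim/term_induction: t => //= [f Ks k|f Ks] IH;
  rewrite -map_comp; [congr (App _ _ _)|congr (Scal _ _)];
  exact/eq_in_map.
Qed.

Lemma relabel_subst r (r' : nat -> term) t :
  relabel r (subst r' t) = subst (fun i => relabel r (r' i)) (relabel r t).
Proof.
elim/term_induction: t => //= [f Ks k|f Ks] IH;
  rewrite -!map_comp; [congr (App _ _ _)|congr (Scal _ _)];
  exact/eq_in_map.
Qed.

Lemma relabel_subst_list r Ms t :
  relabel r (subst_list Ms t) = subst_list (map (relabel r) Ms) (relabel r t).
Proof.
rewrite /subst_list relabel_subst; congr (subst _ _); apply/funext => i.
case: (ltnP i (size Ms)) => iM; first by rewrite (nth_map (Var i)).
by rewrite !nth_default ?size_map.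
Qed.

Lemma relabel_shift r m t : relabel r (shift m t) = shift m (relabel r t).
Proof. by rewrite /shift relabel_subst. Qed.

(** Substituting in a block of consecutive variables selects a block of the list
    of terms; the laws of the symmetry are checked with it. *)
Lemma subst_block Ms1 Ms2 Ms3 i m : size Ms1 = i -> size Ms2 = m ->
  map (subst_list (Ms1 ++ Ms2 ++ Ms3)) (map Var (iota i m)) = Ms2.
Proof.
move=> <- <-; rewrite -[in iota _ _](addn0 (size Ms1)) iotaDl -!map_comp.
apply: (@eq_from_nth _ (Var 0)); first by rewrite size_map size_iota.
move=> j; rewrite size_map size_iota => jM.
rewrite (nth_map 0) ?size_iota //= nth_iota //= /subst_list /= add0n.
rewrite nth_cat ltnNge leq_addr /= addnC addnK nth_cat jM.
exact: set_nth_default.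
Qed.

End FreeProp.

(** * The prop of judgments *)

Section FreeOperations.
Variables (G : signature) (L : eqType).
Hypothesis infL : infinite_set [set: L].
Local Notation term := (term G L).
Local Notation judgment := (judgment G L).
Local Notation fmor := (@fmor G L).
Implicit Types (A B C D : seq (sob G)) (f h : sarr G) (t n : term) (N Ms Zs : seq term).
Implicit Types (J K M : judgment) (r q : L -> L).
Local Notation Var := (@Var G L).

(** The labels of the nodes occur in the terms, so the nodes of judgments without
    common labels have no common labels either. *)
Lemma uniq_labs_dis A B C D J K N N' : dis J K ->
  good A N (jtms J) (jscals J) B -> good C N' (jtms K) (jscals K) D ->
  uniq (labs N' ++ labs N).
Proof.
move=> d g g'; rewrite cat_uniq (good_labs g) (good_labs g') andbT /=.
apply/hasPn => a /(labs_jlab g) aJ; apply/negP => /(labs_jlab g').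
by apply/negP; exact: d.
Qed.

Lemma comp_derives A B C J K : derives A J B -> derives B K C -> dis J K ->
  derives A (comp_judgment J K) C.
Proof.
move=> /derivesP[N g] /derivesP[N' g'] d; apply/derivesP.
exists (map (subst_list (jtms J)) N' ++ N).
apply: (good_comp g g'); exact: uniq_labs_dis d g g'.
Qed.

Lemma vars_cat A C : vars L (A ++ C) = vars L A ++ map (shift (size A)) (vars L C).
Proof.
rewrite /vars size_cat iotaD map_cat add0n -[in iota (size A) _](addn0 (size A)).
by rewrite iotaDl -!map_comp.
Qed.

Lemma wsubst_shift A C : wsubst (A ++ C) C (fun i => Var (size A + i)).
Proof. by move=> i b /= Ci; rewrite onth_cat ltnNge leq_addr /= addnC addnK. Qed.

Lemma wsubst_widen A C : wsubst (A ++ C) A Var.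
Proof.
move=> i b /= Ai; rewrite onth_cat; case: ltnP => // iA.
by rewrite onth_default in Ai.
Qed.

Lemma good_widen A C n : is_node A n -> is_node (A ++ C) n.
Proof. by move=> /(subst_node (@wsubst_widen A C)); rewrite subst_id. Qed.

Lemma good_tens A B C D N N' Ms Ms' Zs Zs' :
  good A N Ms Zs B -> good C N' Ms' Zs' D -> uniq (labs N' ++ labs N) ->
  good (A ++ C) (N ++ map (shift (size A)) N') (Ms ++ map (shift (size A)) Ms')
    (map (shift (size A)) Zs' ++ Zs) (B ++ D).
Proof.
move=> g g' ul; have gn := good_node g; have gn' := good_node g'.
have rn : renames (@nin G L) (@nout G L) (@nin G L) (@nout G L)
  (shift (size A)) (shift (size A)) N' by exact: subst_renames gn'.
split.
- rewrite /labs map_cat flatten_cat -!/(labs _).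
  by rewrite [labs (map _ N')](subst_labs _ gn') (perm_uniq (permEl (perm_catC _ _))).
- move=> n; rewrite mem_cat => /orP[/gn/good_widen //|/mapP[m /gn' mN' ->]].
  exact: subst_node (@wsubst_shift A C) mN'.
- rewrite !map_cat (subst_typed (@wsubst_shift A C) (good_ty g')).
  have := subst_typed (@wsubst_widen A C) (good_ty g).
  by rewrite (eq_map (@subst_id G L)) map_id => ->.
- rewrite outs_cat ins_cat (outs_map rn) (ins_map rn) vars_cat.
  have := perm_map (shift (size A)) (good_perm g'); rewrite !map_cat => p'.
  apply/permP => a; have := permP p' a; have := permP (good_perm g) a.
  by rewrite !count_cat; count_lia.
- rewrite filter_cat [filter _ (map _ N')](subst_is_scal _ gn') perm_catC.
  by apply: perm_cat (good_scal g); exact: perm_map (good_scal g').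
Qed.

Lemma tens_derives A B C D J K : derives A J B -> derives C K D -> dis J K ->
  derives (A ++ C) (tens_judgment (size A) J K) (B ++ D).
Proof.
move=> /derivesP[N g] /derivesP[N' g'] d; apply/derivesP.
exists (N ++ map (shift (size A)) N').
apply: (good_tens g g'); exact: uniq_labs_dis d g g'.
Qed.

(** Representatives with disjoint labels exist, and by [glue_labels] two choices
    of them differ by a single relabelling. *)
Lemma op_ex (op : judgment -> judgment -> judgment) A B C D A' B'
    (x : fmor A B) (y : fmor C D) :
  (forall J K, derives A J B -> derives C K D -> dis J K -> derives A' (op J K) B') ->
  (forall q J K, relabelJ q (op J K) = op (relabelJ q J) (relabelJ q K)) ->
  (forall J J' K K', jsim J J' -> jsim K K' -> jsim (op J K) (op J' K')) ->
  exists z : fmor A' B', forall J K, x J -> y K -> dis J K -> z (op J K).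
Proof.
move=> od orl os; have [J xJ] := rep_ex x; have [K yK d] := rep_dis infL y xJ.
have dJK := od J K (rep_derives xJ) (rep_derives yK) d.
exists (mk dJK) => J' K' xJ' yK' d'.
apply: (rep_closed (mk_rep dJK)); last first.
  by apply: od => //; [exact: rep_derives xJ'|exact: rep_derives yK'].
have [q [bq s s']] := glue_labels d d' (rep_jeq xJ xJ') (rep_jeq yK yK').
by apply/jeqP; exists q => //; rewrite orl; exact: os.
Qed.

Lemma comp_ex A B C (x : fmor A B) (y : fmor B C) :
  {z : fmor A C | forall J K, x J -> y K -> dis J K -> z (comp_judgment J K)}.
Proof.
apply/cid/op_ex => [J K||].
- exact: comp_derives.
- move=> q J K; rewrite /relabelJ /comp_judgment /= map_cat -!map_comp.
  by congr Judgment; [|congr (_ ++ _)]; apply: eq_map => t /=; rewrite relabel_subst_list.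
- move=> J J' K K' [E p] [E' p']; split; rewrite /= ?E ?E' //.
  by apply: perm_cat => //; exact: perm_map.
Qed.

Lemma tens_ex A B C D (x : fmor A B) (y : fmor C D) :
  {z : fmor (A ++ C) (B ++ D) | forall J K, x J -> y K -> dis J K ->
     z (tens_judgment (size A) J K)}.
Proof.
apply/cid/op_ex => [J K||].
- exact: tens_derives.
- move=> q J K; rewrite /relabelJ /tens_judgment /= !map_cat -!map_comp.
  congr Judgment; congr (_ ++ _); apply: eq_map => t /=; exact: relabel_shift.
- move=> J J' K K' [E p] [E' p']; split; rewrite /= ?E ?E' //.
  by apply: perm_cat => //; exact: perm_map.
Qed.

Definition fcomp A B C (x : fmor A B) (y : fmor B C) := sval (comp_ex x y).
Definition ftens A B C D (x : fmor A B) (y : fmor C D) := sval (tens_ex x y).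

Lemma fcompP A B C (x : fmor A B) (y : fmor B C) J K :
  x J -> y K -> dis J K -> fcomp x y (comp_judgment J K).
Proof. exact: (svalP (comp_ex x y)). Qed.

Lemma ftensP A B C D (x : fmor A B) (y : fmor C D) J K :
  x J -> y K -> dis J K -> ftens x y (tens_judgment (size A) J K).
Proof. exact: (svalP (tens_ex x y)). Qed.

Lemma wires_derives A B (s : seq nat) : perm_eq s (iota 0 (size A)) ->
  map (onth A) s = map Some B -> derives A (Judgment (map Var s) [::]) B.
Proof.
move=> p E; apply/derivesP; exists [::]; split => //=.
- by rewrite -map_comp.
- by rewrite cats0 perm_sym; exact: perm_map.
Qed.

Lemma map_onth_iota (T : Type) (s1 s2 s3 : seq T) :
  map (onth (s1 ++ s2 ++ s3)) (iota (size s1) (size s2)) = map Some s2.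
Proof.
rewrite -[in iota _ _](addn0 (size s1)) iotaDl -map_comp -mkseq_onth.
apply/eq_in_map => i; rewrite mem_iota /= add0n => i2.
by rewrite onth_cat ltnNge leq_addr /= addnC addnK onth_cat i2.
Qed.

Lemma id_derives A : derives A (id_judgment L A) A.
Proof.
apply: wires_derives => //.
by have := map_onth_iota [::] A [::]; rewrite /= cats0.
Qed.

Lemma symm_derives A B : derives (A ++ B) (symm_judgment L A B) (B ++ A).
Proof.
apply: wires_derives.
  by rewrite size_cat iotaD perm_catC.
rewrite !map_cat -[in iota (size A) _](add0n (size A)) add0n; congr (_ ++ _).
  by have := map_onth_iota A B [::]; rewrite cats0.
exact: map_onth_iota [::] A B.
Qed.

Definition fid A : fmor A A := mk (id_derives A).
Definition fsymm A B : fmor (A ++ B) (B ++ A) := mk (symm_derives A B).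

Lemma fidP A : fid A (id_judgment L A).
Proof. exact: mk_rep. Qed.

Lemma fsymmP A B : fsymm A B (symm_judgment L A B).
Proof. exact: mk_rep. Qed.

Lemma subst_labels (r : nat -> term) t a : a \in labels (subst r t) ->
  a \in labels t \/ exists i, a \in labels (r i).
Proof.
elim/term_induction: t => //= [i|f b k|f Ks k|f Ks].
- by right; exists i.
- by left.
- move=> IH /flatten_mapP[M]; case/mapP => M' M'K -> /(IH _ M'K)[aM|]; last by right.
  by left; apply/flatten_mapP; exists M'.
- move=> IH /flatten_mapP[M]; case/mapP => M' M'K -> /(IH _ M'K)[aM|]; last by right.
  by left; apply/flatten_mapP; exists M'.
Qed.

Lemma comp_labels J K : {subset jlabels (comp_judgment J K) <= jlabels J ++ jlabels K}.
Proof.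
move=> a /flatten_mapP[t] tJK at_; rewrite mem_cat; apply/orP.
have {tJK} : (t \in map (subst_list (jtms J)) (jtms K ++ jscals K)) || (t \in jscals J).
  by move: tJK; rewrite /= catA -map_cat mem_cat.
case/orP => [/mapP[t' t'K E]|tJ]; last first.
  by left; apply/flatten_mapP; exists t; rewrite // mem_cat tJ orbT.
move: at_; rewrite E => /subst_labels[at'|[i]].
  by right; apply/flatten_mapP; exists t'.
case: (ltnP i (size (jtms J))) => iJ; last by rewrite nth_default.
move=> ai; left; apply/flatten_mapP.
by exists (nth (Var i) (jtms J) i); rewrite // mem_cat mem_nth.
Qed.

Lemma shift_labels m t : labels (shift m t) = labels t.
Proof.
elim/term_induction: t => //= [f Ks k|f Ks] IH;
  rewrite -map_comp; congr flatten; exact/eq_in_map.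
Qed.

Lemma tens_labels m J K : {subset jlabels (tens_judgment m J K) <= jlabels J ++ jlabels K}.
Proof.
move=> a /flatten_mapP[t]; rewrite /= !mem_cat.
have H t' : t' \in jtms K ++ jscals K -> a \in labels (shift m t') -> a \in jlabels K.
  by rewrite shift_labels => t'K at'; apply/flatten_mapP; exists t'.
rewrite -orbA => /or4P[tJ|/mapP[t' tK ->]|/mapP[t' tK ->]|tJ] at_; apply/orP.
- by left; apply/flatten_mapP; exists t; rewrite // mem_cat tJ.
- by right; apply: H at_; rewrite mem_cat tK.
- by right; apply: H at_; rewrite mem_cat tK orbT.
- by left; apply/flatten_mapP; exists t; rewrite // mem_cat tJ orbT.
Qed.

End FreeOperations.

Section FreeLaws.
Variables (G : signature) (L : eqType).
Hypothesis infL : infinite_set [set: L].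
Local Notation term := (term G L).
Local Notation judgment := (judgment G L).
Local Notation fmor := (@fmor G L).
Implicit Types (A B C D : seq (sob G)) (f h : sarr G) (t n : term) (N Ms Zs : seq term).
Implicit Types (J K M : judgment) (r q : L -> L).
Local Notation Var := (@Var G L).
Local Notation fcomp := (fcomp infL).
Local Notation ftens := (ftens infL).
Local Notation fid := (@fid G L).
Local Notation fsymm := (@fsymm G L).
Local Notation fcast := (hom_cast (hom := fmor)).

Lemma jlabels_wires s : jlabels (Judgment (map Var s) [::]) = [::].
Proof. by rewrite /jlabels /= cats0; elim: s. Qed.

Lemma dis_sym J K : dis J K -> dis K J.
Proof. by move=> d a aK; apply/negP => /d; rewrite aK. Qed.

Lemma dis_wiresl s K : dis (Judgment (map Var s) [::]) K.
Proof. by move=> a; rewrite jlabels_wires. Qed.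

Lemma dis_wiresr s K : dis K (Judgment (map Var s) [::]).
Proof. exact/dis_sym/dis_wiresl. Qed.

Lemma dis_compl J K M : dis J M -> dis K M -> dis (comp_judgment J K) M.
Proof. by move=> d d' a /comp_labels; rewrite mem_cat => /orP[/d|/d']. Qed.

Lemma dis_compr J K M : dis J M -> dis K M -> dis M (comp_judgment J K).
Proof. by move=> d d'; apply: dis_sym; exact: dis_compl. Qed.

Lemma dis_tensl m J K M : dis J M -> dis K M -> dis (tens_judgment m J K) M.
Proof. by move=> d d' a /tens_labels; rewrite mem_cat => /orP[/d|/d']. Qed.

Lemma dis_tensr m J K M : dis J M -> dis K M -> dis M (tens_judgment m J K).
Proof. by move=> d d'; apply: dis_sym; exact: dis_tensl. Qed.

Arguments dis_tensl {m J K M}.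
Arguments dis_tensr {m J K M}.

Lemma rep_dis2 A B (x : fmor A B) J K : exists M, [/\ x M, dis J M & dis K M].
Proof.
have [M xM h] := fresh_rep infL x (jlabels J ++ jlabels K).
by exists M; split=> // a aJ; apply/negP => /h; rewrite mem_cat aJ ?orbT.
Qed.

Lemma rep_dis3 A B (x : fmor A B) J K J' :
  exists M, [/\ x M, dis J M, dis K M & dis J' M].
Proof.
have [M xM h] := fresh_rep infL x (jlabels J ++ jlabels K ++ jlabels J').
by exists M; split=> // a aJ; apply/negP => /h; rewrite !mem_cat aJ ?orbT.
Qed.

Lemma subst_list_cat Ms1 Ms2 A t : is_term (size A) t -> size Ms1 = size A ->
  subst_list (Ms1 ++ Ms2) t = subst_list Ms1 t.
Proof.
move=> ht s1; apply: subst_ext ht _ => i iA.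
rewrite nth_cat s1 iA; apply: set_nth_default; by rewrite s1.
Qed.

Lemma subst_list_shift Ms1 Ms2 A C t : is_term (size C) t -> size Ms1 = size A ->
  size Ms2 = size C -> subst_list (Ms1 ++ Ms2) (shift (size A) t) = subst_list Ms2 t.
Proof.
move=> ht s1 s2; rewrite /subst_list /shift subst_subst.
apply: subst_ext ht _ => i iC /=; rewrite nth_cat s1 ltnNge leq_addr /= addnC addnK.
by apply: set_nth_default; rewrite s2.
Qed.

Lemma subst_list_subst Ms Ks A t : is_term (size A) t -> size Ks = size A ->
  subst_list Ms (subst_list Ks t) = subst_list (map (subst_list Ms) Ks) t.
Proof.
move=> ht sK; rewrite /subst_list subst_subst; apply: subst_ext ht _ => i iA.
by rewrite (nth_map (Var i)) ?sK.
Qed.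

Lemma subst_list_vars A t : subst_list (vars L A) t = t.
Proof.
rewrite -[RHS]subst_id /subst_list; congr (subst _ _); apply/funext => i.
case: (ltnP i (size A)) => iA; last by rewrite nth_default ?size_vars.
by rewrite (nth_map 0) ?size_iota // nth_iota.
Qed.

Lemma shift0 t : shift 0 t = t.
Proof. exact: subst_id. Qed.

Lemma shift_shift m k t : shift m (shift k t) = shift (m + k) t.
Proof.
rewrite /shift subst_subst; congr (subst _ _); apply/funext => i /=.
by rewrite addnA.
Qed.

Lemma shift_subst_list m Ms A t : is_term (size A) t -> size Ms = size A ->
  shift m (subst_list Ms t) = subst_list (map (shift m) Ms) t.
Proof.
move=> ht sM; rewrite /subst_list /shift subst_subst.
by apply: subst_ext ht _ => i iA; rewrite (nth_map (Var i)) ?sM.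
Qed.

Lemma shift_wires m i k : map (shift m) (map Var (iota i k)) = map Var (iota (m + i) k).
Proof. by rewrite iotaDl -!map_comp. Qed.

Lemma fcomp_idl A B (x : fmor A B) : fcomp (fid A) x = x.
Proof.
have [J xJ] := rep_ex x.
have := fcompP infL (fidP L A) xJ (@dis_wiresl _ _).
rewrite /comp_judgment /= (eq_map (@subst_list_vars A)) map_id cats0.
rewrite (eq_map (@subst_list_vars A)) map_id => h; apply: fmor_eq h _.
by case: J xJ.
Qed.

Lemma fcomp_idr A B (x : fmor A B) : fcomp x (fid B) = x.
Proof.
have [J xJ] := rep_ex x.
have := fcompP infL xJ (fidP L B) (@dis_wiresr _ _).
rewrite /comp_judgment /= subst_vars; last exact: derives_size (rep_derives xJ).
by move=> h; apply: fmor_eq h _; case: J xJ.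
Qed.

(** In this law and the next ones, representatives with pairwise disjoint labels
    are chosen; both sides have the same terms, and the same scalar terms up to
    order. *)
Lemma fcompA A B C D (x : fmor A B) (y : fmor B C) (z : fmor C D) :
  fcomp x (fcomp y z) = fcomp (fcomp x y) z.
Proof.
have [J xJ] := rep_ex x; have [K yK dJK] := rep_dis infL y xJ.
have [M [zM dJM dKM]] := rep_dis2 z J K.
have h1 := fcompP infL xJ (fcompP infL yK zM dKM) (dis_compr (dis_sym dJK) (dis_sym dJM)).
have h2 := fcompP infL (fcompP infL xJ yK dJK) zM (dis_compl dJM dKM).
apply: fmor_eq h2; apply: rep_sim h1 _.
have sK := derives_size (rep_derives yK).
have E : {in jtms M ++ jscals M, forall t,
    subst_list (jtms J) (subst_list (jtms K) t) =
    subst_list (map (subst_list (jtms J)) (jtms K)) t}.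
  by move=> t tM; apply: subst_list_subst sK; exact: derives_is_term (rep_derives zM) tM.
split; rewrite /= ?map_cat -!map_comp.
  by apply/eq_in_map => t tM; rewrite /= E // mem_cat tM.
rewrite -catA; apply: perm_cat => //; rewrite (_ : map _ (jscals M) =
  map (subst_list (map (subst_list (jtms J)) (jtms K))) (jscals M)) //.
by apply/eq_in_map => t tM; rewrite /= E // mem_cat tM orbT.
Qed.

Lemma ftens_id A B : ftens (fid A) (fid B) = fid (A ++ B).
Proof.
have := ftensP infL (fidP L A) (fidP L B) (@dis_wiresl _ _).
rewrite /tens_judgment /= -vars_cat => h; apply: fmor_eq h _; exact: fidP.
Qed.

Lemma ftens_comp A B C A' B' C' (x : fmor A B) (y : fmor B C)
    (x' : fmor A' B') (y' : fmor B' C') :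
  ftens (fcomp x y) (fcomp x' y') = fcomp (ftens x x') (ftens y y').
Proof.
have [J xJ] := rep_ex x; have [K yK dJK] := rep_dis infL y xJ.
have [J' [xJ' dJJ' dKJ']] := rep_dis2 x' J K.
have [K' [yK' dJK' dKK' dJK'']] := rep_dis3 y' J K J'.
have h1 := ftensP infL (fcompP infL xJ yK dJK) (fcompP infL xJ' yK' dJK'')
  (dis_compl (dis_compr (dis_sym dJJ') (dis_sym dJK'))
             (dis_compr (dis_sym dKJ') (dis_sym dKK'))).
have h2 := fcompP infL (ftensP infL xJ xJ' dJJ') (ftensP infL yK yK' dKK')
  (dis_tensl (dis_tensr (dis_sym dJK) (dis_sym dJK'))
             (dis_tensr dKJ' (dis_sym dJK''))).
apply: fmor_eq h2; apply: rep_sim h1 _.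
have sJ := derives_size (rep_derives xJ); have sJ' := derives_size (rep_derives xJ').
have E1 : {in jtms K ++ jscals K, forall t,
    subst_list (jtms J ++ map (shift (size A)) (jtms J')) t = subst_list (jtms J) t}.
  by move=> t /(derives_is_term (rep_derives yK)) ht; exact: subst_list_cat ht sJ.
have E2 : {in jtms K' ++ jscals K', forall t,
    subst_list (jtms J ++ map (shift (size A)) (jtms J')) (shift (size B) t) =
    shift (size A) (subst_list (jtms J') t)}.
  move=> t /(derives_is_term (rep_derives yK')) ht.
  rewrite (subst_list_shift ht) ?size_map // (shift_subst_list _ ht) //.
split; rewrite /= ?map_cat -!map_comp.
  congr (_ ++ _); apply/eq_in_map => t tK /=.
    by rewrite E1 // mem_cat tK.
  by rewrite E2 // mem_cat tK.
rewrite -!catA; apply/permP => a; rewrite !count_cat.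
have -> : map (subst_list (jtms J ++ map (shift (size A)) (jtms J'))) (jscals K) =
   map (subst_list (jtms J)) (jscals K).
  by apply/eq_in_map => t tK /=; rewrite E1 // mem_cat tK orbT.
have -> : map (subst_list (jtms J ++ map (shift (size A)) (jtms J')) \o shift (size B))
   (jscals K') = map (shift (size A) \o subst_list (jtms J')) (jscals K').
  by apply/eq_in_map => t tK /=; rewrite E2 // mem_cat tK orbT.
by count_lia.
Qed.

Lemma ftensA A B A' B' A'' B'' (x : fmor A B) (x' : fmor A' B') (x'' : fmor A'' B'') :
  fcast (catA A A' A'') (catA B B' B'') (ftens x (ftens x' x'')) =
  ftens (ftens x x') x''.
Proof.
have [J xJ] := rep_ex x; have [K yK dJK] := rep_dis infL x' xJ.
have [M [zM dJM dKM]] := rep_dis2 x'' J K.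
have h1 := ftensP infL xJ (ftensP infL yK zM dKM) (dis_tensr (dis_sym dJK) (dis_sym dJM)).
have h2 := ftensP infL (ftensP infL xJ yK dJK) zM (dis_tensl dJM dKM).
apply: fmor_eq h2; apply: cast_rep; apply: rep_sim h1 _.
have E : shift (size A) \o shift (size A') =1 @shift G L (size (A ++ A')).
  by move=> t; rewrite /= shift_shift size_cat.
split; rewrite /= ?map_cat -!map_comp (eq_map E) ?catA //.
Qed.

Lemma ftens_unitl A B (x : fmor A B) : ftens (fid [::]) x = x.
Proof.
have [J xJ] := rep_ex x.
have := ftensP infL (fidP L [::]) xJ (@dis_wiresl _ _).
rewrite /tens_judgment /= !(eq_map shift0) !map_id cats0 => h.
by apply: fmor_eq h _; case: J xJ.
Qed.

Lemma ftens_unitr A B (x : fmor A B) :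
  fcast (cats0 A) (cats0 B) (ftens x (fid [::])) = x.
Proof.
have [J xJ] := rep_ex x.
have h := ftensP infL xJ (fidP L [::]) (@dis_wiresr _ _).
apply: fmor_eq xJ; apply: cast_rep; apply: (rep_sim h).
by split; rewrite //= cats0.
Qed.

Lemma fsymm_nat A B A' B' (x : fmor A B) (x' : fmor A' B') :
  fcomp (ftens x x') (fsymm B B') = fcomp (fsymm A A') (ftens x' x).
Proof.
have [J xJ] := rep_ex x; have [K yK dJK] := rep_dis infL x' xJ.
have h1 := fcompP infL (ftensP infL xJ yK dJK) (fsymmP L B B') (@dis_wiresr _ _).
have h2 := fcompP infL (fsymmP L A A') (ftensP infL yK xJ (dis_sym dJK)) (@dis_wiresl _ _).
apply: fmor_eq h2; apply: rep_sim h1 _.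
have sJ := derives_size (rep_derives xJ); have sK := derives_size (rep_derives yK).
have v1 : size (map Var (iota (size A) (size A'))) = size A' by rewrite size_map size_iota.
have v2 : size (map Var (iota 0 (size A))) = size A by rewrite size_map size_iota.
have E1 : {in jtms J ++ jscals J, forall t, subst_list (map Var (iota (size A)
    (size A') ++ iota 0 (size A))) (shift (size A') t) = t}.
  move=> t /(derives_is_term (rep_derives xJ)) ht; rewrite map_cat.
  by rewrite (subst_list_shift ht v1 v2) subst_list_vars.
have E2 : {in jtms K ++ jscals K, forall t, subst_list (map Var (iota (size A)
    (size A') ++ iota 0 (size A))) t = shift (size A) t}.
  move=> t /(derives_is_term (rep_derives yK)) ht; rewrite map_cat.
  rewrite (subst_list_cat _ ht v1) -[t in RHS](@subst_list_vars A').
  by rewrite (shift_subst_list _ ht) ?size_vars // shift_wires addn0.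
have F1 : map (subst_list (map Var (iota (size A) (size A') ++ iota 0 (size A))) \o
    shift (size A')) (jtms J) = jtms J.
  by rewrite -[RHS]map_id; apply/eq_in_map => t tJ /=; rewrite E1 // mem_cat tJ.
have F2 : map (subst_list (map Var (iota (size A) (size A') ++ iota 0 (size A))) \o
    shift (size A')) (jscals J) = jscals J.
  by rewrite -[RHS]map_id; apply/eq_in_map => t tJ /=; rewrite E1 // mem_cat tJ orbT.
have F3 : map (subst_list (map Var (iota (size A) (size A') ++ iota 0 (size A))))
     (jtms K) = map (shift (size A)) (jtms K).
  by apply/eq_in_map => t tJ /=; rewrite E2 // mem_cat tJ.
have F4 : map (subst_list (map Var (iota (size A) (size A') ++ iota 0 (size A))))
     (jscals K) = map (shift (size A)) (jscals K).
  by apply/eq_in_map => t tJ /=; rewrite E2 // mem_cat tJ orbT.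
split; rewrite /= map_cat -?map_comp ?F1 ?F2 ?F3 ?F4.
  rewrite !(map_cat (subst_list _)) -(map_comp _ (shift (size A'))) F1 F3.
  congr (_ ++ _).
    have := @subst_block G L (jtms J) (map (shift (size A)) (jtms K)) [::] (size B)
      (size B') sJ.
    by rewrite cats0 => -> //; rewrite size_map.
  exact: (@subst_block G L [::] (jtms J) (map (shift (size A)) (jtms K)) 0 (size B)).
by rewrite cats0 perm_catC.
Qed.

Lemma fsymmK A B : fcomp (fsymm A B) (fsymm B A) = fid (A ++ B).
Proof.
have h := fcompP infL (fsymmP L A B) (fsymmP L B A) (@dis_wiresl _ _).
apply: fmor_eq (rep_sim h _) (fidP L _); split => //=.
rewrite !map_cat /vars size_cat iotaD map_cat; congr (_ ++ _).
  rewrite -[X in subst_list X](cats0 (_ ++ _)) -catA.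
  by rewrite subst_block ?size_map ?size_iota.
by rewrite (@subst_block _ _ [::]) ?size_map ?size_iota.
Qed.

Lemma fsymm_hexagon A B C :
  fcast (catA A B C) (esym (catA B C A)) (fsymm A (B ++ C)) =
  fcomp (ftens (fsymm A B) (fid C))
    (fcast (catA B A C) erefl (ftens (fid B) (fsymm A C))).
Proof.
have h1 := cast_rep (catA B A C) erefl
  (ftensP infL (fidP L B) (fsymmP L A C) (@dis_wiresl _ _)).
have h2 := ftensP infL (fsymmP L A B) (fidP L C) (@dis_wiresl _ _).
have h := fcompP infL h2 h1 (dis_tensl (@dis_wiresl _ _) (@dis_wiresl _ _)).
apply: (fmor_eq _ h); apply: cast_rep; apply: (rep_sim (fsymmP L A (B ++ C))).
split => //=.
set Vb := map Var (iota (size A) (size B)); set Va := map Var (iota 0 (size A)).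
have -> : map Var (iota (size A) (size B) ++ iota 0 (size A)) = Vb ++ Va.
  by rewrite map_cat.
rewrite shift_wires addn0.
have -> : map (shift (size B)) (map Var (iota (size A) (size C) ++ iota 0 (size A))) =
   map Var (iota (size B + size A) (size C)) ++ map Var (iota (size B + 0) (size A)).
  by rewrite map_cat map_cat !shift_wires.
set Vc := map Var (iota (size (A ++ B)) (size C)).
have sa : size Va = size A by rewrite size_map size_iota.
have sb : size Vb = size B by rewrite size_map size_iota.
have sc : size Vc = size C by rewrite size_map size_iota.
rewrite !(map_cat (subst_list _)) -catA.
rewrite (subst_block (Ms1 := [::]) _ erefl sb) addn0 (subst_block _ sb sa).
have := @subst_block G L (Vb ++ Va) Vc [::] (size B + size A) (size C).
rewrite cats0 -catA => -> //; last by rewrite size_cat sb sa.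
by rewrite size_cat iotaD !map_cat -catA /Vc size_cat.
Qed.

Definition freeS : prop_structure fmor :=
  PropStructure fcomp_idl fcomp_idr fcompA ftens_id ftens_comp ftensA ftens_unitl
    ftens_unitr fsymm_nat fsymmK fsymm_hexagon.

End FreeLaws.

(** * Generators *)

Section Generators.
Variables (G : signature) (L : eqType).
Hypothesis infL : infinite_set [set: L].
Local Notation term := (term G L).
Local Notation freeS := (freeS G infL).
Local Notation freeP := (PropCat freeS).
Implicit Types (f : sarr G) (a : L).

Lemma freeS_free : is_free_structure freeS.
Proof.
split=> [A|A B C x y J K xJ yK /disP d|A B C D x y J K xJ yK /disP d|A B] /=.
- exact: fidP.
- exact: fcompP.
- exact: ftensP.
- exact: fsymmP.
Qed.

Definition gen_node f a : term :=
  if nilp (scod f) then Scal f (vars L (sdom f))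
  else if nilp (sdom f) then Cst f a 0 else App f (vars L (sdom f)) 0.

Lemma gen_nodeP f a : [/\ is_node (sdom f) (gen_node f a),
  nin (gen_node f a) = vars L (sdom f),
  nout (gen_node f a) = jtms (gen_judgment f a)
  & filter (@is_scal G L) [:: gen_node f a] = jscals (gen_judgment f a)].
Proof.
rewrite /gen_node /gen_judgment; case: nilP => f0 /=.
  by split=> //; split=> //; exact: tyo_vars.
case: nilP => d0 /=; first by split=> //; rewrite ?d0.
by split=> //; split=> //; exact: tyo_vars.
Qed.

Lemma gen_good f a : good (sdom f) [:: gen_node f a]
  (jtms (gen_judgment f a)) (jscals (gen_judgment f a)) (scod f).
Proof.
have [gn gi go gs] := gen_nodeP f a; split.
- by rewrite /labs /= cats0; case: gen_node.
- by move=> n; rewrite inE => /eqP ->.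
- rewrite /gen_judgment; case: nilP => [->//|_].
  by case: nilP => _ /=; [exact: tyo_csts|exact: tyo_apps].
- by rewrite /consumed /produced /= !cats0 gi go.
- by rewrite gs.
Qed.

Lemma gen_derives f a : derives (sdom f) (gen_judgment f a) (scod f).
Proof. by apply/derivesP; exists [:: gen_node f a]; exact: gen_good. Qed.

Lemma relabel_vars (A : seq (sob G)) r : map (relabel r) (vars L A) = vars L A.
Proof. by rewrite -map_comp. Qed.

(** The label of a constant can be changed by a transposition of labels. *)
Lemma gen_jeq f a b : jeq (gen_judgment f a) (gen_judgment f b).
Proof.
apply/jeqP; exists (transp a b); first by exists (transp a b); exact: transpK.
rewrite /jsim /gen_judgment; case: nilP => _ /=; first by rewrite relabel_vars.
case: nilP => _ /=; split=> //.
  by rewrite -map_comp; apply: eq_map => i /=; rewrite /transp eqxx.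
by rewrite -map_comp; apply: eq_map => i /=; rewrite relabel_vars.
Qed.

Definition label0 : L := sval (cid (infinite_setN0 infL)).

Definition eta_arr f : arrow freeP := @Arrow freeP _ _ (mk (gen_derives f label0)).

Definition free_eta : sig_mor G (underlying freeP) :=
  @SigMor G (underlying freeP) id eta_arr
    (fun f => esym (map_id (sdom f))) (fun f => esym (map_id (scod f))).

Lemma eta_rep f a : mk (gen_derives f label0) (gen_judgment f a).
Proof.
apply: (rep_closed (mk_rep _)) (gen_derives f a); exact: gen_jeq.
Qed.

Lemma eta_inclusion : is_generator_inclusion free_eta.
Proof.
by split=> // f a; exists (mk (gen_derives f label0)); split=> //; exact: eta_rep.
Qed.

End Generators.

(** * The interpretation of judgments in a prop *)

Section Interpretation.
Variables (G : signature) (L : eqType).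
Hypothesis infL : infinite_set [set: L].
Variables (P : prop_cat) (w : sig_mor G (underlying P)).
Local Notation term := (term G L).
Local Notation judgment := (judgment G L).
Local Notation fmor := (@fmor G L).
Implicit Types (A B C D : seq (sob G)) (f h : sarr G) (t n : term) (N Ms Zs : seq term).
Implicit Types (J K M : judgment) (r q : L -> L).
Local Notation ins := (consumed (@nin G L)).
Local Notation outs := (produced (@nout G L)).
Local Notation run := (run (@nin G L) (@nout G L)).

(** The object of a wire, as a list: it is empty on terms without a type, which
    keeps the function total. *)
Definition wire_ob A t : seq (pob P) := if tyo A t is Some b then [:: smob w b] else [::].

Definition node_arrow n : arrow P :=
  match n with
  | Var _ => aid [::]
  | Cst f _ _ | App f _ _ | Scal f _ => smarr w f
  end.

Local Notation sem A := (sem (@nin G L) (@nout G L) (wire_ob A) node_arrow).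

Lemma obs_typed A Ms B : map (tyo A) Ms = map Some B -> obs (wire_ob A) Ms = map (smob w) B.
Proof.
elim: Ms B => [|M Ms IH] [|b B] //= [tM /IH].
by rewrite obs_cons /wire_ob tM => ->.
Qed.

Lemma obs_vars A : obs (wire_ob A) (vars L A) = map (smob w) A.
Proof. exact: obs_typed (tyo_vars L A). Qed.

Lemma node_arrow_typed A n : is_node A n ->
  val_typed (@nin G L) (@nout G L) (wire_ob A) node_arrow n.
Proof.
rewrite /val_typed; have D f : asrc (smarr w f) = map (smob w) (sdom f) := smdom w f.
have E f : atgt (smarr w f) = map (smob w) (scod f) := smcod w f.
case: n => //= [f a k|f Ms k|f Ms]; rewrite D E.
- by case=> _ -> _; rewrite (obs_typed (tyo_csts A f a)).
- by case=> _ _ _ tM; rewrite (obs_typed tM) (obs_typed (tyo_apps A f Ms)).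
- by case=> -> tM; rewrite (obs_typed tM).
Qed.

Lemma nodes_typed A N : {in N, forall n, is_node A n} ->
  {in N, forall n, val_typed (@nin G L) (@nout G L) (wire_ob A) node_arrow n}.
Proof. by move=> h n /h /node_arrow_typed. Qed.

(** A relation, because the run of the nodes is not determined by J; by
    [value_jeq] its arrow is. *)
Definition value A J B (phi : arrow P) := exists N,
  [/\ good A N (jtms J) (jscals J) B, run (vars L A) N (jtms J)
    & phi = sem A (vars L A) N (jtms J)].

Lemma good_permN A N N' Ms Zs B : perm_eq N N' -> good A N Ms Zs B -> good A N' Ms Zs B.
Proof.
move=> p [gl gn gt gp gs]; split=> //.
- by rewrite -(perm_uniq (perm_labs p)).
- by move=> n; rewrite -(perm_mem p); exact: gn.
- rewrite -(permPl (perm_cat (perm_refl _) (perm_flatten (perm_map _ p)))).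
  by rewrite (permPl gp) perm_cat2r; exact/perm_flatten/perm_map.
- by rewrite -(permPl (perm_filter _ p)).
Qed.

(** A node consumes wires of smaller level, so its level can be taken as rank. *)
Lemma good_run A N Ms Zs B : good A N Ms Zs B ->
  exists2 N', perm_eq N N' & run (vars L A) N' Ms.
Proof.
move=> g; apply: (@exists_run _ _ _ _ (@lev G L)) (good_uniq g) (good_perm g) _.
by move=> n m _ _ x; exact: lev_lt.
Qed.

Lemma value_ex A J B : derives A J B -> exists phi, value A J B phi.
Proof.
move=> /derivesP[N g]; have [N' p h] := good_run g.
by exists (sem A (vars L A) N' (jtms J)), N'; split=> //; exact: good_permN g.
Qed.

Lemma value_src A J B phi : value A J B phi -> asrc phi = map (smob w) A.
Proof. by case=> N [_ _ ->]; rewrite asrc_sem obs_vars. Qed.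

Lemma value_tgt A J B phi : value A J B phi -> atgt phi = map (smob w) B.
Proof.
case=> N [g h ->]; rewrite atgt_sem ?(obs_typed (good_ty g)) //.
exact: nodes_typed (good_node g).
Qed.

Lemma bij_relabel_inj r : bijective r -> injective (relabel r : term -> term).
Proof.
case=> r' rK _; apply: (@can_inj _ _ _ (relabel r')) => t.
rewrite -[LHS]/((relabel r' \o relabel r) t) -relabel_comp.
by have -> : r' \o r = id by [apply/funext]; exact: relabel_id.
Qed.

(** Relabelling renames wires and nodes; after that, the nodes are the same up to
    order since the terms are the same. *)
Lemma value_jeq A J K B phi psi : value A J B phi -> value A K B psi -> jeq J K -> phi = psi.
Proof.
move=> [N [g h ->]] [N' [g' h' ->]] /jeqP[r br [E p]].
have gr := good_relabel (bij_inj br) g.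
have ir := bij_relabel_inj br.
have hr : run (vars L A) (map (relabel r) N) (jtms K).
  rewrite -E -(relabel_vars A r); apply: run_map h; last by move=> x y _ _; exact: ir.
  exact: relabel_renames.
have pN : perm_eq N' (map (relabel r) N).
  have gr' : good A (map (relabel r) N) (jtms K) (jscals K) B.
    by rewrite -E; case: gr => *; split=> //; apply: perm_trans p.
  exact: nodes_perm g' gr'.
rewrite (sem_perm (nodes_typed (good_node g')) pN h' hr) -E /= -{2}(relabel_vars A r).
symmetry; apply: sem_map h.
- exact: relabel_renames.
- by move=> x y _ _; exact: ir.
- by move=> x _; rewrite /wire_ob relabel_tyo.
- by case.
Qed.

Lemma uniq_map_inj (T U : eqType) (g : T -> U) (s : seq T) :
  uniq (map g s) -> {in s &, injective g}.
Proof.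
elim: s => //= x s IH /andP[xs /IH inj] y z.
rewrite !inE => /predU1P[->|ys] /predU1P[->|zs] //.
- by move=> E; rewrite E map_f in xs.
- by move=> E; rewrite -E map_f in xs.
- exact: inj.
Qed.

(** The nodes of J are run first, then those of K with the terms of J substituted
    for the variables.  This substitution is injective on the wires of K because
    the composite is good, so it only renames the second run. *)
Lemma value_comp A B C J K phi psi : dis J K ->
  value A J B phi -> value B K C psi -> value A (comp_judgment J K) C (phi >> psi).
Proof.
move=> d [N [g h ->]] [N' [g' h' ->]].
pose sg := subst_list (jtms J).
have sJ : size (jtms J) = size B.
  by rewrite -(size_map (tyo A)) (good_ty g) size_map.
have sv : map sg (vars L B) = jtms J by rewrite /sg /vars subst_vars.
have gc := good_comp g g' (uniq_labs_dis d g g').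
have rn : renames (@nin G L) (@nout G L) (@nin G L) (@nout G L) sg sg N'.
  by exact: subst_renames (good_node g').
have gc' : good A (N ++ map sg N') (jtms (comp_judgment J K))
    (jscals (comp_judgment J K)) C.
  by apply: good_permN gc; rewrite perm_catC.
have U := good_uniq gc'; rewrite outs_cat (outs_map rn) in U.
(* The images are distinct wires of the composite. *)
have inj : {in vars L B ++ outs N' &, injective sg}.
  apply: uniq_map_inj; rewrite map_cat sv.
  move: U; rewrite catA (perm_uniq (perm_cat (good_perm g) (perm_refl _))).
  by rewrite -catA cat_uniq => /and3P[].
have h2 : run (jtms J) (map sg N') (map sg (jtms K)).
  by rewrite -sv; exact: run_map h'.
have U' : uniq (vars L A ++ outs (N ++ map sg N')) by rewrite outs_cat (outs_map rn).
exists (N ++ map sg N'); split=> //; first exact: run_cat h2.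
rewrite (sem_cat _ U' h h2); last exact: nodes_typed (good_node gc').
congr (_ >> _); rewrite -{1}sv; symmetry; apply: sem_map h' => //.
- move=> x xw; rewrite /wire_ob.
  have : tyo B x <> None by exact: good_typed g' xw.
  case Ex: (tyo B x) => [b|] // _; by rewrite (subst_tyo (wsubst_nth (good_ty g)) Ex).
- by move=> n /(good_node g'); case: n.
Qed.

Lemma value_id A : value A (id_judgment L A) A (aid (map (smob w) A)).
Proof.
exists [::]; split=> //=.
- by split=> //; rewrite ?tyo_vars //= cats0.
- by split=> //; exact: uniq_vars.
- by rewrite pm_refl obs_vars.
Qed.

Lemma obs_shift A C : obs (wire_ob (A ++ C)) (map (shift (size A)) (vars L C)) =
  map (smob w) C.
Proof.
apply: obs_typed; apply: (subst_typed (@wsubst_shift G L A C)); exact: tyo_vars.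
Qed.

Lemma obs_widen A C : obs (wire_ob (A ++ C)) (vars L A) = map (smob w) A.
Proof.
have := subst_typed (@wsubst_widen G L A C) (tyo_vars L A).
by rewrite (eq_map (@subst_id G L)) map_id; exact: obs_typed.
Qed.

Lemma value_symm A B : value (A ++ B) (symm_judgment L A B) (B ++ A)
  (asym (map (smob w) A) (map (smob w) B)).
Proof.
have E : jtms (symm_judgment L A B) = map (shift (size A)) (vars L B) ++ vars L A.
  by rewrite /= map_cat /vars shift_wires addn0.
have U : uniq (vars L A ++ map (shift (size A)) (vars L B)).
  by rewrite -vars_cat uniq_vars.
exists [::]; split.
- split=> //; rewrite ?E //=; last by rewrite cats0 vars_cat perm_catC.
  have := subst_typed (@wsubst_widen G L A B) (tyo_vars L A).
  rewrite (eq_map (@subst_id G L)) map_id !map_cat => ->.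
  by rewrite (subst_typed (@wsubst_shift G L A B) (tyo_vars L B)).
- by rewrite E vars_cat /=; split=> //; rewrite perm_catC.
- by rewrite E vars_cat /= pm_asym // obs_widen obs_shift.
Qed.

(** The nodes of J are run beside the variables of K, then the nodes of K beside
    the outputs of J. *)
Lemma value_tens A B C D J K phi psi : dis J K ->
  value A J B phi -> value C K D psi ->
  value (A ++ C) (tens_judgment (size A) J K) (B ++ D) (phi ** psi).
Proof.
move=> d [N [g h ->]] [N' [g' h' ->]].
pose sg := @shift G L (size A).
have gt := good_tens g g' (uniq_labs_dis d g g').
have rn : renames (@nin G L) (@nout G L) (@nin G L) (@nout G L) sg sg N'.
  by exact: subst_renames (good_node g').
have U := good_uniq gt; rewrite vars_cat outs_cat (outs_map rn) in U.
pose V := map sg (vars L C).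
have U1 : uniq ((vars L A ++ V) ++ outs N).
  by move: U; rewrite catA cat_uniq => /and3P[].
have U2 : uniq (jtms J ++ V ++ map sg (outs N')).
  move: U; rewrite (perm_uniq (_ : perm_eq _
    (ins N ++ (jtms J ++ V ++ map sg (outs N'))))).
    by rewrite cat_uniq => /and3P[].
  apply/permP => a; have := permP (good_perm g) a.
  by rewrite !count_cat; count_lia.
have inj : {in vars L C ++ outs N' &, injective sg}.
  apply: uniq_map_inj; rewrite map_cat.
  by move: U2; rewrite [uniq (jtms J ++ _)]cat_uniq => /and3P[].
have h1 : run (vars L A ++ V) N (jtms J ++ V) by exact: run_frame h.
have h2' : run V (map sg N') (map sg (jtms K)) by exact: run_map h'.
have U3 : uniq ((V ++ jtms J) ++ outs (map sg N')).
  by rewrite (outs_map rn) -catA uniq_catCA.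
have h2 : run (jtms J ++ V) (map sg N') (jtms J ++ map sg (jtms K)).
  have := run_frame U3 h2'; move/(run_perml (permEl (perm_catC (jtms J) V))).
  by apply: run_permr; rewrite perm_catC.
have U' : uniq (vars L (A ++ C) ++ outs (N ++ map sg N')).
  by rewrite vars_cat outs_cat (outs_map rn).
exists (N ++ map sg N'); split=> //.
  by rewrite vars_cat; apply: run_cat h1 h2; rewrite -vars_cat.
rewrite vars_cat in U' *.
have vt := nodes_typed (good_node gt).
have vt1 : {in N, forall n,
    val_typed (@nin G L) (@nout G L) (wire_ob (A ++ C)) node_arrow n}.
  by move=> n nN; apply: vt; rewrite mem_cat nN.
have vt2 : {in map sg N', forall n,
    val_typed (@nin G L) (@nout G L) (wire_ob (A ++ C)) node_arrow n}.
  by move=> n nN; apply: vt; rewrite mem_cat nN orbT.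
rewrite (sem_cat vt U' h1 h2) (sem_framer vt1 U1 h) (sem_framel vt2 U3 h2').
have -> : sem (A ++ C) V (map sg N') (map sg (jtms K)) = sem C (vars L C) N' (jtms K).
  apply: sem_map h' => //; last by move=> n /(good_node g'); case: n.
  move=> x xw; rewrite /wire_ob.
  have : tyo C x <> None by exact: good_typed g' xw.
  case Ex: (tyo C x) => [b|] // _.
  by rewrite (subst_tyo (@wsubst_shift G L A C) Ex).
have -> : sem (A ++ C) (vars L A) N (jtms J) = sem A (vars L A) N (jtms J).
  rewrite -{1}[vars L A]map_id -{1}[N]map_id -{1}[jtms J]map_id; apply: sem_map h => //.
    by move=> n _; rewrite !map_id.
  move=> x xw; rewrite /wire_ob.
  have : tyo A x <> None by exact: good_typed g xw.
  case Ex: (tyo A x) => [b|] // _.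
  by have := subst_tyo (@wsubst_widen G L A C) Ex; rewrite subst_id => ->.
have vtA := nodes_typed (good_node g).
have tB := obs_typed (good_ty g).
have tB' : obs (wire_ob (A ++ C)) (jtms J) = map (smob w) B.
  have := subst_typed (@wsubst_widen G L A C) (good_ty g).
  by rewrite (eq_map (@subst_id G L)) map_id => /obs_typed.
rewrite obs_shift tB' -tB -(atgt_sem vtA h) -obs_vars.
have := asrc_sem (@nin G L) (@nout G L) (wire_ob C) node_arrow (vars L C) N' (jtms K).
by move=> <-; rewrite slide_l.
Qed.

Lemma value_gen f a : value (sdom f) (gen_judgment f a) (scod f) (smarr w f).
Proof.
have [gn gi go _] := gen_nodeP f a; have gg := gen_good f a.
have rE : remaining (@nin G L) (vars L (sdom f)) (gen_node f a) = [::].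
  apply/eqP; rewrite -[_ == _]negbK -has_filter; apply/hasPn => x.
  by rewrite gi => ->.
have h : run (vars L (sdom f)) [:: gen_node f a] (jtms (gen_judgment f a)).
  split; rewrite ?rE ?cats0 ?gi ?go //; first exact: good_uniq gg.
  split=> //; rewrite -go; exact: uniq_nout.
exists [:: gen_node f a]; split=> //=; rewrite rE !cats0 gi go !pm_refl.
have [vi vo] := node_arrow_typed gn; rewrite gi in vi; rewrite go in vo.
rewrite atens_unitr acomp_idl // acomp_idr //.
by rewrite /gen_node; case: nilP => // _; case: nilP.
Qed.

Lemma ext_hom_ex A B (x : fmor A B) : exists h : phom (map (smob w) A) (map (smob w) B),
  exists2 J, x J & value A J B (Arrow h).
Proof.
have [J xJ] := rep_ex x; have [phi s] := value_ex (rep_derives xJ).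
have e1 := value_src s; have e2 := value_tgt s.
case: phi s e1 e2 => S T h s /= e1 e2; subst S T.
by exists h, J.
Qed.

Definition ext_hom A B (x : fmor A B) := sval (cid (ext_hom_ex x)).

Lemma FhomP A B (x : fmor A B) J phi : x J -> value A J B phi -> Arrow (ext_hom x) = phi.
Proof.
move=> xJ s; have [K xK sK] := svalP (cid (ext_hom_ex x)).
exact: value_jeq sK s (rep_jeq xK xJ).
Qed.

Lemma ext_hom_rep A B (x : fmor A B) J : x J -> value A J B (Arrow (ext_hom x)).
Proof.
by move=> xJ; have [phi s] := value_ex (rep_derives xJ); rewrite (FhomP xJ s).
Qed.

Lemma ext_hom_id A : ext_hom (fid L A) = idm (pstr P) (map (smob w) A).
Proof. by apply: Arrow_inj; exact: FhomP (fidP L A) (value_id A). Qed.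

Lemma ext_hom_comp A B C (x : fmor A B) (y : fmor B C) :
  ext_hom (fcomp infL x y) = Defs.comp (pstr P) (ext_hom x) (ext_hom y).
Proof.
apply: Arrow_inj; rewrite -acompE.
have [J xJ] := rep_ex x; have [K yK d] := rep_dis infL y xJ.
exact: FhomP (fcompP infL xJ yK d) (value_comp d (ext_hom_rep xJ) (ext_hom_rep yK)).
Qed.

Lemma ext_hom_tens A B C D (x : fmor A B) (y : fmor C D) :
  hom_cast (map_cat (smob w) A C) (map_cat (smob w) B D) (ext_hom (ftens infL x y)) =
  tens (pstr P) (ext_hom x) (ext_hom y).
Proof.
apply: Arrow_inj; rewrite arrow_cast.
have [J xJ] := rep_ex x; have [K yK d] := rep_dis infL y xJ.
exact: FhomP (ftensP infL xJ yK d) (value_tens d (ext_hom_rep xJ) (ext_hom_rep yK)).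
Qed.

Lemma ext_hom_symm A B :
  hom_cast (map_cat (smob w) A B) (map_cat (smob w) B A) (ext_hom (fsymm L A B)) =
  symm (pstr P) (map (smob w) A) (map (smob w) B).
Proof.
by apply: Arrow_inj; rewrite arrow_cast; exact: FhomP (fsymmP L A B) (value_symm A B).
Qed.

Definition free_ext : prop_mor (PropCat (freeS G infL)) P :=
  @PropMor (PropCat (freeS G infL)) P (smob w) ext_hom
    ext_hom_id ext_hom_comp ext_hom_tens ext_hom_symm.

Lemma free_ext_eta f : Arrow (pmhom free_ext (ahom (eta_arr infL f))) = smarr w f.
Proof. exact: FhomP (mk_rep _) (value_gen _ _). Qed.

End Interpretation.

(** * Uniqueness of the extension *)

Section Uniqueness.
Variables (G : signature) (L : eqType).
Hypothesis infL : infinite_set [set: L].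
Local Notation term := (term G L).
Local Notation judgment := (judgment G L).
Local Notation fmor := (@fmor G L).
Local Notation freeP := (PropCat (freeS G infL)).
Implicit Types (A B C D : seq (sob G)) (f h : sarr G) (t n : term) (N Ms Zs : seq term).
Implicit Types (J K M : judgment) (phi psi : arrow freeP).
Local Notation is_scal := (@is_scal G L).
Local Notation Var := (@Var G L).

Local Notation aid := (@aid freeP).
Local Notation asym := (@asym freeP).
Local Notation pm := (@pm freeP _).
Local Notation obs := (@obs freeP _).

(** J represents phi, for phi an arrow of the prop of judgments packed with its
    ends. *)
Definition arrow_rep (phi : arrow freeP) J : Prop := reps (ahom phi : fmor _ _) J.

Lemma arrow_rep_eq phi psi J : arrow_rep phi J -> arrow_rep psi J ->
  asrc phi = asrc psi -> atgt phi = atgt psi -> phi = psi.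
Proof.
case: phi psi => A B x [A' B' y] xJ yJ /= eA eB; subst A' B'.
by congr Arrow; exact: fmor_eq xJ yJ.
Qed.

Lemma arrow_rep_sim phi J K : arrow_rep phi J -> jsim J K -> arrow_rep phi K.
Proof. exact: rep_sim. Qed.

Lemma arrow_rep_comp phi psi J K : atgt phi = asrc psi ->
  arrow_rep phi J -> arrow_rep psi K ->
  dis J K -> arrow_rep (phi >> psi) (comp_judgment J K).
Proof.
case: phi psi => A B x [B' C y] /= e xJ yK d; subst B'.
by rewrite acompE; exact: fcompP.
Qed.

Lemma arrow_rep_tens phi psi J K : arrow_rep phi J -> arrow_rep psi K -> dis J K ->
  arrow_rep (phi ** psi) (tens_judgment (size (asrc phi)) J K).
Proof. by case: phi psi => A B x [C D y] xJ yK d; exact: ftensP. Qed.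

Lemma arrow_rep_id A : arrow_rep (aid A) (id_judgment L A).
Proof. exact: fidP. Qed.

Lemma arrow_rep_asym A B : arrow_rep (asym A B) (symm_judgment L A B).
Proof. exact: fsymmP. Qed.

Lemma size_obs (X : eqType) (ty : X -> seq (sob G)) (s : seq X) :
  {in s, forall x, size (ty x) = 1} -> size (obs ty s) = size s.
Proof.
elim: s => //= x s IH h; rewrite obs_cons size_cat h ?mem_head // IH // => y ys.
by apply: h; rewrite inE ys orbT.
Qed.

(** The j-th output is the variable at the position in s of the j-th wire of t. *)
Lemma arrow_rep_pm (X : eqType) (ty : X -> seq (sob G)) (s t : seq X) :
  perm_eq s t -> {in s, forall x, size (ty x) = 1} -> uniq s ->
  arrow_rep (pm ty s t) (Judgment (map (fun x => Var (index x s)) t) [::]).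
Proof.
elim: s t => [|x s IH] t.
  by rewrite perm_sym => /perm_nilP -> _ _; exact: arrow_rep_id.
move=> /perm_split[t1 [t2 [-> xt1 st]]] h1 /= /andP[xs us]; rewrite pm_cons //.
have sx : size (ty x) = 1 by apply: h1; rewrite mem_head.
have h1s : {in s, forall x, size (ty x) = 1}.
  by apply: sub_in1 h1 => y ys; rewrite inE ys orbT.
have h1t : {in t1 ++ t2, forall x, size (ty x) = 1}.
  by apply: sub_in1 h1s => y; rewrite (perm_mem st).
have s1 : size (obs ty t1) = size t1.
  by apply: size_obs; apply: sub_in1 h1t => y yt; rewrite mem_cat yt.
have s2 : size (obs ty t2) = size t2.
  by apply: size_obs; apply: sub_in1 h1t => y yt; rewrite mem_cat yt orbT.
have htg := @atgt_pm freeP X ty _ _ st; rewrite obs_cat in htg.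
have r1 := arrow_rep_tens (arrow_rep_id (ty x)) (IH _ st h1s us) (@dis_wiresl _ _ _ _).
have r2 := arrow_rep_tens (arrow_rep_asym (ty x) (obs ty t1))
  (arrow_rep_id (obs ty t2)) (@dis_wiresl _ _ _ _).
have e12 : atgt (aid (ty x) ** pm ty s (t1 ++ t2)) =
    asrc (asym (ty x) (obs ty t1) **
      aid (obs ty t2)) by ends.
have r := arrow_rep_comp e12 r1 r2
  (dis_tensr _ (@dis_wiresl _ _ _ _) (@dis_wiresl _ _ _ _)).
apply: (arrow_rep_sim r).
split=> //=.
rewrite sx size_cat sx s1.
set W := vars L (ty x) ++ _.
have -> : W = map (fun y => Var (index y (x :: s))) (x :: t1 ++ t2).
  rewrite /W /vars sx /= eqxx; congr cons; rewrite -map_comp.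
  apply/eq_in_map => y yt /=; case: eqP => // yx.
  by move: xs; rewrite (perm_mem st) yx yt.
set gg := fun y => Var (index y (x :: s)).
rewrite -[RHS]/(map gg (t1 ++ x :: t2)) /= {W}.
have -> : gg x :: map gg (t1 ++ t2) = [:: gg x] ++ map gg t1 ++ map gg t2.
  by rewrite map_cat.
rewrite /vars shift_wires addn0 s2 !map_cat.
rewrite (subst_block (Ms1 := [:: gg x])) ?size_map // -catA; congr (_ ++ _ :: _).
have := @subst_block G L ([:: gg x] ++ map gg t1) (map gg t2) [::] (1 + size t1) (size t2).
by rewrite cats0 -catA => -> //=; rewrite size_map.
Qed.

Local Notation eta := (free_eta G infL).
Local Notation ewire_ob := (wire_ob (L := L) eta).
Local Notation enode_arrow := (node_arrow (L := L) eta).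
Local Notation run := (run (@nin G L) (@nout G L)).
Local Notation esem A := (sem (@nin G L) (@nout G L) (ewire_ob A) enode_arrow).

Lemma wire_ob_size A (s : seq term) : {in s, forall x, tyo A x <> None} ->
  {in s, forall x, size (ewire_ob A x) = 1}.
Proof. by move=> h x /h; rewrite /wire_ob; case: tyo. Qed.

(** The judgment of the generator of n becomes n when the arguments of n are
    substituted for its variables. *)
Lemma node_arrow_rep A n : is_node A n -> exists f a,
  [/\ enode_arrow n = eta_arr infL f, {subset jlabels (gen_judgment f a) <= clab n} &
   forall r, (forall i, i < size (nin n) -> r i = nth (Var i) (nin n) i) ->
     map (subst r) (jtms (gen_judgment f a)) = nout n /\
     map (subst r) (jscals (gen_judgment f a)) = filter is_scal [:: n] /\
     size (nin n) = size (sdom f)].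
Proof.
have SV f Ms r : size Ms = size (sdom f) ->
    (forall i, i < size Ms -> r i = nth (Var i) Ms i) ->
    map (subst r) (vars L (sdom f)) = Ms.
  move=> sM hr; rewrite -map_comp; apply: (@eq_from_nth _ (Var 0)).
    by rewrite size_map size_iota.
  move=> i; rewrite size_map size_iota => id_.
  rewrite (nth_map 0) ?size_iota //= nth_iota //= add0n hr ?sM //.
  by apply: set_nth_default; rewrite sM.
have VL B : flatten (map (@labels G L) (vars L B)) = [::].
  by rewrite /vars; elim: (iota _ _).
have ST f Ms : map (tyo A) Ms = map Some (sdom f) -> size Ms = size (sdom f).
  by move=> tM; rewrite -(size_map (tyo A)) tM size_map.
case: n => //= [f b k|f Ms k|f Ms].
- case=> _ d0 f0; exists f, b; split=> //.
    move=> a; rewrite /gen_judgment; case: nilP => // _; rewrite d0 /=.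
    case/flatten_mapP => t; rewrite cats0 => /mem_csts[i _ ->] /=.
    by rewrite inE.
  move=> r _; rewrite /gen_judgment d0; case: nilP => //= _.
  by split=> //; rewrite -map_comp.
- case=> _ d0 f0 tM; exists f, (label0 infL); split=> //.
    move=> a; rewrite /gen_judgment; case: nilP => // _; case: nilP => // _.
    case/flatten_mapP => t; rewrite cats0 => /mem_apps[i _ ->] /=.
    by rewrite VL.
  move=> r hr; have sM := ST _ _ tM; rewrite /gen_judgment; case: nilP => // _.
  case: nilP => // _; split=> //.
  rewrite -map_comp; apply: eq_map => i /=; congr (App _ _ _).
  exact: SV.
- case=> f0 tM; exists f, (label0 infL); split=> //.
    by move=> a; rewrite /gen_judgment f0 /jlabels /= VL.
  move=> r hr; have sM := ST _ _ tM; rewrite /gen_judgment f0 /=.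
  by split=> //; split=> //; congr [:: Scal _ _]; exact: SV.
Qed.

Lemma arrow_rep_perm A phi (s t : seq term) Zs :
  arrow_rep phi (Judgment s Zs) -> atgt phi = obs (ewire_ob A) s ->
  {in s, forall x, tyo A x <> None} -> uniq s -> perm_eq s t ->
  arrow_rep (phi >> pm (ewire_ob A) s t) (Judgment t Zs).
Proof.
move=> r e ts us st; have rp := arrow_rep_pm st (wire_ob_size ts) us.
have e' : atgt phi = asrc (pm (ewire_ob A) s t) by rewrite e asrc_pm.
have W : map (fun x => Var (index x s)) t = map Var (map (index^~ s) t).
  by rewrite -map_comp.
have d : dis (Judgment s Zs) (Judgment (map (fun x => Var (index x s)) t) [::]).
  by rewrite W; exact: dis_wiresr.
apply: (arrow_rep_sim (arrow_rep_comp e' r rp d)); split=> //=.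
rewrite -map_comp -[RHS]map_id; apply/eq_in_map => x xt /=.
by rewrite /subst_list /= nth_index // (perm_mem st).
Qed.

(** The labels are recorded because later nodes have to avoid them. *)
Lemma arrow_rep_node A phi n (u : seq term) Zs : is_node A n ->
  arrow_rep phi (Judgment (nin n ++ u) Zs) -> atgt phi = obs (ewire_ob A) (nin n ++ u) ->
  {in u, forall x, tyo A x <> None} ->
  {in clab n, forall a, a \notin jlabels (Judgment (nin n ++ u) Zs)} ->
  arrow_rep (phi >> (enode_arrow n ** aid (obs (ewire_ob A) u)))
    (Judgment (nout n ++ u) (filter is_scal [:: n] ++ Zs)) /\
  {subset jlabels (Judgment (nout n ++ u) (filter is_scal [:: n] ++ Zs)) <=
    jlabels (Judgment (nin n ++ u) Zs) ++ clab n}.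
Proof.
move=> gn r e tu dn; have [f [a [Ev sl sr]]] := node_arrow_rep gn.
have [vi vo] := node_arrow_typed eta gn.
have rg : arrow_rep (enode_arrow n) (gen_judgment f a) by rewrite Ev; exact: eta_rep.
have rt := arrow_rep_tens rg (arrow_rep_id (obs (ewire_ob A) u)) (@dis_wiresr _ _ _ _).
have e' : atgt phi = asrc (enode_arrow n ** aid (obs (ewire_ob A) u)).
  by rewrite e obs_cat /= vi.
have dg : dis (gen_judgment f a) (Judgment (nin n ++ u) Zs) by move=> b /sl /dn.
have d : dis (Judgment (nin n ++ u) Zs) (tens_judgment (size (asrc (enode_arrow n)))
    (gen_judgment f a) (id_judgment L (obs (ewire_ob A) u))).
  exact: (dis_tensr _ dg (@dis_wiresl _ _ _ _)).
have hr i : i < size (nin n) -> nth (Var i) (nin n ++ u) i = nth (Var i) (nin n) i.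
  by move=> ilt; rewrite nth_cat ilt.
have [sr1 [sr2 sr3]] := sr _ hr.
have sa : size (asrc (enode_arrow n)) = size (nin n).
  by rewrite sr3 Ev.
have E : comp_judgment (Judgment (nin n ++ u) Zs) (tens_judgment (size (asrc (enode_arrow n)))
    (gen_judgment f a) (id_judgment L (obs (ewire_ob A) u))) =
    Judgment (nout n ++ u) (filter is_scal [:: n] ++ Zs).
  congr Judgment; last by rewrite /= sr2.
  rewrite /= map_cat sr1; congr (_ ++ _).
  rewrite /vars shift_wires addn0 sa (size_obs (wire_ob_size tu)).
  have := @subst_block G L (nin n) u [::] (size (nin n)) (size u).
  by rewrite cats0 => ->.
have rc := arrow_rep_comp e' r rt d; rewrite E in rc; split=> //.
rewrite -E => b /comp_labels; rewrite !mem_cat => /orP[->//|/tens_labels].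
by rewrite mem_cat jlabels_wires orbF => /sl ->; rewrite orbT.
Qed.

(** Running nodes after a morphism amounts to adding these nodes to a judgment
    that represents it. *)
Lemma arrow_rep_sem A N (s t : seq term) Zs phi :
  {in N, forall n, is_node A n} -> uniq (labs N) ->
  arrow_rep phi (Judgment s Zs) -> atgt phi = obs (ewire_ob A) s ->
  {in s, forall x, tyo A x <> None} ->
  {in labs N, forall a, a \notin jlabels (Judgment s Zs)} ->
  run s N t ->
  exists2 Zs', perm_eq Zs' (filter is_scal N ++ Zs) &
    arrow_rep (phi >> esem A s N t) (Judgment t Zs').
Proof.
elim: N s Zs phi => [|n N IH] s Zs phi gN ul r e ts dl /=.
  by case=> us st; exists Zs => //; exact: arrow_rep_perm.
case/run_inv => us p h; set u := remaining _ s n in p h *.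
have gn := gN _ (mem_head _ _).
have us1 : uniq s by move: us; rewrite cat_uniq => /and3P[].
have r1 := arrow_rep_perm r e ts us1 p.
have tsu : {in u, forall x, tyo A x <> None}.
  by move=> x; rewrite mem_filter => /andP[_ /ts].
have hp := atgt_pm (ewire_ob A) p.
have [vi vo] := node_arrow_typed eta gn.
have e1 : atgt (phi >> pm (ewire_ob A) s (nin n ++ u)) = obs (ewire_ob A) (nin n ++ u).
  by rewrite atgt_comp ?hp // e asrc_pm.
have jl : jlabels (Judgment (nin n ++ u) Zs) =i jlabels (Judgment s Zs).
  by apply/perm_mem/perm_flatten/perm_map; rewrite perm_cat2r perm_sym.
have dn : {in clab n, forall a, a \notin jlabels (Judgment (nin n ++ u) Zs)}.
  move=> a an; rewrite jl; apply: dl.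
  by rewrite /labs /= mem_cat an.
have [r2 sub] := arrow_rep_node gn r1 e1 tsu dn.
have e2 : atgt (phi >> pm (ewire_ob A) s (nin n ++ u) >>
      (enode_arrow n ** aid (obs (ewire_ob A) u))) =
    obs (ewire_ob A) (nout n ++ u).
  by rewrite atgt_comp ?e1 /= ?vi ?vo ?obs_cat.
have [] := IH _ _ _ _ _ r2 e2 _ _ h.
- by move=> m mN; apply: gN; rewrite inE mN orbT.
- by move: ul; rewrite /labs /= cat_uniq => /and3P[].
- move=> x; rewrite mem_cat => /orP[xn|/tsu //].
  by have [Bs tB] := tyo_nout gn; move: xn;
    elim: (nout n) Bs tB => // y ys IHy [|b Bs] // [ty /IHy {}IHy];
    rewrite inE => /predU1P[->|//]; rewrite ty.
- move=> a aN; apply/negP => /sub; rewrite mem_cat jl => /orP[aJ|an].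
    by have := dl a; rewrite /labs /= mem_cat aN orbT aJ => /(_ isT).
  by move: ul; rewrite /labs /= cat_uniq => /and3P[_ /hasPn/(_ _ aN)/negP].
move=> Zs' pZ r3; exists Zs'.
  rewrite (permPl pZ); apply/permP => a; rewrite /= !count_cat.
  by case: (is_scal n); rewrite /= ?addn0; lia.
move: r3; congr (arrow_rep _ _).
have hs := asrc_sem (@nin G L) (@nout G L) (ewire_ob A) enode_arrow (nout n ++ u) N t.
rewrite obs_cat in hs; rewrite obs_cat in hp.
rewrite !acompA // ?atgt_comp /= ?hp ?vi ?vo ?e ?asrc_comp ?asrc_pm ?hs ?obs_cat //.
Qed.

(** The run of J starts from the variables, which represent the identity, and
    ends with the terms of J. *)
Lemma free_value A B (x : fmor A B) J phi : x J -> value eta A J B phi ->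
  phi = @Arrow freeP _ _ x.
Proof.
move=> xJ s; have e1 := value_src s; have e2 := value_tgt s.
case: s => N [g h E].
have [] := arrow_rep_sem (good_node g) (good_labs g) (arrow_rep_id A) _ _ _ h.
- by rewrite (@obs_vars G L freeP eta A) map_id.
- move=> y yv; apply: (good_typed g); by rewrite mem_cat yv.
- by move=> a _; rewrite jlabels_wires.
move=> Zs'; rewrite cats0 => pZ r.
rewrite acomp_idl in r; last by rewrite asrc_sem (@obs_vars G L freeP eta A) map_id.
rewrite -E in r; apply: (arrow_rep_eq (J := J)).
- apply: (arrow_rep_sim r); split=> //=.
  by rewrite (permPl pZ) (good_scal g).
- exact: xJ.
- by rewrite e1 map_id.
- by rewrite e2 map_id.
Qed.

Section Ext.
Variables (P : prop_cat) (F : prop_mor freeP P).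
Let w := sig_comp (underlying_mor F) eta.

(** F maps the run of J in the prop of judgments to the run of J in P. *)
Lemma value_amap A B J phi : value eta A J B phi -> value w A J B (amap F phi).
Proof.
case=> N [g h ->]; exists N; split=> //; rewrite amap_sem //; last first.
  exact: nodes_typed (good_node g).
congr (sem _ _ _ _ _ _ _); apply/funext => n.
  by rewrite /wire_ob; case: tyo.
by case: n => // i; rewrite amap_id.
Qed.

Lemma free_ext_unique A B (x : fmor A B) : ext_hom w x = pmhom F x.
Proof.
have [J xJ] := rep_ex x; have [phi s] := value_ex eta (rep_derives xJ).
apply: Arrow_inj; rewrite (FhomP xJ (value_amap s)).
by rewrite (free_value xJ s).
Qed.

End Ext.

End Uniqueness.

Lemma PropMor_eq (P Q : prop_cat) o h h' c1 c2 c3 c4 d1 d2 d3 d4 :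
  (forall A B (x : phom A B), h A B x = h' A B x) ->
  @PropMor P Q o h c1 c2 c3 c4 = @PropMor P Q o h' d1 d2 d3 d4.
Proof.
move=> E; have Eh : h = h' by do 3 apply/functional_extensionality_dep => ?.
by subst h'; congr PropMor; exact: Prop_irrelevance.
Qed.

Lemma sig_mor_eq (G H : signature) o (u u' : sarr G -> sarr H) c1 c2 d1 d2 :
  u =1 u' -> @SigMor G H o u c1 c2 = @SigMor G H o u' d1 d2.
Proof.
by move=> /funext E; subst u'; congr SigMor; exact: Prop_irrelevance.
Qed.

Theorem theorem5p15 (G : signature) (L : Type) (infL : infinite_set [set: L]) :
  exists (S : prop_structure (@fmor G L))
         (eta : sig_mor G (underlying (PropCat S))),
    [/\ is_free_structure S,
        is_generator_inclusion eta
      & forall (P : prop_cat) (w : sig_mor G (underlying P)),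
          exists! F : prop_mor (PropCat S) P,
            sig_comp (underlying_mor F) eta = w].
Proof.
pose iL : infinite_set [set: {classic L}] := infL.
exists (freeS G iL), (free_eta G iL); split.
- exact: (@freeS_free G {classic L} iL).
- exact: (@eta_inclusion G {classic L} iL).
- move=> P w; exists (free_ext iL w); split.
    case: w => o u c1 c2; apply: sig_mor_eq => f.
    exact: (free_ext_eta iL (SigMor c1 c2) f).
  move=> F <-; have H := @free_ext_unique G {classic L} iL P F.
  case: F H => o h c1 c2 c3 c4 H; apply: PropMor_eq => A B x.
  exact: H.
Qed.
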